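(* Let $G=(G_{j,j'})_{1\le j,j'\le d}$ be a positive semidefinite matrix valued, even measure on the torus $[-\pi,\pi)^\nu$ (a matrix valued spectral measure). (1) There exists a vector valued random spectral measure $Z_G=(Z_{G,1},\dots,Z_{G,d})$ corresponding to $G$. (2) For such $Z_G$ the random integrals $\int u(x)Z_{G,j}(dx)$, defined for all $1\le j\le d$ and $u\in\mathcal{K}^c_{1,j}$, are linear in $u$ and satisfy: (a) $E\left(\int u(x)Z_{G,j}(dx)\,\overline{\int v(x)Z_{G,j'}(dx)}\right)=\int u(x)\overline{v(x)}\,G_{j,j'}(dx)$ for all $u\in\mathcal{K}^c_{1,j}$, $v\in\mathcal{K}^c_{1,j'}$, $1\le j,j'\le d$; (b) $E\int u(x)Z_{G,j}(dx)=0$ for all $u\in\mathcal{K}^c_{1,j}$, $1\le j\le d$; (c) $\int u(x)Z_{G,j}(dx)$ is real valued if $u\in\mathcal{K}^c_{1,j}$ and $u(-x)=\overline{u(x)}$ for $\mu$-almost all $x\in[-\pi,\pi)^\nu$, $1\le j\le d$. (3) The formula $$X_j(p)=\int_{[-\pi,\pi)^\nu}e^{i(p,x)}Z_{G,j}(dx),\qquad 1\le j\le d,\ p\in\mathbb{Z}^\nu,$$ defines a $d$-dimensional vector valued Gaussian stationary random field (with expectation zero) whose matrix valued spectral measure is $G$. (4) If a $d$-dimensional vector valued Gaussian stationary random field $X(p)=(X_1(p),\dots,X_d(p))$, $p\in\mathbb{Z}^\nu$, with expectation zero and matrix valued spectral measure $G$ is given, and $Z_{G,j}(A)=T_j(\mathbf{1}_A)$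 is the random spectral measure constructed from this field by means of the operators $T_j$ (see context), then $\int_{[-\pi,\pi)^\nu}e^{i(p,x)}Z_{G,j}(dx)=X_j(p)$ for all $1\le j\le d$ and $p\in\mathbb{Z}^\nu$.
   Context: The torus $[-\pi,\pi)^\nu$ is obtained by identifying coordinates modulo $2\pi$; sets are Borel measurable, and $-A=\{-x:x\in A\}$. Positive semidefinite matrix valued, even measure on the torus: complex measures $G_{j,j'}$, $1\le j,j'\le d$, of finite total variation on $[-\pi,\pi)^\nu$ such that for some finite positive measure $\mu$ all $G_{j,j'}$ are absolutely continuous with respect to $\mu$, the matrix $(g_{j,j'}(x))$, $g_{j,j'}=\frac{dG_{j,j'}}{d\mu}$, is positive semidefinite for $\mu$-almost all $x$, and $G_{j,j'}(-A)=\overline{G_{j,j'}(A)}$ for all $A$ and $j,j'$. One fixes such a $\mu$ which is moreover even ($\mu(-A)=\mu(A)$). Gaussian stationary random field: real valued random vectors $X(p)=(X_1(p),\dots,X_d(p))$, $p\in\mathbb{Z}^\nu$, all finite collections of which are jointly Gaussian, and whose finite dimensional distributions are invariant under the shifts $p\mapsto p+m$, $m\in\mathbb{Z}^\nu$. A field with expectation zero has matrix valued spectral measure $G$ if $EX_j(p)X_{j'}(q)=\int_{[-\pi,\pi)^\nu}e^{i(p-q,x)}G_{j,j'}(dx)$ for all $1\le j,j'\le d$, $p,q\in\mathbb{Z}^\nu$. Vector valued random spectral measure corresponding to $G$: a set of complex valued random variables $Z_{G,j}(A)$ indexed by $1\le j\le d$ and Borel sets $A\subset[-\pi,\pi)^\nu$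 such that (i) for any sets $A_1,\dots,A_N$ the random variables $\mathrm{Re}\,Z_{G,j}(A_s)$, $\mathrm{Im}\,Z_{G,j}(A_s)$, $1\le s\le N$, $1\le j\le d$, are jointly Gaussian; (ii) $EZ_{G,j}(A)=0$; (iii) $EZ_{G,j}(A)\overline{Z_{G,j'}(B)}=G_{j,j'}(A\cap B)$ for all $1\le j,j'\le d$ and $A,B$; (iv) $\sum_{s=1}^nZ_{G,j}(A_s)=Z_{G,j}\left(\bigcup_{s=1}^nA_s\right)$ for disjoint $A_1,\dots,A_n$; (v) $Z_{G,j}(A)=\overline{Z_{G,j}(-A)}$. (Identities between random variables hold with probability 1.) $\mathcal{K}^c_{1,j}$ is the complex Hilbert space of complex valued functions $u$ on $[-\pi,\pi)^\nu$ with $\int|u(x)|^2G_{j,j}(dx)<\infty$, with norm $\left(\int|u|^2dG_{j,j}\right)^{1/2}$. Random integral: for an elementary function $u=\sum_{s=1}^Nc_s\mathbf{1}_{A_s}$ ($A_s$ disjoint, $c_s\in\mathbb{C}$), $\int u(x)Z_{G,j}(dx)=\sum_{s=1}^Nc_sZ_{G,j}(A_s)$; this is norm preserving from a dense subspace of $\mathcal{K}^c_{1,j}$ into the complex $L_2$ space of random variables, and the integral of a general $u\in\mathcal{K}^c_{1,j}$ is defined by the unique continuous extension. Operators $T_j$: given a Gaussian stationary field $X$ with expectation zero and matrix valued spectral measure $G$, let $\mathcal{H}^c_{1,j}$ be the closure, in the complex Hilbert space of square integrable random variables with scalar product $E\xi\bar\eta$, of the finite linear combinations $\sum c_sX_j(p_s)$,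 $c_s\in\mathbb{C}$, $p_s\in\mathbb{Z}^\nu$. $T_j:\mathcal{K}^c_{1,j}\to\mathcal{H}^c_{1,j}$ is the unique norm preserving invertible linear transformation with $T_j\left(\sum c_se^{i(p_s,x)}\right)=\sum c_sX_j(p_s)$. *)

(* Defs.v *)
From HB Require Import structures.
From mathcomp Require Import all_boot all_order all_algebra.
From mathcomp Require Import sesquilinear.
From mathcomp Require Import all_classical all_reals all_analysis.
From mathcomp.real_closed Require Import complex.

Set Implicit Arguments.
Unset Strict Implicit.
Unset Printing Implicit Defensive.

Import Order.TTheory GRing.Theory Num.Theory.
Import numFieldNormedType.Exports.

Local Open Scope classical_set_scope.
Local Open Scope ring_scope.
Local Open Scope complex_scope.
Local Open Scope charge_scope.

Section torus.
Variable R : realType.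

Definition circle_carrier := {x : R | - pi <= x < pi}.

Fact circle0_subproof : - pi <= (0 : R) < pi.
Proof. by rewrite lerNl oppr0 pi_ge0 pi_gt0. Qed.

HB.instance Definition _ := Choice.on circle_carrier.
HB.instance Definition _ :=
  isPointed.Build circle_carrier (exist _ 0 circle0_subproof).

Definition circle_val (x : circle_carrier) : R := val x.

(* [-pi, pi[ with its Borel sigma-algebra; each point is the representative
   of its class modulo 2 pi *)
Definition circle := g_sigma_algebra_preimageType circle_val.

(* [insubd x y] is [y] when y lies in [-pi, pi[ and [x] otherwise; thus
   the opposite of the point - pi is - pi itself, as it must be mod 2 pi *)
Definition circle_opp (x : circle) : circle :=
  insubd (x : circle_carrier) (- circle_val x).

(* the library equips tuples with the product sigma-algebra *)
Definition torus (nu : nat) := (nu.-tuple circle)%type.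

Definition torus_opp nu (x : torus nu) : torus nu :=
  [tuple circle_opp (tnth x k) | k < nu].

(* x |-> exp (i (p, x)) *)
Definition character nu (p : 'rV[int]_nu) (x : torus nu) : R[i] :=
  let t := \sum_(k < nu) (p 0 k)%:~R * circle_val (tnth x k) in
  cos t +i* sin t.

End torus.

Section complex_functions.
Context {disp : measure_display} {T : measurableType disp} {R : realType}.
Implicit Types (u v : T -> R[i]).

Definition cmeasurable u :=
  measurable_fun setT (fun x => complex.Re (u x)) /\
  measurable_fun setT (fun x => complex.Im (u x)).

Definition sqmod (z : R[i]) : R := complex.Re z ^+ 2 + complex.Im z ^+ 2.

Definition cindic (A : set T) (x : T) : R[i] := (\1_A x)%:C.

(* [m] is only a set function because this is used both for probabilities and
   for the diagonal entries of a matrix valued measure, which are charges *)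
Definition L2 (m : set T -> \bar R) u :=
  cmeasurable u /\ (\int[m]_x (sqmod (u x))%:E < +oo)%E.

Definition L2norm (m : set T -> \bar R) u : \bar R :=
  ((\int[m]_x (sqmod (u x))%:E) `^ (2^-1))%E.

End complex_functions.

Section complex_measures.
Context {disp : measure_display} {T : measurableType disp} {R : realType}.

Definition charge_integral (nu : {charge set T -> \bar R}) (f : T -> R) : R :=
  let hP := cid (Hahn_decomposition nu) in
  let hN := cid (svalP hP) in
  \int[jordan_pos (svalP hN)]_x f x - \int[jordan_neg (svalP hN)]_x f x.

(* Charges are finite valued, hence of finite total variation. *)
Record complex_measure := ComplexMeasure {
  cmRe : {charge set T -> \bar R};
  cmIm : {charge set T -> \bar R} }.

Definition cmval (m : complex_measure) (A : set T) : R[i] :=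
  fine (cmRe m A) +i* fine (cmIm m A).

Definition cm_integral (m : complex_measure) (u : T -> R[i]) : R[i] :=
  let a x := complex.Re (u x) in let b x := complex.Im (u x) in
  (charge_integral (cmRe m) a - charge_integral (cmIm m) b) +i*
  (charge_integral (cmRe m) b + charge_integral (cmIm m) a).

Definition cm_dominated (m : complex_measure)
  (mu : {finite_measure set T -> \bar R}) := cmRe m `<< mu /\ cmIm m `<< mu.

Definition cm_density (m : complex_measure)
    (mu : {finite_measure set T -> \bar R}) (x : T) : R[i] :=
  fine (('d (cmRe m) '/d mu) x) +i* fine (('d (cmIm m) '/d mu) x).

End complex_measures.
Arguments complex_measure {disp} T R.
Coercion cmval : complex_measure >-> Funclass.

Definition psdmx (R : realType) n (A : 'M[R[i]]_n) :=
  (A \is hermsymmx) /\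
  forall v : 'rV[R[i]]_n, 0 <= (v *m A *m (map_mx Num.conj v)^T) 0 0.

Section matrix_measures.
Context {R : realType} {nu d : nat}.
Implicit Types (G : 'I_d -> 'I_d -> complex_measure (torus R nu) R)
  (mu : {finite_measure set (torus R nu) -> \bar R}).

Definition psd_density G mu :=
  (forall j j', cm_dominated (G j j') mu) /\
  {ae mu, forall x, psdmx (\matrix_(j, j') cm_density (G j j') mu x)}.

Definition even_measure mu :=
  forall A : set (torus R nu), measurable A ->
    mu (@torus_opp R nu @` A) = mu A.

Definition psd_even_measure G :=
  (exists mu, psd_density G mu) /\
  forall j j' (A : set (torus R nu)), measurable A ->
    G j j' (@torus_opp R nu @` A) = Num.conj (G j j' A).

(* The entry G j j is a nonnegative measure as soon as [psd_density G mu]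
   holds for some [mu]; its imaginary part is then zero. *)
Definition diag_measure G j : set (torus R nu) -> \bar R := cmRe (G j j).

Definition Kspace G j (u : torus R nu -> R[i]) := L2 (diag_measure G j) u.

End matrix_measures.

Section probability.
Context {R : realType} {disp : measure_display} {Omega : measurableType disp}.
Variable P : probability Omega R.

Definition cexpectation (xi : Omega -> R[i]) : R[i] :=
  fine 'E_P[fun w => complex.Re (xi w)]%E +i*
  fine 'E_P[fun w => complex.Im (xi w)]%E.

(* Degenerate normal laws are allowed. The case s = 0 is spelt out because
   the library's [normal_prob m 0] is not the Dirac mass at m. *)
Definition gaussian (xi : Omega -> R) :=
  measurable_fun setT xi /\
  exists m s : R, forall B : set R, measurable B ->
    P (xi @^-1` B) = if s == 0 then \d_m B else normal_prob m s B.

Definition jointly_gaussian (I : finType) (xi : I -> Omega -> R) :=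
  forall c : I -> R, gaussian (fun w => \sum_i c i * xi i w).

Section fields.
Context {nu d : nat}.
Implicit Types (G : 'I_d -> 'I_d -> complex_measure (torus R nu) R)
  (X : 'I_d -> 'rV[int]_nu -> Omega -> R)
  (Z : 'I_d -> set (torus R nu) -> Omega -> R[i])
  (I T : 'I_d -> (torus R nu -> R[i]) -> Omega -> R[i]).

Definition field_sample X N (p : 'I_N -> 'rV[int]_nu) (w : Omega) :
    N.-tuple (d.-tuple R) :=
  [tuple [tuple X j (p s) w | j < d] | s < N].

Definition gaussian_field X :=
  forall N (p : 'I_N -> 'rV[int]_nu),
    jointly_gaussian (fun k : 'I_N * 'I_d => X k.2 (p k.1)).

Definition stationary_field X :=
  forall N (p : 'I_N -> 'rV[int]_nu) (m : 'rV[int]_nu)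
    (B : set (N.-tuple (d.-tuple R))), measurable B ->
    P (field_sample X (fun s => p s + m) @^-1` B) =
    P (field_sample X p @^-1` B).

Definition zero_mean_field X := forall j p, ('E_P[X j p] = 0)%E.

Definition has_spectral_measure X G :=
  forall j j' p q,
    (fine 'E_P[fun w => (X j p w * X j' q w)%R]%E)%:C =
    cm_integral (G j j') (character (p - q)).

Definition gaussian_stationary_field_with X G :=
  [/\ gaussian_field X, stationary_field X, zero_mean_field X
    & has_spectral_measure X G].

Record random_spectral_measure G Z : Prop := RandomSpectralMeasure {
  rsm_gaussian : forall N (A : 'I_N -> set (torus R nu)),
    (forall s, measurable (A s)) ->
    jointly_gaussian (fun k : bool * ('I_N * 'I_d) =>
      let: (b, (s, j)) := k in
      fun w => if b then complex.Re (Z j (A s) w)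
               else complex.Im (Z j (A s) w));
  rsm_mean : forall j (A : set (torus R nu)), measurable A ->
    cexpectation (Z j A) = 0;
  rsm_cov : forall j j' (A B : set (torus R nu)),
    measurable A -> measurable B ->
    cexpectation (fun w => Z j A w * Num.conj (Z j' B w)) =
    G j j' (A `&` B);
  rsm_additive : forall j n (A : 'I_n -> set (torus R nu)),
    (forall s, measurable (A s)) -> trivIset setT A ->
    {ae P, forall w,
      \sum_(s < n) Z j (A s) w = Z j (\bigcup_(s in setT) A s) w};
  rsm_even : forall j (A : set (torus R nu)), measurable A ->
    {ae P, forall w, Z j A w = Num.conj (Z j (@torus_opp R nu @` A) w)} }.

(* [I j] is the continuous extension to [Kspace G j] (unique up to almost sure
   equality) of u |-> int u dZ_j from the elementary functions. *)
Record random_integral G Z I : Prop := RandomIntegral {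
  ri_L2 : forall j u, Kspace G j u -> L2 P (I j u);
  ri_elementary : forall j N (A : 'I_N -> set (torus R nu)) (c : 'I_N -> R[i]),
    (forall s, measurable (A s)) -> trivIset setT A ->
    {ae P, forall w, I j (fun x => \sum_(s < N) c s * cindic (A s) x) w =
                     \sum_(s < N) c s * Z j (A s) w};
  ri_continuous : forall j u, Kspace G j u ->
    forall eps : R, 0 < eps -> exists2 delta : R, 0 < delta &
      forall v, Kspace G j v ->
        (L2norm (diag_measure G j) (fun x => (u x - v x)%R) < delta%:E)%E ->
        (L2norm P (fun w => (I j u w - I j v w)%R) < eps%:E)%E }.

Definition Hspace X j (xi : Omega -> R[i]) :=
  L2 P xi /\
  forall eps : R, 0 < eps ->
    exists (N : nat) (c : 'I_N -> R[i]) (p : 'I_N -> 'rV[int]_nu),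
      (L2norm P (fun w => (xi w - \sum_(s < N) c s * (X j (p s) w)%:C)%R)
        < eps%:E)%E.

(* The elements of the Hilbert spaces are classes of functions modulo almost
   everywhere equality, hence the a.s. identities and the form of [si_onto];
   injectivity follows from [si_linear] and [si_norm]. *)
Record spectral_isometry G X T : Prop := SpectralIsometry {
  si_range : forall j u, Kspace G j u -> Hspace X j (T j u);
  si_onto : forall j xi, Hspace X j xi ->
    exists2 u, Kspace G j u & {ae P, forall w, T j u w = xi w};
  si_linear : forall j u v (a b : R[i]), Kspace G j u -> Kspace G j v ->
    {ae P, forall w, T j (fun x => a * u x + b * v x) w =
                     a * T j u w + b * T j v w};
  si_norm : forall j u, Kspace G j u ->
    L2norm P (T j u) = L2norm (diag_measure G j) u;
  si_character : forall j N (c : 'I_N -> R[i]) (p : 'I_N -> 'rV[int]_nu),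
    {ae P, forall w,
      T j (fun x => \sum_(s < N) c s * character (p s) x) w =
      \sum_(s < N) c s * (X j (p s) w)%:C} }.

End fields.
End probability.

(* Main.v *)
(** Since the density matrix is positive semidefinite, |G_jk(u conj(v))| is at most
    ||u||_j ||v||_k, so integration against G_jk is a contractive sesquilinear
    form on K_j x K_k. The random integral and the operators T_j are isometries
    obtained by closing up a map on a total family (indicators, resp. characters)
    that preserves inner products; two contractive forms agreeing on total
    families agree everywhere, which transfers covariances from one family to the
    other. L2-limits of normal variables are normal, and the reflection
    u |-> conj (u (- x)) is intertwined with complex conjugation, which gives the
    reality statements. Stationarity holds because a centred Gaussian vector is
    determined by its covariances (via its characteristic function).

    It remains to produce one Gaussian field with spectral measure G. Splitting
    the binary digits of a uniform variable into odd and even ones yields two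
    independent uniform variables; a quantile transform of the first and iteration
    on the second give an independent normal sequence. The covariance kernel
    prescribed by G is positive semidefinite on a countable set, so a Cholesky
    factorization realizes it by finite linear combinations of that sequence. *)

(* The function spaces are not quotiented by almost sure equality. An isometry is therefore handled
   through its graph [corr], which is linear, symmetric in its two sides and single-valued up to
   null sets; completeness of L2 shows that it is everywhere defined. An operator given by axioms,
   such as a random integral or some T_j, is first shown to have such a graph; its properties are
   then read off from the generating family through the record [generators]. Density of
   trigonometric polynomials is a monotone class argument. The sets whose indicators lie in the L2
   closure of an algebra of bounded functions form a sigma-algebra, and it contains every set h > 0
   with h in the closure, since the sign function is a pointwise limit of iterated cubics. With real
   instead of integer frequencies the same argument shows that a finite measure is determined by its
   characteristic function. The constructed field has to be real: evenness of G makes the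
   covariances of characters real. The kernel may be singular, so each new row of the Cholesky
   factor is solved for in the row space of the preceding block. *)
From HB Require Import structures.
Require Import Defs.
From mathcomp Require Import all_boot all_order all_algebra.
From mathcomp Require Import all_classical all_reals all_analysis.
From mathcomp.real_closed Require Import complex.
From mathcomp Require Import measurable_realfun ring lra.

Set Implicit Arguments.
Unset Strict Implicit.
Unset Printing Implicit Defensive.

Import HBNNSimple.
Import Order.TTheory GRing.Theory Num.Theory.
Import numFieldNormedType.Exports.

Local Open Scope classical_set_scope.
Local Open Scope ring_scope.
Local Open Scope complex_scope.

(** * Square-integrable complex functions *)

Section complex_facts.
Variable R : realType.
Implicit Types z w : R[i].

Lemma complex_ext z w :
  complex.Re z = complex.Re w -> complex.Im z = complex.Im w -> z = w.
Proof. by case: z => a b; case: w => a' b' /= -> ->. Qed.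

Lemma complex_Re_conj z : complex.Re (Num.conj z) = complex.Re z.
Proof. by case: z. Qed.

Lemma complex_Im_conj z : complex.Im (Num.conj z) = - complex.Im z.
Proof. by case: z. Qed.

Lemma Re_mul z w : complex.Re (z * w) =
  complex.Re z * complex.Re w - complex.Im z * complex.Im w.
Proof. by case: z; case: w. Qed.

Lemma Im_mul z w : complex.Im (z * w) =
  complex.Re z * complex.Im w + complex.Im z * complex.Re w.
Proof. by case: z; case: w. Qed.

Lemma conjM z w : Num.conj (z * w) = Num.conj z * Num.conj w.
Proof. exact: rmorphM. Qed.

Lemma conjD z w : Num.conj (z + w) = Num.conj z + Num.conj w.
Proof. exact: raddfD. Qed.

Lemma conjB z w : Num.conj (z - w) = Num.conj z - Num.conj w.
Proof. exact: raddfB. Qed.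

Lemma conj_sum n (f : 'I_n -> R[i]) :
  Num.conj (\sum_i f i) = \sum_i Num.conj (f i).
Proof. exact: raddf_sum. Qed.

Definition ReImE := (raddfD, raddfB, raddfN, Re_mul, Im_mul, complex_Re_conj,
  complex_Im_conj).

Lemma conj_real (a : R) : Num.conj (a%:C) = a%:C.
Proof. by apply: complex_ext; rewrite ?complex_Re_conj ?complex_Im_conj//= oppr0. Qed.

Lemma sqmod_ge0 z : 0 <= sqmod z.
Proof. by rewrite addr_ge0 ?sqr_ge0. Qed.

Lemma sqmodM z w : sqmod (z * w) = sqmod z * sqmod w.
Proof. by rewrite /sqmod !ReImE; ring. Qed.

Lemma sqmod_conj z : sqmod (Num.conj z) = sqmod z.
Proof. by rewrite /sqmod !ReImE sqrrN. Qed.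

Lemma sqmodN z : sqmod (- z) = sqmod z.
Proof. by rewrite /sqmod !raddfN/= !sqrrN. Qed.

Lemma sqmod_real (a : R) : sqmod a%:C = a ^+ 2.
Proof. by rewrite /sqmod/= expr0n addr0. Qed.

Lemma sqmod0 : sqmod (0 : R[i]) = 0.
Proof. by rewrite (sqmod_real 0) expr0n. Qed.

Lemma sqmodD_le z w : sqmod (z + w) <= 2 * sqmod z + 2 * sqmod w.
Proof.
rewrite /sqmod !ReImE /= !sqrrD.
have := sqr_ge0 (complex.Re z - complex.Re w).
have := sqr_ge0 (complex.Im z - complex.Im w); rewrite !sqrrB; lra.
Qed.

Lemma mul_conj z : z * Num.conj z = (sqmod z)%:C.
Proof. by apply: complex_ext; rewrite !ReImE/sqmod/=; ring. Qed.

Lemma sqmod_eq0 z : sqmod z = 0 -> z = 0.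
Proof.
move/eqP; rewrite /sqmod paddr_eq0 ?sqr_ge0// !sqrf_eq0 => /andP[/eqP a /eqP b].
exact: complex_ext.
Qed.

Lemma Re_mul_conj_le z w : `|complex.Re (z * Num.conj w)| <= (sqmod z + sqmod w) / 2.
Proof.
rewrite /sqmod !ReImE ler_norml; apply/andP; split;
  move: (complex.Re z) (complex.Im z) (complex.Re w) (complex.Im w) => {z w} p q r s.
  have := sqr_ge0 (p + r).
  by have := sqr_ge0 (q + s); rewrite !sqrrD; lra.
have := sqr_ge0 (p - r).
by have := sqr_ge0 (q - s); rewrite !sqrrB; lra.
Qed.

Lemma sqmodNi z : sqmod (- 'i * z) = sqmod z.
Proof. by rewrite sqmodM /sqmod/= oppr0 sqrrN expr0n expr1n add0r mul1r. Qed.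

(** Reduces statements about imaginary parts to real parts, multiplication by -i being isometric. *)
Lemma Im_Re z : complex.Im z = complex.Re (- 'i * z).
Proof. by rewrite !ReImE/=; ring. Qed.

Definition cmod z : R := Num.sqrt (sqmod z).

Lemma cmod_ge0 z : 0 <= cmod z. Proof. exact: sqrtr_ge0. Qed.

Lemma cmod_normE z : `|z| = (cmod z)%:C.
Proof. exact: normc_def. Qed.

Lemma cmodD z w : cmod (z + w) <= cmod z + cmod w.
Proof. by have := ler_normD z w; rewrite !cmod_normE -rmorphD lecR. Qed.

Lemma cmodN z : cmod (- z) = cmod z. Proof. by rewrite /cmod sqmodN. Qed.

Lemma cmodB z w : cmod (z - w) <= cmod z + cmod w.
Proof. by rewrite -(cmodN w) cmodD. Qed.

Lemma cmodM z w : cmod (z * w) = cmod z * cmod w.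
Proof. by rewrite /cmod sqmodM sqrtrM// sqmod_ge0. Qed.

Lemma cmod_conj z : cmod (Num.conj z) = cmod z.
Proof. by rewrite /cmod sqmod_conj. Qed.

Lemma sqr_cmod z : cmod z ^+ 2 = sqmod z.
Proof. by rewrite sqr_sqrtr// sqmod_ge0. Qed.

Lemma cmod_eq0 z : cmod z = 0 -> z = 0.
Proof. by move=> z0; apply: sqmod_eq0; rewrite -sqr_cmod z0 expr0n. Qed.

Lemma cmod_real (a : R) : cmod a%:C = `|a|.
Proof. by rewrite /cmod sqmod_real sqrtr_sqr. Qed.

Lemma cmod_Re z : `|complex.Re z| <= cmod z.
Proof. by rewrite -sqrtr_sqr ler_sqrt ?sqmod_ge0// lerDl sqr_ge0. Qed.

(** The discriminant of the quadratic s^2 a - 2 s r + b. The coefficient [a] may vanish, as it does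
    for functions of norm zero. *)
Lemma quad_le (a b r : R) : 0 <= a -> 0 <= b ->
  (forall s, 2 * s * r <= s ^+ 2 * a + b) -> r ^+ 2 <= a * b.
Proof.
move=> a0 b0 h; have [a00|an0] := eqVneq a 0.
  have r0 : r = 0.
    apply/eqP/negPn/negP => rn0.
    (* At this [s] the hypothesis would read 2 (b + 1) <= b. *)
    have := h ((b + 1) / r); rewrite a00 mulr0 add0r.
    by rewrite -[2 * _ * r]mulrA divfK//; lra.
  by rewrite r0 a00 expr0n mul0r.
(* r / a is the minimiser of the quadratic. *)
have := h (r / a); rewrite expr_div_n.
have -> : 2 * (r / a) * r = 2 * r ^+ 2 / a by field.
have -> : r ^+ 2 / a ^+ 2 * a = r ^+ 2 / a by field.
have apos : 0 < a by rewrite lt_def an0.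
set q := r ^+ 2 in apos *; rewrite -(ler_pdivrMl _ _ apos) mulrC; lra.
Qed.

(** The closing step of the approximation arguments. Errors may be taken below one, so that products
    of errors are absorbed in [K]. *)
Lemma arbitrarily_small (x K : R) : 0 <= K ->
  (forall e, 0 < e -> e < 1 -> x <= K * e) -> x <= 0.
Proof.
move=> K0 h; rewrite leNgt; apply/negP => x0.
pose e := Num.min (2^-1) (x / (2 * (K + 1))).
have K1 : 0 < 2 * (K + 1) by lra.
have e0 : 0 < e by rewrite /e lt_min invr_gt0 ltr0n divr_gt0.
have e1 : e < 1 by rewrite /e gt_min invf_lt1// ltr1n.
have := h e e0 e1.
have : e * (2 * (K + 1)) <= x by rewrite -ler_pdivlMr// /e ge_min lexx orbT.
by nra.
Qed.

End complex_facts.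

Section L2.
Context {disp : measure_display} {T : measurableType disp} {R : realType}.
Implicit Types (u v w : T -> R[i]) (a b : R[i]).

Lemma cmeasurableD u v : cmeasurable u -> cmeasurable v ->
  cmeasurable (fun x => u x + v x).
Proof.
move=> [u1 u2] [v1 v2]; split.
  under eq_fun do rewrite !raddfD /=; exact: measurable_funD.
under eq_fun do rewrite !raddfD /=; exact: measurable_funD.
Qed.

Lemma cmeasurableM u v : cmeasurable u -> cmeasurable v ->
  cmeasurable (fun x => u x * v x).
Proof.
move=> [u1 u2] [v1 v2]; split.
  under eq_fun do rewrite Re_mul.
  by apply: measurable_funB; exact: measurable_funM.
under eq_fun do rewrite Im_mul.
by apply: measurable_funD; exact: measurable_funM.
Qed.

Lemma cmeasurable_conj u : cmeasurable u -> cmeasurable (fun x => Num.conj (u x)).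
Proof.
move=> [u1 u2]; split; first by under eq_fun do rewrite complex_Re_conj.
by under eq_fun do rewrite complex_Im_conj; exact: measurableT_comp.
Qed.

Lemma cmeasurable_cst a : cmeasurable (fun _ : T => a).
Proof. by split; exact: measurable_cst. Qed.

Lemma cmeasurable_real (f : T -> R) : measurable_fun setT f ->
  cmeasurable (fun x => (f x)%:C).
Proof. by move=> mf; split => //=; exact: measurable_cst. Qed.

Lemma cmeasurable_lin a b u v : cmeasurable u -> cmeasurable v ->
  cmeasurable (fun x => a * u x + b * v x).
Proof.
by move=> ? ?; apply: cmeasurableD; apply: cmeasurableM => //;
  exact: cmeasurable_cst.
Qed.

Lemma measurable_sqmod u : cmeasurable u ->
  measurable_fun setT (fun x => sqmod (u x)).
Proof. by move=> [u1 u2]; apply: measurable_funD; exact: measurable_funX. Qed.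

Variable m : {finite_measure set T -> \bar R}.

Definition rint (f : T -> R) := m.-integrable setT (EFin \o f).

Lemma rint_measurable f : rint f -> measurable_fun setT f.
Proof. by move=> /integrableP[/measurable_EFinP]. Qed.

Lemma rint_le (f g : T -> R) : measurable_fun setT f -> rint g ->
  (forall x, `|f x| <= g x) -> rint f.
Proof.
move=> mf ig fg; apply: le_integrable ig => //; first exact/measurable_EFinP.
move=> x _ /=; by rewrite lee_fin (le_trans (fg x))// ler_norm.
Qed.

Lemma rintD f g : rint f -> rint g -> rint (fun x => f x + g x).
Proof.
by move=> i j; rewrite /rint (_ : _ \o _ = (EFin \o f) \+ (EFin \o g))%E//;
  exact: integrableD.
Qed.

Lemma rintZ k f : rint f -> rint (fun x => k * f x).
Proof.
move=> i; rewrite /rint (_ : _ \o _ = (fun x => k%:E * (EFin \o f) x)%E)//.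
exact: integrableZl.
Qed.

Lemma rintN f : rint f -> rint (fun x => - f x).
Proof.
by move=> /(rintZ (-1)); congr rint; apply/funext => x; rewrite mulN1r.
Qed.

Lemma rintB f g : rint f -> rint g -> rint (fun x => f x - g x).
Proof. by move=> i /rintN; exact: rintD. Qed.

Lemma rint_bounded (f : T -> R) (M : R) : measurable_fun setT f -> (forall x,
  `|f x| <= M) ->
  rint f.
Proof.
move=> mf fM; apply: (rint_le mf _ fM).
exact: finite_measure_integrable_cst.
Qed.

Definition cintegrable u :=
  rint (fun x => complex.Re (u x)) /\ rint (fun x => complex.Im (u x)).

Definition cint u : R[i] :=
  (\int[m]_x complex.Re (u x)) +i* (\int[m]_x complex.Im (u x)).

Lemma cintegrableZ a u : cintegrable u -> cintegrable (fun x => a * u x).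
Proof.
move=> [i j]; split.
  under eq_fun do rewrite Re_mul; apply: rintB; exact: rintZ.
under eq_fun do rewrite Im_mul; apply: rintD; exact: rintZ.
Qed.

Lemma cintegrableD u v : cintegrable u -> cintegrable v ->
  cintegrable (fun x => u x + v x).
Proof.
move=> [i j] [k l]; split.
  by under eq_fun do rewrite raddfD/=; exact: rintD.
by under eq_fun do rewrite raddfD/=; exact: rintD.
Qed.

Lemma cintZ a u : cintegrable u -> cint (fun x => a * u x) = a * cint u.
Proof.
move=> [i j]; apply: complex_ext; rewrite /= ?Re_mul ?Im_mul/=.
  under eq_Rintegral do rewrite Re_mul.
  by rewrite RintegralB// ?RintegralZl//; exact: rintZ.
under eq_Rintegral do rewrite Im_mul.
by rewrite RintegralD// ?RintegralZl//; exact: rintZ.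
Qed.

Lemma cintD u v : cintegrable u -> cintegrable v ->
  cint (fun x => u x + v x) = cint u + cint v.
Proof.
move=> [i j] [k l]; apply: complex_ext; rewrite /= ?raddfD/=.
  by under eq_Rintegral do rewrite raddfD/=; rewrite RintegralD.
by under eq_Rintegral do rewrite raddfD/=; rewrite RintegralD.
Qed.

Lemma cint_lin a b u v : cintegrable u -> cintegrable v ->
  cint (fun x => a * u x + b * v x) = a * cint u + b * cint v.
Proof.
by move=> iu iv; rewrite cintD ?cintZ//; exact: cintegrableZ.
Qed.

Lemma Rintegral0 : \int[m]_x (0 : R) = 0.
Proof. by rewrite /Rintegral integral0. Qed.

Lemma RintegralN (f : T -> R) : rint f -> \int[m]_x (- f x) = - \int[m]_x f x.
Proof.
move=> i; rewrite -[RHS]mulN1r -RintegralZl//.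
by apply: eq_Rintegral => x _; rewrite mulN1r.
Qed.

Lemma cint_conj u : cintegrable u ->
  cint (fun x => Num.conj (u x)) = Num.conj (cint u).
Proof.
move=> [i j]; apply: complex_ext; rewrite /= ?complex_Re_conj ?complex_Im_conj/=.
  by apply: eq_Rintegral => x _; rewrite complex_Re_conj.
by under eq_Rintegral do rewrite complex_Im_conj; rewrite RintegralN.
Qed.

Lemma eq_ae_Rintegral (f g : T -> R) : measurable_fun setT f ->
  measurable_fun setT g -> {ae m, forall x, f x = g x} ->
  \int[m]_x f x = \int[m]_x g x.
Proof.
move=> mf mg fg; congr fine; apply: ae_eq_integral => //; try exact/measurable_EFinP.
by apply: filterS fg => x fgx _; rewrite fgx.
Qed.

Lemma eq_ae_cint u v : cmeasurable u -> cmeasurable v ->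
  {ae m, forall x, u x = v x} -> cint u = cint v.
Proof.
move=> [mu1 mu2] [mv1 mv2] uv; congr (_ +i* _); apply: eq_ae_Rintegral => //;
  by apply: filterS uv => x ->.
Qed.

Lemma L2P u : L2 m u <-> cmeasurable u /\ rint (fun x => sqmod (u x)).
Proof.
split=> -[mu i]; split => //.
  apply/integrableP; split; first exact/measurable_EFinP/measurable_sqmod.
  by under eq_integral do rewrite /= ger0_norm ?sqmod_ge0//.
move/integrableP : i => [_].
by under eq_integral do rewrite /= ger0_norm ?sqmod_ge0//.
Qed.

Lemma L2_cmeasurable u : L2 m u -> cmeasurable u. Proof. by case. Qed.

Lemma L2_bounded u M : cmeasurable u -> (forall x, sqmod (u x) <= M) -> L2 m u.
Proof.
move=> mu uM; apply/L2P; split => //; apply: (@rint_bounded _ M) => //.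
  exact: measurable_sqmod.
by move=> x; rewrite ger0_norm// sqmod_ge0.
Qed.

Lemma L2_lin a b u v : L2 m u -> L2 m v -> L2 m (fun x => a * u x + b * v x).
Proof.
move=> /L2P[mu iu] /L2P[mv iv]; apply/L2P; split; first exact: cmeasurable_lin.
apply: (@rint_le _ (fun x => 2 * sqmod a * sqmod (u x) + 2 * sqmod b * sqmod (v x))).
- exact/measurable_sqmod/cmeasurable_lin.
- by apply: rintD; exact: rintZ.
- move=> x; rewrite ger0_norm ?sqmod_ge0// (le_trans (sqmodD_le _ _))//.
  by rewrite !sqmodM !mulrA.
Qed.

Lemma L2Z a u : L2 m u -> L2 m (fun x => a * u x).
Proof.
move=> iu; have := L2_lin a 0 iu iu; congr L2.
by apply/funext => x; rewrite mul0r addr0.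
Qed.

Lemma L2B u v : L2 m u -> L2 m v -> L2 m (fun x => u x - v x).
Proof.
move=> iu iv; have := L2_lin 1 (-1) iu iv; congr L2.
by apply/funext => x; rewrite mul1r mulN1r.
Qed.

Lemma L2_cst a : L2 m (fun=> a).
Proof. by apply: (@L2_bounded _ (sqmod a)) => //; exact: cmeasurable_cst. Qed.

Lemma L2_conj u : L2 m u -> L2 m (fun x => Num.conj (u x)).
Proof.
move=> [mu iu]; split; first exact: cmeasurable_conj.
by under eq_integral do rewrite sqmod_conj.
Qed.

Lemma L2_mul_conj u v : L2 m u -> L2 m v -> cintegrable (fun x => u x * Num.conj (v x)).
Proof.
move=> /L2P[mu iu] /L2P[mv iv].
have muv : cmeasurable (fun x => u x * Num.conj (v x)).
  by apply: cmeasurableM => //; exact: cmeasurable_conj.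
have i : rint (fun x => (sqmod (u x) + sqmod (v x)) / 2).
  by under eq_fun do rewrite mulrC; apply: rintZ; exact: rintD.
split; apply: rint_le i _; try by case: muv.
  by move=> x; exact: Re_mul_conj_le.
by move=> x; rewrite Im_Re mulrA -(sqmodNi (u x)); exact: Re_mul_conj_le.
Qed.

Lemma eq_ae_L2 u v : cmeasurable v -> {ae m, forall x, u x = v x} ->
  L2 m u -> L2 m v.
Proof.
move=> mv uv [mu iu]; split => //;
  rewrite (_ : (\int[m]_x _ = \int[m]_x (sqmod (u x))%:E)%E)//.
apply: ae_eq_integral => //; try exact/measurable_EFinP/measurable_sqmod.
by apply: filterS uv => x ->.
Qed.

Definition ip u v : R[i] := cint (fun x => u x * Num.conj (v x)).

Definition sq u : R := \int[m]_x sqmod (u x).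

Definition nrm u : R := Num.sqrt (sq u).

Lemma sq_ge0 u : 0 <= sq u.
Proof. by apply: Rintegral_ge0 => x _; exact: sqmod_ge0. Qed.

Lemma nrm_ge0 u : 0 <= nrm u. Proof. exact: sqrtr_ge0. Qed.

Lemma sqr_nrm u : nrm u ^+ 2 = sq u.
Proof. by rewrite sqr_sqrtr// sq_ge0. Qed.

Lemma ip_self u : ip u u = (sq u)%:C.
Proof.
rewrite /ip; under eq_fun do rewrite mul_conj.
by rewrite /cint/= Rintegral0.
Qed.

Lemma ip_linl a b u v w : L2 m u -> L2 m v -> L2 m w ->
  ip (fun x => a * u x + b * v x) w = a * ip u w + b * ip v w.
Proof.
move=> iu iv iw; rewrite /ip -cint_lin; try exact: L2_mul_conj.
by congr cint; apply/funext => x; rewrite mulrDl !mulrA.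
Qed.

Lemma ip_conj u v : L2 m u -> L2 m v -> ip v u = Num.conj (ip u v).
Proof.
move=> iu iv; rewrite /ip -cint_conj; last exact: L2_mul_conj.
by congr cint; apply/funext => x; rewrite conjM conjCK mulrC.
Qed.

Lemma ip_linr a b u v w : L2 m u -> L2 m v -> L2 m w ->
  ip w (fun x => a * u x + b * v x) =
  Num.conj a * ip w u + Num.conj b * ip w v.
Proof.
move=> iu iv iw; rewrite ip_conj//; last exact: L2_lin.
by rewrite ip_linl// conjD !conjM -!ip_conj.
Qed.

Lemma sqZ a u : L2 m u -> sq (fun x => a * u x) = sqmod a * sq u.
Proof.
move=> /L2P[_ iu]; rewrite /sq -RintegralZl//.
by apply: eq_Rintegral => x _; rewrite sqmodM.
Qed.

Lemma nrmZ a u : L2 m u -> nrm (fun x => a * u x) = cmod a * nrm u.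
Proof. by move=> iu; rewrite /nrm sqZ// sqrtrM// sqmod_ge0. Qed.

Lemma sqD u v : L2 m u -> L2 m v ->
  sq (fun x => u x + v x) = sq u + 2 * complex.Re (ip u v) + sq v.
Proof.
move=> iu iv; have h : complex.Re (ip (fun x => 1 * u x + 1 * v x) (fun x => 1 * u x +
  1 * v x)) =
    sq (fun x => 1 * u x + 1 * v x) by rewrite ip_self.
have -> : (fun x => u x + v x) = (fun x => 1 * u x + 1 * v x).
  by apply/funext => x; rewrite !mul1r.
rewrite -h ip_linl ?ip_linr//; try exact: L2_lin.
rewrite (conj_real 1) !mul1r (ip_conj iu iv) !ip_self !raddfD/=; lra.
Qed.

Lemma eq_ae_sq u v : cmeasurable u -> cmeasurable v ->
  {ae m, forall x, u x = v x} -> sq u = sq v.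
Proof.
move=> mu mv uv; apply: eq_ae_Rintegral; try exact: measurable_sqmod.
by apply: filterS uv => x ->.
Qed.

Lemma eq_ae_nrm u v : cmeasurable u -> cmeasurable v ->
  {ae m, forall x, u x = v x} -> nrm u = nrm v.
Proof. by move=> mu mv uv; rewrite /nrm (eq_ae_sq mu mv uv). Qed.

Lemma eq_ae_ip u v u' v' : L2 m u -> L2 m v -> L2 m u' -> L2 m v' ->
  {ae m, forall x, u x = u' x} -> {ae m, forall x, v x = v' x} ->
  ip u v = ip u' v'.
Proof.
move=> [mu _] [mv _] [mu' _] [mv' _] uu vv; apply: eq_ae_cint.
- by apply: cmeasurableM => //; exact: cmeasurable_conj.
- by apply: cmeasurableM => //; exact: cmeasurable_conj.
- by apply: filterS2 uu vv => x -> ->.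
Qed.

Lemma nrm_eq0 u : L2 m u -> nrm u = 0 -> {ae m, forall x, u x = 0}.
Proof.
move=> /[dup] iu /L2P[mu i] /eqP; rewrite sqrtr_eq0 => s0.
have s0' : sq u = 0 by apply/eqP; rewrite eq_le s0 sq_ge0.
have e0 : (\int[m]_x `|(sqmod (u x))%:E| = 0)%E.
  under eq_integral do rewrite /= ger0_norm ?sqmod_ge0//.
  by rewrite -[LHS]fineK; [congr EFin|exact: integrable_fin_num i].
have : ae_eq m setT (fun x => (sqmod (u x))%:E) (cst 0%E).
  apply/ae_eq_integral_abs => //; exact/measurable_EFinP/measurable_sqmod.
apply: filterS => x /(_ I) [] /sqmod_eq0 //.
Qed.

End L2.

(** * Sesquilinear forms bounded by the norms *)

Section forms.
Context {d1 : measure_display} {T1 : measurableType d1} {d2 : measure_display}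
  {T2 : measurableType d2} {R : realType}.
Variables (m1 : {finite_measure set T1 -> \bar R})
  (m2 : {finite_measure set T2 -> \bar R}).
Implicit Types b : (T1 -> R[i]) -> (T2 -> R[i]) -> R[i].

(** Linearity is an exact identity, but only for square-integrable arguments: that is where the
    integrals defining the forms are additive. *)
Record sesquilinear b : Prop := Sesquilinear {
  sesq_linl : forall a a' u u' v, L2 m1 u -> L2 m1 u' -> L2 m2 v ->
    b (fun x => a * u x + a' * u' x) v = a * b u v + a' * b u' v;
  sesq_linr : forall a a' u v v', L2 m1 u -> L2 m2 v -> L2 m2 v' ->
    b u (fun x => a * v x + a' * v' x) =
    Num.conj a * b u v + Num.conj a' * b u v' }.

Definition contractive_form b := forall u v, L2 m1 u -> L2 m2 v ->
  cmod (b u v) <= nrm m1 u * nrm m2 v.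

Lemma sesqZl b a u v : sesquilinear b -> L2 m1 u -> L2 m2 v ->
  b (fun x => a * u x) v = a * b u v.
Proof.
move=> sb iu iv; have := sesq_linl sb a 0 iu iu iv.
by rewrite mul0r addr0 => <-; congr b; apply/funext => x; rewrite mul0r addr0.
Qed.

Lemma sesqBl b u u' v : sesquilinear b -> L2 m1 u -> L2 m1 u' -> L2 m2 v ->
  b (fun x => u x - u' x) v = b u v - b u' v.
Proof.
move=> sb iu iu' iv; have := sesq_linl sb 1 (-1) iu iu' iv.
by rewrite mul1r mulN1r => <-; congr b; apply/funext => x; rewrite mul1r mulN1r.
Qed.

Lemma sesqBr b u v v' : sesquilinear b -> L2 m1 u -> L2 m2 v -> L2 m2 v' ->
  b u (fun x => v x - v' x) = b u v - b u v'.
Proof.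
move=> sb iu iv iv'; have := sesq_linr sb 1 (-1) iu iv iv'.
rewrite (conj_real 1) mul1r.
have -> : Num.conj (-1) = -1 :> R[i].
  by apply: complex_ext; rewrite ?complex_Re_conj ?complex_Im_conj//= !oppr0.
by rewrite mulN1r => <-; congr b; apply/funext => x; rewrite mul1r mulN1r.
Qed.

(* Replacing [u] by [s u] turns the hypothesis into a family of quadratic
   inequalities in [s], and a unimodular factor turns [Re] into the modulus. *)
Lemma contractive_formP b : sesquilinear b ->
  (forall u v, L2 m1 u -> L2 m2 v ->
    `|complex.Re (b u v)| <= (sq m1 u + sq m2 v) / 2) ->
  contractive_form b.
Proof.
move=> sb bb u v iu iv.
have Re_le w : L2 m1 w -> (complex.Re (b w v)) ^+ 2 <= sq m1 w * sq m2 v.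
  move=> iw; apply: quad_le; try exact: sq_ge0.
  move=> s; have := bb _ v (L2Z s%:C iw) iv.
  rewrite sesqZl// sqZ// sqmod_real Re_mul/= mul0r subr0.
  by move=> /(le_trans (ler_norm _)); lra.
set z := b u v; have := Re_le _ (L2Z (Num.conj z) iu).
rewrite sesqZl// -/z mulrC mul_conj/= sqZ// sqmod_conj.
have [z0 _|z0] := eqVneq (sqmod z) 0.
  by rewrite /cmod z0 sqrtr0 mulr_ge0// nrm_ge0.
have zpos : 0 < sqmod z by rewrite lt_def z0 sqmod_ge0.
rewrite expr2 -mulrA ler_pM2l// => h.
by rewrite /cmod /nrm -sqrtrM ?sq_ge0// ler_sqrt// mulr_ge0// sq_ge0.
Qed.

(** Joint continuity, by telescoping: b(u, v) - b(u', v') = b(u - u', v) + b(u', v - v'). *)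
Lemma form_dist b u u' v v' : sesquilinear b -> contractive_form b ->
  L2 m1 u -> L2 m1 u' -> L2 m2 v -> L2 m2 v' ->
  cmod (b u v - b u' v') <= nrm m1 (fun x => u x - u' x) * nrm m2 v +
    nrm m1 u' * nrm m2 (fun x => v x - v' x).
Proof.
move=> sb cb iu iu' iv iv'.
have -> : b u v - b u' v' = b (fun x => u x - u' x) v + b u' (fun x => v x - v' x).
  by rewrite (sesqBl sb)// (sesqBr sb)//; ring.
rewrite (le_trans (cmodD _ _))// lerD//; apply: cb => //; exact: L2B.
Qed.

End forms.

Section triangle.
Context {disp : measure_display} {T : measurableType disp} {R : realType}.
Variable m : {finite_measure set T -> \bar R}.
Implicit Types (u v w : T -> R[i]) (a b : R[i]).

Lemma sesquilinear_ip : sesquilinear m m (ip m).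
Proof. by split=> *; [exact: ip_linl|exact: ip_linr]. Qed.

(** Integrating |Re (u conj v)| <= (|u|^2 + |v|^2) / 2 gives the additive bound that
    [contractive_formP] sharpens to a product of norms. *)
Lemma cauchy_schwarz : contractive_form m m (ip m).
Proof.
apply: contractive_formP; first exact: sesquilinear_ip.
move=> u v iu iv; have [iR _] := L2_mul_conj iu iv.
have [/L2P[_ ju] /L2P[_ jv]] := (iu, iv).
rewrite (le_trans (le_normr_Rintegral _ _))// /sq -RintegralD//.
rewrite -[leRHS]mulrC -RintegralZl//; last exact: (rintD ju jv).
apply: le_Rintegral => //; first exact: integrable_norm iR.
  exact: (rintZ _ (rintD ju jv)).
by move=> x _; rewrite [2^-1 * _]mulrC; exact: Re_mul_conj_le.
Qed.

Lemma nrmD u v : L2 m u -> L2 m v ->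
  nrm m (fun x => u x + v x) <= nrm m u + nrm m v.
Proof.
move=> iu iv; rewrite -(@ler_pXn2r _ 2) ?nnegrE ?addr_ge0 ?nrm_ge0//.
rewrite sqr_nrm sqD// sqrrD !sqr_nrm.
have := le_trans (le_trans (ler_norm _) (cmod_Re _)) (cauchy_schwarz iu iv).
lra.
Qed.

Lemma nrm_distC u v : nrm m (fun x => u x - v x) = nrm m (fun x => v x - u x).
Proof. by congr Num.sqrt; apply: eq_Rintegral => x _; rewrite -opprB sqmodN. Qed.

Lemma nrm_triangle w u v : L2 m u -> L2 m v -> L2 m w ->
  nrm m (fun x => u x - v x) <=
  nrm m (fun x => u x - w x) + nrm m (fun x => w x - v x).
Proof.
move=> iu iv iw; rewrite (_ : (fun x => u x - v x) =
  (fun x => (u x - w x) + (w x - v x))); first by apply: nrmD; exact: L2B.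
by apply/funext => x; rewrite addrA subrK.
Qed.

Lemma nrm_le u v : L2 m u -> L2 m v ->
  nrm m u <= nrm m v + nrm m (fun x => u x - v x).
Proof.
move=> iu iv; rewrite [X in nrm m X <= _](_ : u = fun x => v x + (u x - v x)).
  by apply: nrmD => //; exact: L2B.
by apply/funext => x; rewrite addrC subrK.
Qed.

Lemma nrm0 : nrm m (fun=> 0) = 0.
Proof. by rewrite /nrm /sq; under eq_Rintegral do rewrite sqmod0;
  rewrite Rintegral0 sqrtr0. Qed.

Lemma nrm_self u : nrm m (fun x => u x - u x) = 0.
Proof. by under [X in nrm m X]eq_fun do rewrite subrr; rewrite nrm0. Qed.

End triangle.

Section totality.
Context {disp : measure_display} {T : measurableType disp} {R : realType}.
Variable m : {finite_measure set T -> \bar R}.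
Implicit Types u v w : T -> R[i].

(** The carrier [T'] is separate from the index type so that the same coefficients and indices can
    be fed to two families living on different spaces, as [corr] requires. *)
Definition comb S (T' : Type) (e : S -> T' -> R[i]) N (c : 'I_N -> R[i]) (s : 'I_N ->
  S) :
  T' -> R[i] := fun x => \sum_(k < N) c k * e (s k) x.

Variables (S : Type) (e : S -> T -> R[i]).
Hypothesis L2e : forall s, L2 m (e s).

Lemma combS (T' : Type) (f : S -> T' -> R[i]) N (c : 'I_N.+1 -> R[i]) s :
  comb f c s = fun x => 1 * comb f (c \o lift ord0) (s \o lift ord0) x +
    c ord0 * f (s ord0) x.
Proof. by apply/funext => x; rewrite /comb big_ord_recl mul1r addrC. Qed.

Lemma comb0 (T' : Type) (f : S -> T' -> R[i]) (c : 'I_0 ->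
  R[i]) s : comb f c s = fun=> 0.
Proof. by apply/funext => x; rewrite /comb big_ord0. Qed.

Lemma L2_comb N c s : L2 m (comb e (N := N) c s).
Proof.
elim: N c s => [|N IH] c s; first by rewrite comb0; exact: L2_cst.
by rewrite combS; exact: L2_lin.
Qed.

Definition approx u := forall eps : R, 0 < eps -> exists N (c : 'I_N -> R[i]) s,
  nrm m (fun x => u x - comb e c s x) < eps.

Definition total := forall u, L2 m u -> approx u.

(** The new coefficients and indices are chosen before the family [f], so that corresponding
    combinations of two families stay synchronised. *)
Lemma comb_lin (a b : R[i]) N (c : 'I_N -> R[i]) (s : 'I_N -> S)
    N' (c' : 'I_N' -> R[i]) (s' : 'I_N' -> S) :
  exists N'' (c'' : 'I_N'' -> R[i]) s'', forall T' (f : S -> T' -> R[i]),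
   (fun x => a * comb f (N := N) c s x + b * comb f (N := N') c' s' x) =
   comb f c'' s''.
Proof.
exists (N + N')%N, (fun k => match fintype.split k with inl i => a * c i | inr j => b *
  c' j end),
  (fun k => match fintype.split k with inl i => s i | inr j => s' j end) => T'' g.
apply/funext => x; rewrite /comb big_split_ord/= !mulr_sumr.
congr (_ + _); apply: eq_bigr => i _.
  by rewrite -[lshift _ i]/(unsplit (inl i)) unsplitK mulrA.
by rewrite -[rshift _ i]/(unsplit (inr i)) unsplitK mulrA.
Qed.

End totality.

Section forms_total.
Context {d1 : measure_display} {T1 : measurableType d1} {d2 : measure_display}
  {T2 : measurableType d2} {R : realType}.
Variables (m1 : {finite_measure set T1 -> \bar R})
  (m2 : {finite_measure set T2 -> \bar R}).
Variables (S1 S2 : Type) (e : S1 -> T1 -> R[i]) (f : S2 -> T2 -> R[i]).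
Hypotheses (L2e : forall s, L2 m1 (e s)) (L2f : forall s, L2 m2 (f s)).
Variable b : (T1 -> R[i]) -> (T2 -> R[i]) -> R[i].
Hypothesis sb : sesquilinear m1 m2 b.

Lemma sesq_comb_l N c s v : L2 m2 v ->
  b (comb e (N := N) c s) v = \sum_(k < N) c k * b (e (s k)) v.
Proof.
move=> iv; elim: N c s => [|N IH] c s.
  rewrite big_ord0 comb0 -[RHS](mul0r (b (fun=> 0) v)).
  rewrite -(sesqZl _ sb)//; last exact: L2_cst.
  by congr b; apply/funext => x; rewrite mul0r.
rewrite combS (sesq_linl sb)//; last exact: L2_comb.
by rewrite IH big_ord_recl mul1r addrC.
Qed.

Lemma sesq_comb_r u N c s : L2 m1 u ->
  b u (comb f (N := N) c s) = \sum_(k < N) Num.conj (c k) * b u (f (s k)).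
Proof.
move=> iu; elim: N c s => [|N IH] c s.
  rewrite big_ord0 comb0; have := sesq_linr sb 0 0 iu (L2_cst m2 0) (L2_cst m2 0).
  rewrite (conj_real 0) !mul0r addr0 => h; rewrite -[RHS]h.
  by congr (b u _); apply/funext => x; rewrite !mul0r addr0.
rewrite combS (sesq_linr sb)//; last exact: L2_comb.
by rewrite IH big_ord_recl (conj_real 1) mul1r addrC.
Qed.

Lemma sesq_comb N c s N' c' s' :
  b (comb e (N := N) c s) (comb f (N := N') c' s') =
  \sum_(k < N) \sum_(l < N') c k * Num.conj (c' l) * b (e (s k)) (f (s' l)).
Proof.
rewrite sesq_comb_l; last exact: L2_comb.
apply: eq_bigr => k _; rewrite sesq_comb_r// mulr_sumr.
by apply: eq_bigr => l _; rewrite mulrA.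
Qed.

End forms_total.

Section form_ext.
Context {d1 : measure_display} {T1 : measurableType d1} {d2 : measure_display}
  {T2 : measurableType d2} {R : realType}.
Variables (m1 : {finite_measure set T1 -> \bar R})
  (m2 : {finite_measure set T2 -> \bar R}).
Variables (S1 S2 : Type) (e : S1 -> T1 -> R[i]) (f : S2 -> T2 -> R[i]).
Hypotheses (L2e : forall s, L2 m1 (e s)) (L2f : forall s, L2 m2 (f s)).
Variables b b' : (T1 -> R[i]) -> (T2 -> R[i]) -> R[i].

Lemma form_ext : sesquilinear m1 m2 b -> contractive_form m1 m2 b ->
  sesquilinear m1 m2 b' -> contractive_form m1 m2 b' ->
  total m1 e -> total m2 f ->
  (forall s t, b (e s) (f t) = b' (e s) (f t)) ->
  forall u v, L2 m1 u -> L2 m2 v -> b u v = b' u v.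
Proof.
move=> sb cb sb' cb' te tf bb u v iu iv.
apply/eqP; rewrite -subr_eq0; apply/eqP/cmod_eq0/eqP.
rewrite eq_le cmod_ge0 andbT.
(* Each [form_dist] bound is at most eps ||v|| + (||u|| + 1) eps, and there are two forms. *)
pose K := 2 * (nrm m1 u + 1 + nrm m2 v).
apply: (@arbitrarily_small _ _ K).
  by rewrite /K mulr_ge0// !addr_ge0 ?nrm_ge0.
move=> eps e0 e1; have [N [c [s us]]] := te u iu eps e0.
have [N' [c' [s' vs]]] := tf v iv eps e0.
set u' := comb e c s in us; set v' := comb f c' s' in vs.
have iu' : L2 m1 u' by exact: L2_comb.
have iv' : L2 m2 v' by exact: L2_comb.
have eq' : b u' v' = b' u' v'.
  rewrite (sesq_comb L2e L2f sb) (sesq_comb L2e L2f sb').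
  by apply: eq_bigr => k _; apply: eq_bigr => l _; rewrite bb.
(* The common value of both forms at the approximants is inserted. *)
have -> : b u v - b' u v = (b u v - b u' v') - (b' u v - b' u' v').
  by rewrite eq'; ring.
have un : nrm m1 u' <= nrm m1 u + eps.
  by rewrite (le_trans (nrm_le iu' iu))// lerD2l nrm_distC ltW.
have h1 := form_dist sb cb iu iu' iv iv'.
have h2 := form_dist sb' cb' iu iu' iv iv'.
rewrite (le_trans (cmodB _ _))// (le_trans (lerD h1 h2))//.
have l1 : nrm m1 (fun x => u x - u' x) * nrm m2 v <= eps * nrm m2 v.
  by rewrite ler_wpM2r ?nrm_ge0// ltW.
have l2 : nrm m1 u' * nrm m2 (fun x => v x - v' x) <= (nrm m1 u + 1) * eps.
  by apply: ler_pM; rewrite ?nrm_ge0//; [lra|exact: ltW].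
rewrite /K; nra.
Qed.

End form_ext.

(** * Completeness of L2 *)

Section riesz_fischer.
Context {disp : measure_display} {T : measurableType disp} {R : realType}.
Variable m : {finite_measure set T -> \bar R}.

Lemma bounded_series_cvg (x : R^nat) (a : R^nat) (M : R) :
  (forall n, `|x n.+1 - x n| <= a n) -> (forall n, 0 <= a n) ->
  (forall n, \sum_(0 <= k < n) a k <= M) -> cvgn x.
Proof.
move=> xa a0 aM; have h : cvgn (series (telescope x)).
  apply: (@normed_cvg R R^o); apply: nondecreasing_is_cvgn.
    by apply: nondecreasing_series => n _ _; exact: normr_ge0.
  exists M => _ [n _ <-]; rewrite (le_trans _ (aM n))//.
  by apply: ler_sum => k _; exact: xa.
have -> : x = (fun n => x 0%N + series (telescope x) n).
  by apply/funext => n; rewrite -eq_sum_telescope.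
by apply: is_cvgD => //; exact: is_cvg_cst.
Qed.

Variable u : nat -> T -> R[i].
Hypothesis L2u : forall n, L2 m (u n).
Hypothesis du : forall n, nrm m (fun x => u n.+1 x - u n x) <= 2^-1 ^+ n.

Let D n x := u n.+1 x - u n x.

Let a n x : R := `|complex.Re (D n x)| + `|complex.Im (D n x)|.

Let mD n : cmeasurable (D n). Proof. by have [] := L2B (L2u n.+1) (L2u n). Qed.

Let ma n : measurable_fun setT (a n).
Proof. by have [? ?] := mD n; apply: measurable_funD; exact: measurableT_comp. Qed.

Let a_ge0 n x : 0 <= a n x. Proof. exact: addr_ge0. Qed.

(** With mass M of the whole space, t = 2^n and ||D_n|| <= 2^-n, the bound of |D_n| used in [inta]
    integrates to 2^-n / 2 + M 2^-n, that is (1 + 2 M) / 2^(n+1). *)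
Let K := 1 + 2 * fine (m setT).

Let absle (t p : R) : 0 < t -> `|p| <= (t * p ^+ 2 + t^-1) / 2.
Proof.
move=> t0; rewrite -(real_normK (num_real p)); set q := `|p|.
have : 0 <= t * (q - t^-1) ^+ 2 by rewrite mulr_ge0 ?sqr_ge0// ltW.
have -> : t * (q - t^-1) ^+ 2 = t * q ^+ 2 - 2 * q + t^-1.
  by field; rewrite gt_eqF.
lra.
Qed.

Let inta n : (\int[m]_x (a n x)%:E <= (K / (2 ^+ n.+1))%:E)%E.
Proof.
(* The weight in [absle] balances both terms of Young's inequality at order 2^-n, turning the L2
   bound on the increment into a summable L1 bound. *)
pose t : R := 2 ^+ n; have t0 : 0 < t by rewrite exprn_gt0.
have /L2P[_ iD] := L2B (L2u n.+1) (L2u n).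
have ig : rint m (fun x => t / 2 * sqmod (D n x) + t^-1).
  by apply: rintD; [exact: rintZ|exact: finite_measure_integrable_cst].
have h x : `|a n x| <= t / 2 * sqmod (D n x) + t^-1.
  rewrite ger0_norm// /a (le_trans (lerD (absle _ t0) (absle _ t0)))//.
  by rewrite /sqmod; lra.
have ia : rint m (a n) by exact: (rint_le (ma n) ig h).
rewrite -[leLHS]fineK ?integrable_fin_num// lee_fin.
apply: (@le_trans _ _ (\int[m]_x (t / 2 * sqmod (D n x) + t^-1))).
  by apply: le_Rintegral => // x _; rewrite (le_trans _ (h x))// ler_norm.
rewrite RintegralD//; [|exact: rintZ|exact: finite_measure_integrable_cst].
rewrite RintegralZl// Rintegral_cst// -/(sq m (D n)) -sqr_nrm.
have : nrm m (D n) ^+ 2 <= t^-1 ^+ 2.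
  by rewrite ler_pXn2r ?nnegrE ?nrm_ge0 ?invr_ge0 ?(ltW t0)// /t -exprVn; exact: du.
rewrite [2 ^+ n.+1]exprS -/t invfM /K => /(ler_wpM2l (ltW t0)).
rewrite [t * t^-1 ^+ 2]mulrA divff ?gt_eqF// mul1r; lra.
Qed.

Let E := [set x | (\sum_(n <oo) (a n x)%:E < +oo)%E].

Let mS : measurable_fun setT (fun x => \sum_(n <oo) (a n x)%:E)%E.
Proof.
apply: (ge0_emeasurable_sum (P := predT)) => [k x _ _|k _].
  by rewrite lee_fin.
exact/measurable_EFinP.
Qed.

Let mE : measurable E.
Proof.
rewrite /E -[X in measurable X]setTI.
exact: (emeasurable_fun_infty_o measurableT mS).
Qed.

Let aeE : {ae m, forall x, E x}.
Proof.
have iS : m.-integrable setT (fun x => \sum_(n <oo) (a n x)%:E)%E.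
  apply/integrableP; split => //.
  have S0 x : (0 <= \sum_(n <oo) (a n x)%:E)%E.
    by apply: nneseries_ge0 => n _ _; rewrite lee_fin.
  under eq_integral do rewrite gee0_abs//.
  have mEa n : measurable_fun setT (fun x => (a n x)%:E).
    exact/measurable_EFinP/ma.
  rewrite integral_nneseries//; last by move=> n x _; rewrite lee_fin.
  apply: (@le_lt_trans _ _ (\sum_(n <oo) (K / (2 ^+ n.+1))%:E)%E).
    apply: lee_nneseries => n *; last exact: inta.
    by apply: integral_ge0 => x _; rewrite lee_fin.
  have K0 : 0 <= K by rewrite /K addr_ge0// mulr_ge0// fine_ge0.
  apply: le_lt_trans (ltry K); apply: le_trans (epsilon_trick0 xpredT K0).
  by rewrite le_eqVlt; apply/orP; left; apply/eqP; apply: eq_eseriesr => n _;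
    rewrite natrX.
have := integrable_ae measurableT iS; apply: filterS => x /(_ I).
by rewrite /E/= fin_numElt => /andP[].
Qed.

Let cvgE x : E x -> cvgn (fun n => complex.Re (u n x)) /\ cvgn (fun n => complex.Im (u
  n x)).
Proof.
move=> Ex; pose M := fine (\sum_(n <oo) (a n x)%:E)%E.
have aM n : \sum_(0 <= k < n) a k x <= M.
  rewrite -lee_fin fineK; last first.
    by rewrite ge0_fin_numE// nneseries_ge0// => k _ _; rewrite lee_fin.
  by rewrite -sumEFin; apply: nneseries_lim_ge => k _ _; rewrite lee_fin.
split; apply: (@bounded_series_cvg _ (a ^~ x) M) => // n.
  by rewrite -raddfB lerDl.
by rewrite -raddfB lerDr.
Qed.

(** The sequence is set to zero off the convergence set [E], so that it converges at every point and
    its limit [g] is measurable. *)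
Let h n x : R[i] := u n x * cindic E x.

Let hE n x : E x -> h n x = u n x.
Proof. by move=> Ex; rewrite /h /cindic indicE mem_set// mulr1. Qed.

Let hNE n x : ~ E x -> h n x = 0.
Proof. by move=> Ex; rewrite /h /cindic indicE memNset// mulr0. Qed.

Let g x : R[i] := limn (fun n => complex.Re (h n x)) +i* limn (fun n => complex.Im (h n
  x)).

Let cvgh x : (fun n => complex.Re (h n x)) @ \oo --> complex.Re (g x) /\
  (fun n => complex.Im (h n x)) @ \oo --> complex.Im (g x).
Proof.
suff [c1 c2] : cvgn (fun n => complex.Re (h n x)) /\
  cvgn (fun n => complex.Im (h n x)) by [].
have [Ex|Ex] := pselect (E x).
  have -> : (fun n => complex.Re (h n x)) = (fun n => complex.Re (u n x)).
    by apply/funext => n; rewrite hE.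
  have -> : (fun n => complex.Im (h n x)) = (fun n => complex.Im (u n x)).
    by apply/funext => n; rewrite hE.
  exact: cvgE.
have -> : (fun n => complex.Re (h n x)) = (fun=> 0).
  by apply/funext => n; rewrite hNE.
have -> : (fun n => complex.Im (h n x)) = (fun=> 0).
  by apply/funext => n; rewrite hNE.
by split; exact: is_cvg_cst.
Qed.

Let mh n : cmeasurable (h n).
Proof.
apply: cmeasurableM; first by have [] := L2u n.
by apply: cmeasurable_real; exact: measurable_indic.
Qed.

Let mg : cmeasurable g.
Proof.
split.
  apply: (@measurable_fun_cvg _ _ _ setT (fun n x => complex.Re (h n x))) => [n|x _].
    by have [] := mh n.
  by have [] := cvgh x.
apply: (@measurable_fun_cvg _ _ _ setT (fun n x => complex.Im (h n x))) => [n|x _].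
  by have [] := mh n.
by have [] := cvgh x.
Qed.

Let nrmu n k : nrm m (fun x => u n x - u (n + k)%N x) <= 2 * 2^-1 ^+ n * (1 - 2^-1 ^+
  k).
Proof.
elim: k => [|k IH]; first by rewrite addn0 nrm_self expr0 subrr mulr0.
rewrite (le_trans (nrm_triangle (L2u _) (L2u _) (L2u (n + k)%N)))//.
rewrite (le_trans (lerD IH (_ : _ <= 2^-1 ^+ (n + k))))//.
  by rewrite nrm_distC addnS.
by rewrite exprD exprS; lra.
Qed.

(** Fatou's lemma for k |-> |h_n - h_(n+k)|^2: the distances between terms of the sequence are
    bounded uniformly in [k] by [nrmu], hence so is the distance to the limit. *)
Let fatou_bound n : (\int[m]_x (sqmod (h n x - g x))%:E <= ((2 * 2^-1 ^+ n) ^+ 2)%:E)%E.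
Proof.
have mhk k : cmeasurable (fun x => h n x - h (n + k)%N x).
  have := cmeasurable_lin 1 (-1) (mh n) (mh (n + k)%N).
  by congr cmeasurable; apply/funext => x; rewrite mul1r mulN1r.
pose f k x := (sqmod (h n x - h (n + k)%N x))%:E.
have -> : (\int[m]_x (sqmod (h n x - g x))%:E = \int[m]_x limn_einf (f^~ x))%E.
  apply: eq_integral => x _.
  have c : f^~ x @ \oo --> (sqmod (h n x - g x))%:E.
    suff cR : (fun k => sqmod (h n x - h (n + k)%N x)) @ \oo --> sqmod (h n x - g x).
      by apply: cvg_EFin; [exact: nearW|exact: cR].
    have [c1 c2] := cvgh x.
    have sh (y : R^nat) (l : R) : y @ \oo --> l ->
        (fun k => (y n - y (n + k)%N) ^+ 2) @ \oo --> (y n - l) ^+ 2.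
      move=> yl; have c : (fun k => y n - y (n + k)%N) @ \oo --> y n - l.
        apply: cvgB; first exact: cvg_cst.
        apply: (cvg_comp (addn n) y _ yl); exact: cvg_addnl.
      by rewrite expr2; under eq_fun do rewrite expr2; exact: cvgM.
    rewrite /sqmod !raddfB; under eq_fun do rewrite !raddfB.
    by apply: cvgD; [exact: (sh _ _ c1)|exact: (sh _ _ c2)].
  by have [-> _] := cvg_limn_einf_sup c.
apply: (le_trans (fatou m measurableT _ _)).
- by move=> k; exact/measurable_EFinP/measurable_sqmod.
- by move=> k x _; rewrite lee_fin sqmod_ge0.
have bnd k : (\int[m]_x f k x <= ((2 * 2^-1 ^+ n) ^+ 2)%:E)%E.
  have -> : (\int[m]_x f k x = \int[m]_x (sqmod (u n x - u (n + k)%N x))%:E)%E.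
    apply: ae_eq_integral => //; try exact/measurable_EFinP/measurable_sqmod.
      by apply/measurable_EFinP/measurable_sqmod;
        have [] := L2B (L2u n) (L2u (n + k)%N).
    by apply: filterS aeE => x Ex _; rewrite /f !hE.
  have /L2P[_ i] := L2B (L2u n) (L2u (n + k)%N).
  rewrite -[leLHS]fineK ?integrable_fin_num// lee_fin.
  rewrite -/(Rintegral _ _ _) -/(sq m _) -sqr_nrm ler_pXn2r ?nnegrE ?nrm_ge0//.
  rewrite (le_trans (nrmu n k))// -[leRHS]mulr1 ler_wpM2l//.
rewrite limn_einf_lim; apply: lime_le; first exact: is_cvg_einfs.
apply: nearW => k; rewrite (le_trans _ (bnd k))//.
by apply: ereal_inf_lbound; exists k => //=.
Unshelve. all: by end_near. Qed.

Lemma riesz_fischer : exists2 g, L2 m g &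
  forall n, nrm m (fun x => u n x - g x) <= 2 * 2^-1 ^+ n.
Proof.
have Eu n : {ae m, forall x, h n x - g x = u n x - g x}.
  by apply: filterS aeE => x Ex; rewrite hE.
have mug n : cmeasurable (fun x => u n x - g x).
  have := cmeasurable_lin 1 (-1) (L2_cmeasurable (L2u n)) mg.
  by congr cmeasurable; apply/funext => x; rewrite mul1r mulN1r.
have iug n : L2 m (fun x => u n x - g x).
  apply: eq_ae_L2 (Eu n) _ => //; split.
    have := cmeasurable_lin 1 (-1) (mh n) mg.
    by congr cmeasurable; apply/funext => x; rewrite mul1r mulN1r.
  by rewrite (le_lt_trans (fatou_bound n))// ltry.
exists g.
  (* g = u_0 - (u_0 - g), and the difference is already known to be square-integrable. *)
  have := L2B (L2u 0%N) (iug 0%N); congr L2.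
  by apply/funext => x; rewrite opprB addrC subrK.
move=> n; rewrite -(@ler_pXn2r _ 2) ?nnegrE ?nrm_ge0//.
have mhg : cmeasurable (fun x => h n x - g x).
  have := cmeasurable_lin 1 (-1) (mh n) mg.
  by congr cmeasurable; apply/funext => x; rewrite mul1r mulN1r.
rewrite -(eq_ae_nrm mhg (mug n) (Eu n)) sqr_nrm.
have := fatou_bound n; rewrite -[leLHS]fineK//.
rewrite ge0_fin_numE; last by apply: integral_ge0 => x _; rewrite lee_fin sqmod_ge0.
by rewrite (le_lt_trans (fatou_bound n))// ltry.
Qed.

End riesz_fischer.

(** * Isometries obtained by closure *)

Section correspondence.
Context {d1 : measure_display} {T1 : measurableType d1} {d2 : measure_display}
  {T2 : measurableType d2} {R : realType}.
Variables (m1 : {finite_measure set T1 -> \bar R})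
  (m2 : {finite_measure set T2 -> \bar R}).
Variables (S : Type) (e : S -> T1 -> R[i]) (f : S -> T2 -> R[i]).

(* The graph of the isometry [e s |-> f s], extended by closure. *)
Definition corr (u : T1 -> R[i]) (xi : T2 -> R[i]) :=
  [/\ L2 m1 u, L2 m2 xi & forall eps : R, 0 < eps ->
    exists N (c : 'I_N -> R[i]) (s : 'I_N -> S),
      nrm m1 (fun x => u x - comb e c s x) < eps /\
      nrm m2 (fun w => xi w - comb f c s w) < eps].

Hypotheses (L2e : forall s, L2 m1 (e s)) (L2f : forall s, L2 m2 (f s)).

Lemma corr_comb N (c : 'I_N -> R[i]) s : corr (comb e c s) (comb f c s).
Proof.
split; [exact: L2_comb|exact: L2_comb|move=> eps e0].
by exists N, c, s; rewrite !nrm_self.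
Qed.

Lemma corr_single s : corr (e s) (f s).
Proof.
have := corr_comb (fun _ : 'I_1 => 1) (fun _ => s).
by congr corr; apply/funext => x; rewrite /comb big_ord1 mul1r.
Qed.

Lemma corr_lin a b u v xi eta : corr u xi -> corr v eta ->
  corr (fun x => a * u x + b * v x) (fun w => a * xi w + b * eta w).
Proof.
move=> [iu ixi h] [iv ieta h']; split; [exact: L2_lin|exact: L2_lin|].
move=> eps e0; pose K := cmod a + cmod b + 1.
have K0 : 0 < K by rewrite ltr_wpDl// addr_ge0 ?cmod_ge0.
have eK : 0 < eps / K by rewrite divr_gt0.
have [N [c [s [h1 h2]]]] := h _ eK; have [N' [c' [s' [h1' h2']]]] := h' _ eK.
have [N'' [c'' [s'' E]]] := comb_lin a b c s c' s'.
exists N'', c'', s''; rewrite -!E.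
have aux d (T : measurableType d) (m : {finite_measure set T -> \bar R}) w w' z z' :
    L2 m w -> L2 m w' -> L2 m z -> L2 m z' ->
    nrm m (fun x => w x - z x) < eps / K -> nrm m (fun x => w' x - z' x) < eps / K ->
    nrm m (fun x => a * w x + b * w' x - (a * z x + b * z' x)) < eps.
  move=> iw iw' iz iz' l l'.
  rewrite [X in nrm m X](_ : _ = fun x => a * (w x - z x) + b * (w' x - z' x));
    last first.
    by apply/funext => x; ring.
  apply: (le_lt_trans (nrmD _ _)); try by apply: L2Z; exact: L2B.
  rewrite !nrmZ; try exact: L2B.
  have l1 := ler_wpM2l (cmod_ge0 a) (ltW l).
  have l2 := ler_wpM2l (cmod_ge0 b) (ltW l').
  have : K * (eps / K) = eps by rewrite mulrC divfK// gt_eqF.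
  rewrite /K !mulrDl mul1r; lra.
by split; apply: aux => //; exact: L2_comb.
Qed.

Hypothesis gram : forall s t, ip m1 (e s) (e t) = ip m2 (f s) (f t).

Lemma nrm_comb N (c : 'I_N -> R[i]) s : nrm m1 (comb e c s) = nrm m2 (comb f c s).
Proof.
congr Num.sqrt.
have : (sq m1 (comb e c s))%:C = (sq m2 (comb f c s))%:C.
  rewrite -!ip_self (sesq_comb L2e L2e (sesquilinear_ip m1)).
  rewrite (sesq_comb L2f L2f (sesquilinear_ip m2)).
  by apply: eq_bigr => k _; apply: eq_bigr => l _; rewrite gram.
by case.
Qed.

Lemma corr_nrm u xi : corr u xi -> nrm m1 u = nrm m2 xi.
Proof.
move=> [iu ixi h]; apply/eqP; rewrite -subr_eq0 -normr_eq0.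
rewrite eq_le normr_ge0 andbT; apply: (@arbitrarily_small _ _ 2) => //.
move=> eps e0 _; have [N [c [s [h1 h2]]]] := h _ e0.
have ic := L2_comb L2e c s; have jc := L2_comb L2f c s.
have := nrm_le iu ic; have := nrm_le ic iu.
have := nrm_le ixi jc; have := nrm_le jc ixi.
rewrite (nrm_comb c s) (nrm_distC _ (comb e c s)) (nrm_distC _ (comb f c s)).
by move=> *; rewrite ler_norml; apply/andP; split; lra.
Qed.

(** The graph is single-valued up to null sets: by linearity the difference corresponds to a
    function of norm zero, and norms are preserved. *)
Lemma corr_eq u u' xi xi' : corr u xi -> corr u' xi' ->
  {ae m1, forall x, u x = u' x} -> {ae m2, forall w, xi w = xi' w}.
Proof.
move=> c c' uu; have := corr_lin 1 (-1) c c' => cB.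
have /corr_nrm nB := cB; have [iB jB _] := cB.
have : nrm m2 (fun w => 1 * xi w + -1 * xi' w) = 0.
  rewrite -nB -(nrm0 m1); apply: eq_ae_nrm; [by case: iB|exact: cmeasurable_cst|].
  by apply: filterS uu => x ->; rewrite mul1r mulN1r subrr.
move=> /(nrm_eq0 jB); apply: filterS => w /eqP.
by rewrite mul1r mulN1r subr_eq0 => /eqP.
Qed.

Lemma corr_exists u : L2 m1 u -> approx m1 e u -> exists xi, corr u xi.
Proof.
move=> iu au.
(* The factor 1/4 makes consecutive approximants differ by at most 2^-n, the rate asked for by
   [riesz_fischer]: 2^-n / 4 + 2^-(n+1) / 4 <= 2^-n. *)
have pos n : 0 < 2^-1 ^+ n / 4 :> R by rewrite divr_gt0// exprn_gt0.
have /choice[C hC] : forall n, exists C : {N & (('I_N -> R[i]) * ('I_N -> S))%type},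
    nrm m1 (fun x => u x - comb e (projT2 C).1 (projT2 C).2 x) < 2^-1 ^+ n / 4.
  by move=> n; have [N [c [s h]]] := au _ (pos n); exists (existT _ N (c, s)).
pose ue n := comb e (projT2 (C n)).1 (projT2 (C n)).2.
pose uf n := comb f (projT2 (C n)).1 (projT2 (C n)).2.
have iue n : L2 m1 (ue n) by exact: L2_comb.
have iuf n : L2 m2 (uf n) by exact: L2_comb.
have close n : nrm m2 (fun x => uf n.+1 x - uf n x) <= 2^-1 ^+ n.
  have [N'' [c'' [s'' E]]] := comb_lin 1 (-1) (projT2 (C n.+1)).1
    (projT2 (C n.+1)).2 (projT2 (C n)).1 (projT2 (C n)).2.
  have E1 : (fun x => uf n.+1 x - uf n x) = comb f c'' s''.
    by rewrite -E; apply/funext => x; rewrite mul1r mulN1r.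
  have E2 : (fun x => ue n.+1 x - ue n x) = comb e c'' s''.
    by rewrite -E; apply/funext => x; rewrite mul1r mulN1r.
  (* The increment is measured on the source side, where [u] itself serves as the intermediate
     point. *)
  rewrite E1 -nrm_comb -E2 (le_trans (nrm_triangle (iue _) (iue _) iu))//.
  have := hC n.+1; have := hC n; rewrite exprS -/(ue n) -/(ue n.+1).
  rewrite (nrm_distC _ (ue n.+1)); have := pos n; lra.
have [g ig hg] := riesz_fischer iuf close.
exists g; split => // eps e0.
have [n hn] : exists n, 2 * 2^-1 ^+ n < eps.
  have := @cvg_geometric R 2 2^-1.
  rewrite ger0_norm// invf_lt1// ltr1n => /(_ isT) /cvgrPdist_lt /(_ eps e0)[n _ /(_ n
    (leqnn _))].
  rewrite sub0r normrN ger0_norm//= ?mulr_ge0 ?exprn_ge0// => h.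
  by exists n.
exists (projT1 (C n)), (projT2 (C n)).1, (projT2 (C n)).2.
rewrite -/(ue n) -/(uf n); split.
  by rewrite (lt_trans (hC n))//; have := pos n; lra.
by rewrite nrm_distC (le_lt_trans (hg n)).
Qed.

Lemma corr_fun : total m1 e ->
  exists U : (T1 -> R[i]) -> T2 -> R[i], forall u, L2 m1 u -> corr u (U u).
Proof.
move=> te; have /choice[U hU] : forall u, exists xi, L2 m1 u -> corr u xi.
  (* Outside L2 the value is an arbitrary default, here zero. *)
  move=> u; have [iu|] := pselect (L2 m1 u); last by exists (fun=> 0).
  by have [xi h] := corr_exists iu (te u iu); exists xi.
by exists U.
Qed.

End correspondence.

(** Surjectivity of an isometry becomes existence for the reversed graph. *)
Lemma corr_sym d1 (T1 : measurableType d1) d2 (T2 : measurableType d2) (R : realType)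
  (m1 : {finite_measure set T1 -> \bar R}) (m2 : {finite_measure set T2 -> \bar R})
  S (e : S -> T1 -> R[i]) (f : S -> T2 -> R[i]) u xi :
  corr m1 m2 e f u xi -> corr m2 m1 f e xi u.
Proof.
move=> [iu ixi h]; split => // eps /h [N [c [s [h1 h2]]]].
by exists N, c, s.
Qed.

Section approximation.
Context {disp : measure_display} {T : measurableType disp} {R : realType}.
Variable m : {finite_measure set T -> \bar R}.
Variables (S : Type) (e : S -> T -> R[i]).
Hypothesis L2e : forall s, L2 m (e s).

(** The closed span of a family is the diagonal of its own graph, so it inherits linearity from
    [corr_lin]. *)
Lemma approx_corr u : L2 m u -> approx m e u <-> corr m m e e u u.
Proof.
move=> iu; split=> [h|[_ _ h] eps /h [N [c [s [? _]]]]]; last by exists N, c, s.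
by split => // eps /h [N [c [s ?]]]; exists N, c, s.
Qed.

Lemma approx_lin a b u v : L2 m u -> L2 m v -> approx m e u -> approx m e v ->
  approx m e (fun x => a * u x + b * v x).
Proof.
move=> iu iv /(approx_corr iu) au /(approx_corr iv) av.
by apply/approx_corr; [exact: L2_lin|exact: corr_lin].
Qed.

Lemma approx_comb N (c : 'I_N -> R[i]) s : approx m e (comb e c s).
Proof. by apply/approx_corr; [exact: L2_comb|exact: corr_comb]. Qed.

Lemma approx_closed u : L2 m u ->
  (forall eps, 0 < eps -> exists v, [/\ L2 m v, approx m e v &
     nrm m (fun x => u x - v x) < eps]) -> approx m e u.
Proof.
move=> iu h eps e0; have [v [iv av uv]] := h _ (divr_gt0 e0 (ltr0n _ 2)).
have [N [c [s vc]]] := av _ (divr_gt0 e0 (ltr0n _ 2)).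
exists N, c, s; rewrite (le_lt_trans (nrm_triangle iu (L2_comb L2e c s) iv))//; lra.
Qed.

Lemma approx_trans S' (e' : S' -> T -> R[i]) u : (forall s, L2 m (e' s)) ->
  (forall s, approx m e (e' s)) -> L2 m u -> approx m e' u -> approx m e u.
Proof.
move=> L2e' h iu au; apply: approx_closed => // eps e0.
have [N [c [s uc]]] := au _ e0; exists (comb e' c s); split => //.
  exact: L2_comb.
elim: N c s {uc} => [|N IH] c s.
  (* The index type [S] may be empty, so the empty combination needs its own empty index
     function. *)
  have s0 : 'I_0 -> S by case.
  by rewrite comb0 -(comb0 e (fun=> 0) s0); exact: approx_comb.
by rewrite combS; apply: approx_lin => //; exact: L2_comb.
Qed.

End approximation.

Section isometry.
Context {d1 : measure_display} {T1 : measurableType d1} {d3 : measure_display}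
  {T3 : measurableType d3} {R : realType}.
Variable P : {finite_measure set T3 -> \bar R}.

Record isometry (m : {finite_measure set T1 -> \bar R})
    (U : (T1 -> R[i]) -> T3 -> R[i]) : Prop := Isometry {
  iso_L2 : forall u, L2 m u -> L2 P (U u);
  iso_lin : forall a b u v, L2 m u -> L2 m v ->
    {ae P, forall w, U (fun x => a * u x + b * v x) w = a * U u w + b * U v w};
  iso_nrm : forall u, L2 m u -> nrm P (U u) = nrm m u }.

End isometry.

Section isometry_forms.
Context {d1 : measure_display} {T1 : measurableType d1} {d2 : measure_display}
  {T2 : measurableType d2} {d3 : measure_display} {T3 : measurableType d3} {R :
    realType}.
Variables (m1 : {finite_measure set T1 -> \bar R})
  (m2 : {finite_measure set T2 -> \bar R}) (P : {finite_measure set T3 -> \bar R}).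
Variables (U : (T1 -> R[i]) -> T3 -> R[i]) (V : (T2 -> R[i]) -> T3 -> R[i]).
Hypotheses (iU : isometry P m1 U) (iV : isometry P m2 V).

Lemma isometry_sesquilinear : sesquilinear m1 m2 (fun u v => ip P (U u) (V v)).
Proof.
split=> [a a' u u' v iu iu' iv|a a' u v v' iu iv iv'].
  have ju := iso_L2 iU iu; have ju' := iso_L2 iU iu'; have jv := iso_L2 iV iv.
  rewrite -ip_linl//; apply: eq_ae_ip => //; try exact: L2_lin.
  - by apply: (iso_L2 iU); exact: L2_lin.
  - exact: (iso_lin iU).
  - exact: aeW.
have ju := iso_L2 iU iu; have jv := iso_L2 iV iv; have jv' := iso_L2 iV iv'.
rewrite -ip_linr//; apply: eq_ae_ip => //; try exact: L2_lin.
- by apply: (iso_L2 iV); exact: L2_lin.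
- exact: aeW.
- exact: (iso_lin iV).
Qed.

Lemma isometry_contractive : contractive_form m1 m2 (fun u v => ip P (U u) (V v)).
Proof.
move=> u v iu iv; rewrite -(iso_nrm iU iu) -(iso_nrm iV iv).
by apply: cauchy_schwarz; [exact: (iso_L2 iU)|exact: (iso_L2 iV)].
Qed.

End isometry_forms.

Section isometry_corr.
Context {d1 : measure_display} {T1 : measurableType d1} {d2 : measure_display}
  {T2 : measurableType d2} {R : realType}.
Variables (m1 : {finite_measure set T1 -> \bar R})
  (m2 : {finite_measure set T2 -> \bar R}).
Variables (S : Type) (e : S -> T1 -> R[i]) (f : S -> T2 -> R[i]).
Hypotheses (L2e : forall s, L2 m1 (e s)) (L2f : forall s, L2 m2 (f s)).
Hypothesis gram : forall s t, ip m1 (e s) (e t) = ip m2 (f s) (f t).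

Lemma corr_isometry U : (forall u, L2 m1 u -> corr m1 m2 e f u (U u)) ->
  isometry m2 m1 U.
Proof.
move=> cU; split=> [u /cU[]//|a b u v iu iv|u iu].
  apply: (corr_eq L2e L2f gram (cU _ (L2_lin a b iu iv)) (corr_lin L2e L2f a b (cU _
    iu) (cU _ iv))).
  exact: aeW.
by rewrite -(corr_nrm L2e L2f gram (cU _ iu)).
Qed.

(** Uniqueness of the continuous extension: an isometry with the right values on a total family has
    the graph [corr]. Operators specified only by axioms enter the theory this way. *)
Lemma isometry_corrP U : isometry m2 m1 U -> total m1 e ->
  (forall s, {ae m2, forall w, U (e s) w = f s w}) ->
  forall u, L2 m1 u -> corr m1 m2 e f u (U u).
Proof.
move=> iU te Ue u iu; split => //; first exact: (iso_L2 iU).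
move=> eps e0; have [N [c [s us]]] := te u iu eps e0.
exists N, c, s; split => //; have ic := L2_comb L2e c s.
have Uc : {ae m2, forall w, U (comb e c s) w = comb f c s w}.
  elim: N c s {us ic} => [|N IH] c s.
    rewrite !comb0; have := iso_lin iU 0 0 (L2_cst m1 0) (L2_cst m1 0).
    apply: filterS => w; rewrite !mul0r addr0 => h; rewrite -[RHS]h.
    by congr (U _ w); apply/funext => x; rewrite mul0r addr0.
  rewrite !combS; have ic := L2_comb L2e (c \o lift ord0) (s \o lift ord0).
  have h := iso_lin iU 1 (c ord0) ic (L2e (s ord0)).
  by apply: filterS3 h (IH (c \o lift ord0) (s \o lift ord0)) (Ue (s ord0)) => w -> ->
    ->.
have : {ae m2, forall w, U u w - comb f c s w = U (fun x => 1 * u x + -1 * comb e c s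
  x) w}.
  apply: filterS2 (iso_lin iU 1 (-1) iu ic) Uc => w -> <-.
  by rewrite mul1r mulN1r.
move=> h; rewrite (eq_ae_nrm _ _ h).
- rewrite (iso_nrm iU); last exact: L2_lin.
  by congr (_ < _): us; congr nrm; apply/funext => x; rewrite mul1r mulN1r.
- by have [] := L2B (iso_L2 iU iu) (L2_comb L2f c s).
- by have [] := iso_L2 iU (L2_lin 1 (-1) iu ic).
Qed.

End isometry_corr.

(** * Density of trigonometric polynomials *)

Section bounded_functions.
Context {disp : measure_display} {T : measurableType disp} {R : realType}.
Implicit Types f g h : T -> R.

Definition bmeas f := measurable_fun setT f /\ exists M, forall x, `|f x| <= M.

Lemma bmeas_lin a b f g : bmeas f -> bmeas g -> bmeas (fun x => a * f x + b * g x).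
Proof.
move=> [mf [M fM]] [mg [N gN]]; split.
  by apply: measurable_funD; exact: measurable_funM.
exists (`|a| * M + `|b| * N) => x; rewrite (le_trans (ler_normD _ _))// !normrM.
by rewrite lerD// ler_wpM2l.
Qed.

Lemma bmeasM f g : bmeas f -> bmeas g -> bmeas (fun x => f x * g x).
Proof.
move=> [mf [M fM]] [mg [N gN]]; split; first exact: measurable_funM.
by exists (M * N) => x; rewrite normrM ler_pM.
Qed.

Lemma bmeasB f g : bmeas f -> bmeas g -> bmeas (fun x => f x - g x).
Proof.
move=> bf bg; have := bmeas_lin 1 (-1) bf bg.
by congr bmeas; apply/funext => x; rewrite mul1r mulN1r.
Qed.

Variable m : {finite_measure set T -> \bar R}.

Lemma rint_bmeas f : bmeas f -> rint m f.
Proof. by move=> [mf [M fM]]; exact: rint_bounded fM. Qed.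

(** The L2 distance is left squared, which costs a factor 2 in the triangle inequality and spares
    square roots. *)
Definition dist2 f g : R := \int[m]_x (f x - g x) ^+ 2.

Lemma bmeas_sqr f g : bmeas f -> bmeas g -> bmeas (fun x => (f x - g x) ^+ 2).
Proof. by move=> bf bg; under eq_fun do rewrite expr2; apply: bmeasM;
  exact: bmeasB. Qed.

Lemma dist2_triangle f g h : bmeas f -> bmeas g -> bmeas h ->
  dist2 f h <= 2 * dist2 f g + 2 * dist2 g h.
Proof.
move=> bf bg bh.
have i := rint_bmeas (bmeas_sqr bf bg); have j := rint_bmeas (bmeas_sqr bg bh).
rewrite /dist2 -!RintegralZl// -RintegralD//; try exact: rintZ.
apply: le_Rintegral => //; first exact/rint_bmeas/bmeas_sqr.
  by apply: rintD; exact: rintZ.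
move=> x _; have := sqr_ge0 (f x - g x - (g x - h x)).
have -> : f x - h x = (f x - g x) + (g x - h x) by ring.
by move: (f x - g x) (g x - h x) => p q; rewrite sqrrB sqrrD; lra.
Qed.

Lemma dist2_lin a b f g f' g' : bmeas f -> bmeas g -> bmeas f' -> bmeas g' ->
  dist2 (fun x => a * f x + b * g x) (fun x => a * f' x + b * g' x) <=
  2 * a ^+ 2 * dist2 f f' + 2 * b ^+ 2 * dist2 g g'.
Proof.
move=> bf bg bf' bg'.
have i := rint_bmeas (bmeas_sqr bf bf'); have j := rint_bmeas (bmeas_sqr bg bg').
rewrite /dist2 -!RintegralZl// -RintegralD//; try exact: rintZ.
apply: le_Rintegral => //; first by apply/rint_bmeas/bmeas_sqr; exact: bmeas_lin.
  by apply: rintD; exact: rintZ.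
move=> x _; have := sqr_ge0 (a * (f x - f' x) - b * (g x - g' x)).
have -> : a * f x + b * g x - (a * f' x + b * g' x) =
  a * (f x - f' x) + b * (g x - g' x) by ring.
set p := f x - f' x; set q := g x - g' x; rewrite sqrrB sqrrD !exprMn; lra.
Qed.

Lemma dist2_mul f g h M : bmeas f -> bmeas g -> bmeas h -> (forall x, `|h x| <= M) ->
  dist2 (fun x => f x * h x) (fun x => g x * h x) <= M ^+ 2 * dist2 f g.
Proof.
move=> bf bg bh hM; have i := rint_bmeas (bmeas_sqr bf bg).
rewrite /dist2 -!RintegralZl//; apply: le_Rintegral => //.
- by apply/rint_bmeas/bmeas_sqr; exact: bmeasM.
- exact: rintZ.
- move=> x _; rewrite -mulrBl exprMn mulrC ler_wpM2r ?sqr_ge0//.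
  by rewrite -(real_normK (num_real (h x))) ler_pXn2r ?nnegrE// (le_trans _ (hM x)).
Qed.

(** Dominated convergence with the constant (2 M)^2 as majorant. *)
Lemma dist2_dominated (f_ : nat -> T -> R) (f : T -> R) (M : R) : (forall n,
  measurable_fun setT (f_ n)) ->
  (forall n x, `|f_ n x| <= M) -> (forall x, f_ ^~ x @ \oo --> f x) ->
  bmeas f /\ forall e, 0 < e -> exists n, dist2 f (f_ n) < e.
Proof.
move=> mf fM cf.
have bf : bmeas f.
  split; first by apply: (@measurable_fun_cvg _ _ _ setT f_) => // x _; exact: cf.
  exists M => x; have c : `|f_ n x| @[n --> \oo] --> `|f x| by apply: cvg_norm;
    exact: cf.
  rewrite -(cvg_lim (@Rhausdorff R) c); apply: limr_le; first by apply/cvg_ex;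
    exists `|f x|.
  exact: nearW.
split => // e e0.
have bfn n : bmeas (f_ n) by split => //; exists M.
have [||||| _ _] := @dominated_convergence _ _ _ m setT measurableT
  (fun n x => ((f x - f_ n x) ^+ 2)%:E) (fun=> 0%E) (fun=> ((2 * M) ^+ 2)%:E).
- by move=> n; apply/measurable_EFinP; have [] := bmeas_sqr bf (bfn n).
- exact: measurable_cst.
- apply: aeW => x _; apply: cvg_EFin; first exact: nearW.
  rewrite -(_ : (f x - f x) ^+ 2 = 0); last by rewrite subrr expr0n.
  have c : (fun n => f x - f_ n x) @ \oo --> f x - f x.
    by apply: cvgB; [exact: cvg_cst|exact: cf].
  by rewrite expr2; under eq_fun do rewrite /= expr2; exact: cvgM.
- exact: finite_measure_integrable_cst.
- apply: aeW => x n _; rewrite /= lee_fin ger0_norm ?sqr_ge0//.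
  rewrite -(real_normK (num_real (f x - f_ n x))) ler_pXn2r ?nnegrE//.
  + have fx : `|f x| <= M.
      have c : `|f_ n x| @[n --> \oo] --> `|f x| by apply: cvg_norm; exact: cf.
      rewrite -(cvg_lim (@Rhausdorff R) c); apply: limr_le; first by apply/cvg_ex;
        exists `|f x|.
      exact: nearW.
    by rewrite (le_trans (ler_normB _ _))// mulr_natl mulr2n lerD.
  + by rewrite mulr_ge0// (le_trans _ (fM 0%N x)).
rewrite integral0 => /fine_cvgP[_ /cvgrPdist_lt /(_ e e0) [n _ /(_ n (leqnn _))]].
rewrite sub0r normrN => h; exists n; rewrite (le_lt_trans _ h)//.
exact: ler_norm.
Qed.

End bounded_functions.

Section closed_algebra.
Context {disp : measure_display} {T : measurableType disp} {R : realType}.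
Variables (m : {finite_measure set T -> \bar R}) (A : (T -> R) -> Prop).
Hypothesis A_bmeas : forall f, A f -> bmeas f.
Hypothesis A1 : A (fun=> 1).
Hypothesis A_lin : forall a b f g, A f -> A g -> A (fun x => a * f x + b * g x).
Hypothesis A_mul : forall f g, A f -> A g -> A (fun x => f x * g x).

(** The L2 closure taken inside the bounded functions: boundedness is what keeps the closure stable
    under products. *)
Definition bclosure f := bmeas f /\
  forall e, 0 < e -> exists2 g, A g & dist2 m f g < e.

Lemma bclosure_sub f : A f -> bclosure f.
Proof.
move=> Af; split; first exact: A_bmeas.
move=> e e0; exists f => //; rewrite /dist2.
by under eq_Rintegral do rewrite subrr expr0n; rewrite Rintegral0.
Qed.

Lemma bclosure_closed f : bmeas f ->
  (forall e, 0 < e -> exists2 g, bclosure g & dist2 m f g < e) -> bclosure f.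
Proof.
move=> bf h; split => // e e0; have e4 : 0 < e / 4 by rewrite divr_gt0.
have [g [bg cg] fg] := h _ e4; have [g' Ag' gg'] := cg _ e4.
exists g' => //; rewrite (le_lt_trans (dist2_triangle m bf bg (A_bmeas Ag')))//; lra.
Qed.

Lemma bclosure_lin a b f g : bclosure f -> bclosure g ->
  bclosure (fun x => a * f x + b * g x).
Proof.
move=> [bf cf] [bg cg]; split; first exact: bmeas_lin.
move=> e e0; pose K := 2 * a ^+ 2 + 2 * b ^+ 2 + 1.
have K0 : 0 < K by rewrite ltr_wpDl// addr_ge0// mulr_ge0// sqr_ge0.
have eK : 0 < e / K by rewrite divr_gt0.
have [f' Af' ff'] := cf _ eK; have [g' Ag' gg'] := cg _ eK.
exists (fun x => a * f' x + b * g' x); first exact: A_lin.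
rewrite (le_lt_trans (dist2_lin m a b bf bg (A_bmeas Af') (A_bmeas Ag')))//.
have a2 : 0 <= 2 * a ^+ 2 by rewrite mulr_ge0// sqr_ge0.
have b2 : 0 <= 2 * b ^+ 2 by rewrite mulr_ge0// sqr_ge0.
have l1 := ler_wpM2l a2 (ltW ff'); have l2 := ler_wpM2l b2 (ltW gg').
have : K * (e / K) = e by rewrite mulrC divfK// gt_eqF.
move: l1 l2 eK; move: (e / K) => t; rewrite /K !mulrDl mul1r; lra.
Qed.

(** Approximants of a bounded function need not be uniformly bounded, so the factors are replaced
    one at a time, always against a fixed bounded factor: [half] approximates [f] against an [h] in
    [A], and then [g] is approximated against [f]. *)
Lemma bclosure_mul f g : bclosure f -> bclosure g -> bclosure (fun x => f x * g x).
Proof.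
have small (M e : R) : 0 <= M -> 0 < e -> exists2 e', 0 < e' & M * e' < e.
  move=> M0 e0; exists (e / (M + 1)); first by rewrite divr_gt0// ltr_wpDl.
  by rewrite mulrA ltr_pdivrMr ?ltr_wpDl//; lra.
move=> [bf cf] cg; have [bg cg2] := cg.
have half h : A h -> bclosure (fun x => f x * h x).
  move=> Ah; have bh := A_bmeas Ah; have [_ [M hM]] := bh; split; first exact: bmeasM.
  move=> e e0; have [e' e'0 lte] := small (M ^+ 2) e (sqr_ge0 _) e0.
  have [f' Af' ff'] := cf _ e'0; exists (fun x => f' x * h x); first exact: A_mul.
  rewrite (le_lt_trans (dist2_mul m bf (A_bmeas Af') bh hM))//.
  by rewrite (le_lt_trans _ lte)// ler_wpM2l ?sqr_ge0// ltW.
apply: bclosure_closed; first exact: bmeasM.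
move=> e e0; have [_ [M fM]] := bf.
have [e' e'0 lte] := small (M ^+ 2) e (sqr_ge0 _) e0.
have [g' Ag' gg'] := cg2 _ e'0; exists (fun x => f x * g' x); first exact: half.
under [X in dist2 m X _]eq_fun do rewrite mulrC.
under [X in dist2 m _ X]eq_fun do rewrite mulrC.
rewrite (le_lt_trans (dist2_mul m bg (A_bmeas Ag') bf fM))//.
by rewrite (le_lt_trans _ lte)// ler_wpM2l ?sqr_ge0// ltW.
Qed.

Lemma bclosure_cst a : bclosure (fun=> a).
Proof.
have := bclosure_lin a 0 (bclosure_sub A1) (bclosure_sub A1).
by congr bclosure; apply/funext => x; rewrite mulr1 mul0r addr0.
Qed.

Lemma bclosure_lim (f_ : nat -> T -> R) (f : T -> R) (M : R) : (forall n,
  bclosure (f_ n)) ->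
  (forall n x, `|f_ n x| <= M) -> (forall x, f_ ^~ x @ \oo --> f x) -> bclosure f.
Proof.
move=> cf fM ff; have mf n : measurable_fun setT (f_ n) by have [[]] := cf n.
have [bf h] := dist2_dominated m mf fM ff.
by apply: bclosure_closed => // e /h [n lt]; exists (f_ n).
Qed.

Definition bclosed_set := [set B : set T | bclosure (\1_B)].

Lemma bclosed_setC B : bclosed_set B -> bclosed_set (~` B).
Proof.
move=> cB; have := bclosure_lin 1 (-1) (bclosure_cst 1) cB.
by congr bclosure; apply/funext => x; rewrite mul1r mulN1r !indicE in_setC;
  case: (x \in B); rewrite ?subrr ?subr0.
Qed.

Lemma bclosed_setI B C : bclosed_set B -> bclosed_set C -> bclosed_set (B `&` C).
Proof.
move=> cB cC; have := bclosure_mul cB cC.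
by congr bclosure; apply/funext => x; rewrite indicI.
Qed.

(** Complements come from linearity, intersections from products, and countable unions from the
    bounded pointwise limit of the indicators of finite unions. *)
Lemma sigma_algebra_bclosed_set : sigma_algebra setT bclosed_set.
Proof.
have c0 : bclosed_set set0.
  by have := bclosure_cst 0; congr bclosure; apply/funext => x; rewrite indic0.
split => // [B cB|B cB]; first by rewrite setTD; exact: bclosed_setC.
have cU n : bclosed_set (\bigcup_(k < n) B k).
  elim: n => [|n IH]; first by rewrite bigcup_mkord big_ord0.
  rewrite bigcup_mkord big_ord_recr/= -bigcup_mkord -[X in bclosed_set X]setCK setCU.
  by apply: bclosed_setC; apply: bclosed_setI; exact: bclosed_setC.
apply: (@bclosure_lim (fun n => \1_(\bigcup_(k < n) B k)) _ 1) => // [n x|x].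
  by rewrite indicE; case: (_ \in _); rewrite ?normr1 ?normr0.
have [[k _ Bk]|nB] := pselect ((\bigcup_k B k) x).
  rewrite indicE mem_set; last by exists k.
  apply: cvg_near_cst; exists k.+1 => // n /= kn.
  by rewrite indicE mem_set//; exists k.
rewrite indicE memNset//; apply: cvg_near_cst; apply: nearW => n.
by rewrite indicE memNset// => -[k _ Bk]; apply: nB; exists k.
Qed.

(* The cubic [t |-> (3 t - t^3) / 2] maps [-1, 1] to itself and its iterates
   converge pointwise to the sign function there. *)
Let p (t : R) := (3 * t - t ^+ 3) / 2.

Let iter_p_bound n t : `|t| <= 1 -> `|iter n p t| <= 1.
Proof.
move=> t1; elim: n => //= n; set s := iter n p t; rewrite !ler_norml => /andP[s1 s2].
have -> : p s = (3 * s - s * s * s) / 2 by rewrite /p; ring.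
have : 0 <= (s + 1) ^+ 2 * (2 - s) by rewrite mulr_ge0 ?sqr_ge0//; lra.
have : 0 <= (1 - s) ^+ 2 * (2 + s) by rewrite mulr_ge0 ?sqr_ge0//; lra.
by move=> u1 u2; apply/andP; split; lra.
Qed.

Let iter_pN n t : iter n p (- t) = - iter n p t.
Proof. by elim: n => //= n ->; rewrite /p; ring. Qed.

Let iter_p0 n : iter n p 0 = 0.
Proof. by elim: n => //= n ->; rewrite /p mulr0 expr0n subrr mul0r. Qed.

Let cvg_iter_p_gt0 t : 0 < t <= 1 -> (fun n => iter n p t) @ \oo --> (1 : R).
Proof.
(* Since 1 - p(s) = (1 - s) (1 - (s + s^2) / 2) and iterates stay above [t], the distance to 1
   shrinks by at least the factor 1 - t / 2. *)
move=> /andP[t0 t1]; pose q := 1 - t / 2.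
have q0 : 0 <= q by rewrite /q; lra.
have q1 : q < 1 by rewrite /q; lra.
have bnd n : [/\ t <= iter n p t, iter n p t <= 1 & 1 - iter n p t <= q ^+ n].
  elim: n => [|n /= [h1 h2 h3]]; first by rewrite /= expr0; split => //; lra.
  set s := iter n p t in h1 h2 h3 *.
  have -> : p s = (3 * s - s * s * s) / 2 by rewrite /p; ring.
  have u1 : 0 <= s * ((1 - s) * (1 + s)) by rewrite !mulr_ge0//; lra.
  have u2 : 0 <= (1 - s) ^+ 2 * (2 + s) by rewrite mulr_ge0 ?sqr_ge0//; lra.
  have u3 : 0 <= (1 - s) * (s - t + s ^+ 2) by apply: mulr_ge0; have := sqr_ge0 s; lra.
  split; [lra|lra|].
  rewrite exprS (le_trans _ (ler_wpM2l q0 h3))// /q.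
  have -> : 1 - (3 * s - s * s * s) / 2 = (1 - s) * ((1 - s) * (2 + s)) / 2 by field.
  lra.
apply: (@squeeze_cvgr _ _ _ _ (fun n => 1 - q ^+ n) (fun=> 1)).
- by apply: nearW => n; have [_ h2 h3] := bnd n; apply/andP; split => //; lra.
- rewrite -[X in _ --> X]subr0; apply: cvgB; first exact: cvg_cst.
  by apply: cvg_expr; rewrite ger0_norm.
- exact: cvg_cst.
Qed.

(** After scaling [h] into [-1, 1], the iterates of [p] are polynomials in the scaled function,
    hence stay in the closure, and converge boundedly to its sign. *)
Lemma bclosed_set_pos h : bclosure h -> bclosed_set [set x | 0 < h x].
Proof.
move=> ch; have [[mh [M hM]] _] := ch.
pose N := `|M| + 1; have N0 : 0 < N by rewrite ltr_wpDl.
pose k x := N^-1 * h x.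
have k1 x : `|k x| <= 1.
  rewrite /k normrM ger0_norm ?invr_ge0 ?(ltW N0)// mulrC ler_pdivrMr// mul1r.
  by rewrite (le_trans (hM x))// (le_trans (ler_norm _))// lerDl.
have ck : bclosure k.
  have := bclosure_lin N^-1 0 ch ch.
  by congr bclosure; apply/funext => x; rewrite mul0r addr0.
have citer n : bclosure (fun x => iter n p (k x)).
  elim: n => [//|n IH].
  have := bclosure_lin (3 / 2) (- 2^-1) IH (bclosure_mul IH (bclosure_mul IH IH)).
  by congr bclosure; apply/funext => x /=; rewrite /p; field.
have cs : bclosure (fun x => Num.sg (k x)).
  apply: (@bclosure_lim (fun n x => iter n p (k x)) _ 1) => // [n x|x].
    exact: iter_p_bound.
  case: (sgrP (k x)) => [kx|kx|kx].
  - by under eq_fun do rewrite kx iter_p0; exact: cvg_cst.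
  - by apply: cvg_iter_p_gt0; rewrite kx (le_trans _ (k1 x))// ler_norm.
  - have kn : 0 < - k x <= 1.
      by rewrite oppr_gt0 kx/= (le_trans _ (k1 x))// -normrN ler_norm.
    under eq_fun do rewrite -[k x]opprK iter_pN.
    by apply: cvgN; exact: cvg_iter_p_gt0.
(* The indicator of the positive set is (sg + sg^2) / 2. *)
have := bclosure_lin 2^-1 2^-1 cs (bclosure_mul cs cs).
congr bclosure; apply/funext => x; rewrite indicE.
have -> : (x \in [set x | 0 < h x]) = (0 < k x).
  by apply/idP/idP; rewrite inE/= /k pmulr_rgt0// invr_gt0.
case: (sgrP (k x)) => kx; rewrite ?kx ?ltxx ?(lt_gtF kx)/=; lra.
Qed.

End closed_algebra.

(** Generation by coordinate rays, phrased as an induction principle so that it applies directly to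
    the sigma-algebra [bclosed_set]. *)
Definition generates disp (T : measurableType disp) (R : realType) K
    (c : K -> T -> R) :=
  forall S : set (set T), sigma_algebra setT S ->
  (forall k a, S [set x | a < c k x]) -> forall B, measurable B -> S B.

Lemma generates_id (R : realType) : generates (fun (_ : unit) (x : R) => x).
Proof.
move=> S sS h B mB; have : (@ocitv R).-sigma.-measurable B by [].
rewrite RGenOInfty.measurableE; move: B {mB}.
apply: smallest_sub => // _ [a ->]; have := h tt a.
by congr S; apply/seteqP; split => x /=; rewrite in_itv/= andbT.
Qed.

Lemma generates_circle (R : realType) :
  generates (fun (_ : unit) (x : circle R) => circle_val x).
Proof.
move=> S sS h B [C mC <-]; rewrite setTI.
apply: (generates_id (S := [set C | S (@circle_val R @^-1` C)])) => //.
  have := sigma_algebra_image (@circle_val R) sS.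
  by congr sigma_algebra; apply/funext => D; rewrite /image_set_system/= setTI.
Qed.

Lemma generates_tuple disp (T : measurableType disp) (R : realType) K
    (c : K -> T -> R) n : generates c ->
  generates (fun (k : 'I_n * K) (x : n.-tuple T) => c k.2 (tnth x k.1)).
Proof.
move=> gc S sS h B; rewrite /measurable/=; apply: smallest_sub => // C.
rewrite -bigcup_seq => -[i _ [D mD <-]]; rewrite setTI.
apply: (gc [set D | S ((@tnth n T ^~ i) @^-1` D)]) => //.
  have := sigma_algebra_image (@tnth n T ^~ i) sS.
  by congr sigma_algebra; apply/funext => E; rewrite /image_set_system/= setTI.
by move=> k a; exact: (h (i, k)).
Qed.

Section trigonometric_algebra.
Context {disp : measure_display} {T : measurableType disp} {R : realType}.
Variables (K : finType) (c : K -> T -> R).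
Hypothesis mc : forall k, measurable_fun setT (c k).
(* the admissible frequencies *)
Variable L : (K -> R) -> Prop.
Hypothesis L0 : L (fun=> 0).
Hypothesis LD : forall a b, L a -> L b -> L (fun k => a k + b k).
Hypothesis LB : forall a b, L a -> L b -> L (fun k => a k - b k).

Definition phase (a : K -> R) (x : T) : R := \sum_k a k * c k x.

Inductive trig : (T -> R) -> Prop :=
| trig_cos a t of L a : trig (fun x => cos (phase a x + t))
| trig_lin a b f g of trig f & trig g : trig (fun x => a * f x + b * g x).

Lemma phaseD a b x : phase (fun k => a k + b k) x = phase a x + phase b x.
Proof. by rewrite -big_split; apply: eq_bigr => k _; rewrite mulrDl. Qed.

Lemma phaseB a b x : phase (fun k => a k - b k) x = phase a x - phase b x.
Proof. by rewrite -sumrB; apply: eq_bigr => k _; rewrite mulrBl. Qed.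

Lemma phase0 x : phase (fun=> 0) x = 0.
Proof. by apply: big1 => k _; rewrite mul0r. Qed.

Lemma phase_delta k t x : phase (fun l => (l == k)%:R * t) x = t * c k x.
Proof.
rewrite /phase (bigD1 k)//= eqxx mul1r big1 ?addr0// => l /negbTE ->.
by rewrite !mul0r.
Qed.

Lemma measurable_phase a : measurable_fun setT (phase a).
Proof. by apply: measurable_sum => k; exact: measurable_funM. Qed.

Lemma measurable_cos_phase a t : measurable_fun setT (fun x => cos (phase a x + t)).
Proof.
apply: (measurableT_comp (continuous_measurable_fun (@continuous_cos R))).
by apply: measurable_funD => //; exact: measurable_phase.
Qed.

Lemma trig_bmeas f : trig f -> bmeas f.
Proof.
elim=> [a t _|a b g h _ bg _ bh]; last exact: bmeas_lin.
split; first exact: measurable_cos_phase.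
by exists 1 => x; exact: cos_max.
Qed.

Lemma trig_cst (a : R) : trig (fun=> a).
Proof.
have := trig_lin a 0 (trig_cos 0 L0) (trig_cos 0 L0); congr trig.
by apply/funext => x; rewrite phase0 addr0 cos0 mulr1 mul0r addr0.
Qed.

(** The product-to-sum formula produces sums and differences of frequencies, whence the two closure
    conditions on [L]. *)
Lemma trigM f g : trig f -> trig g -> trig (fun x => f x * g x).
Proof.
move=> tf; elim: tf g => {f} [a t La|a b f f' tf IH tf' IH'] g tg.
  elim: tg => {g} [b s Lb|b b' g g' tg IH tg' IH'].
    have := trig_lin 2^-1 2^-1 (trig_cos (t + s) (LD La Lb)) (trig_cos (t - s) (LB La
      Lb)).
    congr trig; apply/funext => x; rewrite phaseD phaseB.
    set u := phase a x; set v := phase b x.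
    have -> : u + v + (t + s) = (u + t) + (v + s) by ring.
    have -> : u - v + (t - s) = (u + t) - (v + s) by ring.
    by rewrite cosD cosB; field.
  have := trig_lin b b' IH IH'; congr trig; apply/funext => x; ring.
by have := trig_lin a b (IH _ tg) (IH' _ tg); congr trig; apply/funext => x; ring.
Qed.

End trigonometric_algebra.

(** * Uniqueness of a measure from its characteristic function *)

Section characteristic_function.
Context {disp : measure_display} {T : measurableType disp} {R : realType}.
Variables (K : finType) (c : K -> T -> R).
Hypothesis mc : forall k, measurable_fun setT (c k).

Let L (a : K -> R) := True.

Let trig1 : trig c L (fun=> 1). Proof. exact: trig_cst. Qed.

(** Arbitrarily slow sines are available: as soon as |c_k - a| / (n + 1) < pi, the sign of sin ((c_k
    - a) / (n + 1)) is that of c_k - a, so the ray is a pointwise limit of sets where a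
    trigonometric function is positive. *)
Lemma trig_ray_bclosed (m : {finite_measure set T -> \bar R}) k (a : R) :
  bclosed_set m (trig c L) [set x | a < c k x].
Proof.
have tM f g : trig c L f -> trig c L g -> trig c L (fun x => f x * g x) by exact: trigM.
have tL := @trig_lin _ _ R K c L; have tb := trig_bmeas mc (L := L).
pose s n x := sin ((c k x - a) / n.+1%:R).
have cs n : bclosed_set m (trig c L) [set x | 0 < s n x].
  apply: (bclosed_set_pos tb tL tM); apply: (bclosure_sub _ tb).
  have := @trig_cos _ _ R K c L (fun l => (l == k)%:R * n.+1%:R^-1)
    (- (a / n.+1%:R) - pi / 2) I.
  congr trig; apply/funext => x; rewrite phase_delta addrA cosBpihalf /s.
  by congr sin; rewrite mulrBl mulrC.
apply: (bclosure_lim tb (M := 1) cs) => [n x|x].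
  by rewrite indicE; case: (_ \in _); rewrite ?normr1 ?normr0.
pose y := c k x - a.
have [n0 hn0] : exists n0, `|y| < n0.+1%:R * pi.
  exists (Num.bound `|y|); have := archi_boundP (normr_ge0 y).
  move=> /lt_le_trans; apply; rewrite -[leLHS]mulr1 ler_pM ?ler_nat//.
  by rewrite (le_trans _ (pi_ge2 R))// ler1n.
have yn n : (n0 <= n)%N -> `|y / n.+1%:R| < pi.
  move=> nn; rewrite normrM normfV [`|n.+1%:R|]ger0_norm// ltr_pdivrMr//.
  by rewrite (lt_le_trans hn0)// mulrC ler_wpM2l ?pi_ge0// ler_nat.
apply: cvg_near_cst; exists n0 => // n /= /yn; rewrite ltr_norml => /andP[l1 l2].
have [ax|ax] := ltP a (c k x).
  rewrite !indicE !mem_set//= /s; apply: sin_gt0_pi; rewrite l2 andbT.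
  by rewrite divr_gt0// subr_gt0.
rewrite !indicE !memNset//= ; first by apply/negP; rewrite -leNgt.
apply/negP; rewrite -leNgt /s -[_ / _]opprK sinN oppr_le0; apply: sin_ge0_pi.
rewrite lerNl (ltW l1) andbC/= -mulNr divr_ge0//; lra.
Qed.

Variables m1 m2 : {finite_measure set T -> \bar R}.

Let fin_add : fin_num_fun (measure_add m1 m2).
Proof. by move=> U mU; rewrite measure_addE fin_numD !fin_num_measure. Qed.

HB.instance Definition _ := Measure.copy (measure_add m1 m2)
  (msum (fun n => if n is 0%N then (m1 : {measure set T -> \bar R}) else m2) 2).

HB.instance Definition _ := @Measure_isFinite.Build _ _ _
  (measure_add m1 m2) fin_add.

(** Approximation takes place once, in the sum of the two measures, so that one trigonometric
    function is close to the indicator for both. *)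
Let le_dist2 (m : {finite_measure set T -> \bar R}) f g :
  (forall h : T -> \bar R, measurable_fun setT h -> (forall x, 0 <= h x)%E ->
    (\int[m]_x h x <= \int[measure_add m1 m2]_x h x)%E) ->
  bmeas f -> bmeas g -> dist2 m f g <= dist2 (measure_add m1 m2) f g.
Proof.
move=> hle bf bg; rewrite /dist2; apply: fine_le.
- exact/integrable_fin_num/rint_bmeas/bmeas_sqr.
- exact/integrable_fin_num/rint_bmeas/bmeas_sqr.
- by apply: hle => [|x]; [apply/measurable_EFinP;
    have [] := bmeas_sqr bf bg|rewrite lee_fin sqr_ge0].
Qed.

(** Pointwise |f - g| <= (f - g)^2 / t + t for a free weight [t]; on a finite measure this turns
    closeness in L2 into closeness of integrals. *)
Let Rintegral_dist (m : {finite_measure set T -> \bar R}) f g (t : R) : bmeas f ->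
  bmeas g ->
  0 < t -> `|\int[m]_x f x - \int[m]_x g x| <= t^-1 * dist2 m f g + t * fine (m setT).
Proof.
move=> bf bg t0; have i := rint_bmeas m bf; have j := rint_bmeas m bg.
have k := rint_bmeas m (bmeas_sqr bf bg).
rewrite -RintegralB// (le_trans (le_normr_Rintegral _ _))//; first exact: rintB.
rewrite /dist2 -RintegralZl// -(Rintegral_cst m measurableT) -RintegralD//.
- apply: le_Rintegral => //.
  + exact/integrable_norm/rintB.
  + by apply: rintD; [exact: rintZ|exact: finite_measure_integrable_cst].
  + move=> x _; rewrite -(real_normK (num_real (f x - g x))); set q := `|_|.
    have : 0 <= t^-1 * (q - t) ^+ 2 by rewrite mulr_ge0 ?sqr_ge0// invr_ge0 ltW.
    have q0 : 0 <= q by exact: normr_ge0.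
    have -> : t^-1 * (q - t) ^+ 2 = t^-1 * q ^+ 2 - 2 * q + t by field; rewrite gt_eqF.
    by lra.
- exact: rintZ.
- exact: finite_measure_integrable_cst.
Qed.

(* The shift [t] lets cosines carry the whole characteristic function. *)
Lemma measure_unique_cos : generates c ->
  (forall a t, \int[m1]_x cos (phase c a x + t) = \int[m2]_x cos (phase c a x + t)) ->
  forall B, measurable B -> m1 B = m2 B.
Proof.
move=> gc h B mB.
have tM f g : trig c L f -> trig c L g -> trig c L (fun x => f x * g x) by exact: trigM.
have tL := @trig_lin _ _ R K c L; have tb := trig_bmeas mc (L := L).
have ht f : trig c L f -> \int[m1]_x f x = \int[m2]_x f x.
  elim=> // a b g g' tg IH tg' IH'.
  have i1 := rint_bmeas m1 (tb _ tg); have i2 := rint_bmeas m2 (tb _ tg).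
  have j1 := rint_bmeas m1 (tb _ tg'); have j2 := rint_bmeas m2 (tb _ tg').
  by rewrite !RintegralD ?RintegralZl ?IH ?IH'//; exact: rintZ.
have [bB cB] : bclosure (measure_add m1 m2) (trig c L) (\1_B).
  apply: (gc (bclosed_set (measure_add m1 m2) (trig c L))) => //.
    exact: (sigma_algebra_bclosed_set _ tb trig1 tL tM).
  by move=> k a; exact: trig_ray_bclosed.
suff : fine (m1 B) = fine (m2 B).
  by move=> mm; rewrite -[LHS]fineK ?fin_num_measure// -[RHS]fineK ?fin_num_measure//
    mm.
have mB' (m : {finite_measure set T -> \bar R}) : fine (m B) = \int[m]_x \1_B x.
  by rewrite /Rintegral integral_indic// setIT.
rewrite !mB'; apply/eqP; rewrite -subr_eq0 -normr_eq0 eq_le normr_ge0 andbT.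
pose M := fine (m1 setT) + fine (m2 setT).
have M0 : 0 <= M by rewrite addr_ge0// fine_ge0.
apply: (@arbitrarily_small _ _ (2 + M)); first by rewrite addr_ge0.
(* A squared distance below e^2, used with the weight t = e, makes both terms of [Rintegral_dist] of
   order e. *)
move=> e e0 e1; have [g tg lt] := cB (e ^+ 2) (exprn_gt0 _ e0).
have bg := tb _ tg.
have l1 : dist2 m1 (\1_B) g <= e ^+ 2.
  rewrite (le_trans _ (ltW lt))//; apply: le_dist2 => // k mk k0.
  by rewrite ge0_integral_measure_add// leeDl// integral_ge0.
have l2 : dist2 m2 (\1_B) g <= e ^+ 2.
  rewrite (le_trans _ (ltW lt))//; apply: le_dist2 => // k mk k0.
  by rewrite ge0_integral_measure_add// leeDr// integral_ge0.
have d1 := Rintegral_dist m1 bB bg e0; have d2 := Rintegral_dist m2 bB bg e0.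
have ee : e^-1 * e ^+ 2 = e by field; rewrite gt_eqF.
have ei : 0 <= e^-1 by rewrite invr_ge0 ltW.
have {}l1 := ler_wpM2l ei l1; have {}l2 := ler_wpM2l ei l2.
rewrite ee in l1 l2.
rewrite (_ : _ - _ = (\int[m1]_x \1_B x - \int[m1]_x g x) - (\int[m2]_x \1_B x -
  \int[m2]_x g x)).
  by rewrite (le_trans (ler_normB _ _))// /M; lra.
by rewrite (ht _ tg); ring.
Qed.

End characteristic_function.

(** * Density of simple functions *)

Section indicators_total.
Context {disp : measure_display} {T : measurableType disp} {R : realType}.
Variable m : {finite_measure set T -> \bar R}.

(** Sets bundled with their measurability, so that indicators form a family indexed by a type, as
    [comb] and [total] expect. *)
Definition mset := {A : set T | measurable A}.

Definition ind (A : mset) : T -> R[i] := cindic (sval A).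

Lemma cindicE (A : set T) x : cindic A x = (x \in A)%:R :> R[i].
Proof. by rewrite /cindic indicE; case: (x \in A). Qed.

Lemma cmeasurable_cindic (A : set T) : measurable A -> cmeasurable (@cindic _ _ R A).
Proof. by move=> mA; apply: cmeasurable_real; exact: measurable_indic. Qed.

Lemma L2_cindic (A : set T) : measurable A -> L2 m (@cindic _ _ R A).
Proof.
move=> mA; apply: (@L2_bounded _ _ _ _ _ 1); first exact: cmeasurable_cindic.
move=> x; rewrite sqmod_real indicE; case: (x \in A); rewrite ?expr1n// expr0n//.
Qed.

Lemma L2_ind A : L2 m (ind A).
Proof. exact/L2_cindic/(svalP A). Qed.

Lemma nrm_real (f : T -> R) : nrm m (fun x => (f x)%:C) = Num.sqrt (\int[m]_x (f x) ^+
  2).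
Proof. by congr Num.sqrt; apply: eq_Rintegral => x _; rewrite sqmod_real. Qed.

(** Simple functions increase to [f]; the squared error is dominated by f^2, so pointwise
    convergence becomes L2 convergence. *)
Lemma approx_nonneg (f : T -> R) : L2 m (fun x => (f x)%:C) -> (forall x, 0 <= f x) ->
  approx m ind (fun x => (f x)%:C).
Proof.
move=> iF f0; have [[mf _] _] := iF.
have mf' : measurable_fun setT (EFin \o f) by exact/measurable_EFinP.
have [g [ndg cg]] := approximation measurableT mf' (fun t _ => f0 t : (0 <= (EFin \o f)
  t)%E).
have cgx x : g ^~ x @ \oo --> f x by have /fine_cvgP[] := cg x I.
have gf n x : g n x <= f x.
  have nd : nondecreasing_seq (g ^~ x) by move=> i j ij; have /lefP := ndg i j ij;
    exact.
  rewrite -(cvg_lim (@Rhausdorff R) (cgx x)); apply: nondecreasing_cvgn_le => //.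
  by apply/cvg_ex; exists (f x).
have ig n : L2 m (fun x => (g n x)%:C).
  have /L2P[_ i] := iF; apply/L2P; split; first exact: cmeasurable_real.
  apply: (rint_le _ i); first exact/measurable_sqmod/cmeasurable_real.
  move=> x; rewrite !sqmod_real ger0_norm ?sqr_ge0//.
  by rewrite ler_pXn2r ?nnegrE.
have ag n : approx m ind (fun x => (g n x)%:C).
  pose s : seq R := finmap.enum_fset (fset_set (g n @` setT)).
  have ms i : measurable (g n @^-1` [set s`_i]) by exact: measurable_sfunP.
  have -> : (fun x => (g n x)%:C) = comb ind (fun i : 'I_(size s) => (s`_i)%:C)
      (fun i => exist _ _ (ms i) : mset).
    apply/funext => x; rewrite (fimfunEord (g n)) /comb rmorph_sum.
    by apply: eq_bigr => i _; rewrite rmorphM.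
  by apply: approx_comb; exact: L2_ind.
apply: (approx_closed L2_ind) => // eps e0.
have /L2P[_ i] := iF.
have [||||| _ _] := @dominated_convergence _ _ _ m setT measurableT
   (fun n x => ((f x - g n x) ^+ 2)%:E) (fun=> 0%E) (fun x => (sqmod (f x)%:C)%:E).
- by move=> n; apply/measurable_EFinP; apply: measurable_funX; exact: measurable_funB.
- exact: measurable_cst.
- apply: aeW => x _; apply: cvg_EFin; first exact: nearW.
  rewrite -(_ : (f x - f x) ^+ 2 = 0); last by rewrite subrr expr0n.
  have c : (fun n => f x - g n x) @ \oo --> f x - f x.
    by apply: cvgB; [exact: cvg_cst|exact: cgx].
  by rewrite expr2; under eq_fun do rewrite /= expr2; exact: cvgM.
- exact: i.
- apply: aeW => x n _; rewrite /= lee_fin ger0_norm ?sqr_ge0// sqmod_real.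
  by rewrite ler_pXn2r ?nnegrE ?subr_ge0// lerBlDr lerDl.
rewrite integral0 => /fine_cvgP[_ /cvgrPdist_lt /(_ _ (exprn_gt0 2 e0)) [n _ /(_ n
  (leqnn _))]].
rewrite sub0r normrN => h; exists (fun x => (g n x)%:C); split => //.
under [X in nrm m X]eq_fun do rewrite -rmorphB.
rewrite nrm_real -[ltRHS]ger0_norm ?(ltW e0)// -sqrtr_sqr ltr_sqrt ?exprn_gt0//.
by rewrite (le_lt_trans _ h)// ler_norm.
Qed.

Lemma total_ind : total m ind.
Proof.
move=> u iu; have [[m1 m2] _] := iu.
pose f1 x := Num.max (complex.Re (u x)) 0; pose f2 x := Num.max (- complex.Re (u x)) 0.
pose f3 x := Num.max (complex.Im (u x)) 0; pose f4 x := Num.max (- complex.Im (u x)) 0.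
have aux (f : T -> R) : measurable_fun setT f -> (forall x, 0 <= f x) ->
    (forall x, f x ^+ 2 <= sqmod (u x)) ->
      L2 m (fun x => (f x)%:C) /\ approx m ind (fun x => (f x)%:C).
  move=> mf f0 fu; suff i : L2 m (fun x => (f x)%:C) by split => //;
    exact: approx_nonneg.
  have /L2P[_ i] := iu; apply/L2P; split; first exact: cmeasurable_real.
  apply: (rint_le _ i); first exact/measurable_sqmod/cmeasurable_real.
  by move=> x; rewrite sqmod_real ger0_norm ?sqr_ge0.
have mx (a b : R) : Num.max a 0 ^+ 2 <= a ^+ 2 + b ^+ 2.
  have := sqr_ge0 a; have := sqr_ge0 b.
  by case: (leP a 0) => _; rewrite ?expr0n/=; lra.
have [i1 a1] : L2 m (fun x => (f1 x)%:C) /\ approx m ind (fun x => (f1 x)%:C).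
  apply: aux => [|x|x]; first exact: measurable_maxr.
    by rewrite le_max lexx orbT.
  exact: mx.
have [i2 a2] : L2 m (fun x => (f2 x)%:C) /\ approx m ind (fun x => (f2 x)%:C).
  apply: aux => [|x|x]; first by apply: measurable_maxr => //; exact: measurable_funN.
    by rewrite le_max lexx orbT.
  by rewrite /sqmod -(sqrrN (complex.Re _)); exact: mx.
have [i3 a3] : L2 m (fun x => (f3 x)%:C) /\ approx m ind (fun x => (f3 x)%:C).
  apply: aux => [|x|x]; first exact: measurable_maxr.
    by rewrite le_max lexx orbT.
  by rewrite /sqmod addrC; exact: mx.
have [i4 a4] : L2 m (fun x => (f4 x)%:C) /\ approx m ind (fun x => (f4 x)%:C).
  apply: aux => [|x|x]; first by apply: measurable_maxr => //; exact: measurable_funN.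
    by rewrite le_max lexx orbT.
  by rewrite /sqmod addrC -(sqrrN (complex.Im _)); exact: mx.
have a12 := approx_lin L2_ind 1 (-1) i1 i2 a1 a2.
have a34 := approx_lin L2_ind 'i (- 'i) i3 i4 a3 a4.
have := approx_lin L2_ind 1 1 (L2_lin 1 (-1) i1 i2) (L2_lin 'i (- 'i) i3 i4) a12 a34.
congr approx; apply/funext => x.
have mm (a : R) : Num.max a 0 - Num.max (- a) 0 = a.
  by case: (leP a 0) => h; case: (leP (- a) 0) => h'; lra.
have h1 : f1 x - f2 x = complex.Re (u x) by exact: mm.
have h2 : f3 x - f4 x = complex.Im (u x) by exact: mm.
apply: complex_ext; rewrite !ReImE/= -?h1 -?h2;
  move: (f1 x) (f2 x) (f3 x) (f4 x) => p q r s; lra.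
Qed.

(** Random integrals are prescribed only on combinations of disjoint sets. The atom of a set [j] of
    indices consists of the points lying in [A k] exactly for the [k] in [j], and carries the sum of
    the corresponding coefficients. *)
Lemma comb_ind_disjoint N (c : 'I_N -> R[i]) (A : 'I_N -> mset) :
  exists N' (c' : 'I_N' -> R[i]) (B : 'I_N' -> set T),
    [/\ forall s, measurable (B s), trivIset setT B &
     comb ind c A = fun x => \sum_(s < N') c' s * cindic (B s) x].
Proof.
pose J := {set 'I_N}.
pose atom (j : J) : set T := \bigcap_(k in [set: 'I_N]) (if k \in j then sval (A k)
  else ~` sval (A k)).
have atomP j x : atom j x <-> j = [set k | x \in sval (A k)]%SET.
  split=> [h|-> k _].
    apply/setP => k; rewrite inE; have := h k I.
    by case: ifP => _ /= H; [rewrite mem_set|rewrite memNset].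
  rewrite inE; case: ifP => /=; first by rewrite inE.
  by move/negbT; rewrite notin_setE.
pose ev (s : 'I_#|{: J}|) : J := enum_val s.
exists #|{: J}|, (fun s => \sum_(k in ev s) c k), (fun s => atom (ev s)).
split.
- move=> s; apply: fin_bigcap_measurable => // k _.
  by case: ifP => _; [|apply: measurableC]; exact: (svalP (A k)).
- move=> s t _ _ [x [/atomP h1 /atomP h2]]; apply: enum_val_inj.
  by rewrite -/(ev s) -/(ev t) h1 h2.
- apply/funext => x; rewrite /comb.
  pose jx : J := [set k | x \in sval (A k)]%SET.
  rewrite (bigD1 (enum_rank jx))//= [X in _ + X]big1 ?addr0; last first.
    move=> s sj; rewrite cindicE memNset ?mulr0// => /atomP h.
    by move/negP: sj; apply; rewrite -(enum_valK s) -/(ev s) h.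
  rewrite cindicE mem_set; last by apply/atomP; rewrite /ev enum_rankK.
  rewrite mulr1 /ev enum_rankK [RHS]big_mkcond/=; apply: eq_bigr => k _.
  by rewrite inE /ind cindicE; case: (x \in _); rewrite ?mulr1 ?mulr0.
Qed.

End indicators_total.

(** * Characters and reflection on the torus *)

Section torus_characters.
Variables (R : realType) (nu : nat).
Local Notation torus := (torus R nu).

Lemma measurable_circle_val : measurable_fun setT (@circle_val R : circle R -> R).
Proof. by move=> _ B mB; rewrite setTI; exists B => //; rewrite setTI. Qed.

Lemma measurable_fun_circle d (T : measurableType d) (f : T -> circle R) :
  measurable_fun setT (fun x => circle_val (f x)) -> measurable_fun setT f.
Proof.
move=> mf _ B [C mC <-]; rewrite !setTI.
by have := mf measurableT C mC; rewrite setTI.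
Qed.

Definition coord (k : 'I_nu) (x : torus) : R := circle_val (tnth x k).

Lemma measurable_coord k : measurable_fun setT (coord k).
Proof. exact: (measurableT_comp measurable_circle_val (measurable_tnth k)). Qed.

Lemma generates_torus : generates coord.
Proof.
move=> S sS h; apply: (generates_tuple (@generates_circle R)) => // k a.
exact: h.
Qed.

Definition int_freq (a : 'I_nu -> R) :=
  exists p : 'rV[int]_nu, forall k, a k = (p 0 k)%:~R.

Let int_freq0 : int_freq (fun=> 0).
Proof. by exists 0 => k; rewrite mxE. Qed.

Let int_freqD a b : int_freq a -> int_freq b -> int_freq (fun k => a k + b k).
Proof. by move=> [p ap] [q bq]; exists (p + q) => k; rewrite mxE rmorphD/= ap bq. Qed.

Let int_freqB a b : int_freq a -> int_freq b -> int_freq (fun k => a k - b k).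
Proof. by move=> [p ap] [q bq]; exists (p - q) => k; rewrite !mxE rmorphB/= ap bq. Qed.

Lemma characterE (p : 'rV[int]_nu) x : character p x =
  cos (phase coord (fun k => (p 0 k)%:~R : R) x) +i* sin (phase coord (fun k => (p 0
    k)%:~R) x).
Proof. by []. Qed.

Lemma sqmod_character (p : 'rV[int]_nu) (x : torus) : sqmod (character p x) = 1.
Proof. exact: cos2Dsin2. Qed.

Lemma cmeasurable_character (p : 'rV[int]_nu) : cmeasurable (@character R nu p).
Proof.
have mp := measurable_phase measurable_coord (fun k => (p 0 k)%:~R : R).
split => /=.
  exact: (measurableT_comp (continuous_measurable_fun (@continuous_cos R)) mp).
exact: (measurableT_comp (continuous_measurable_fun (@continuous_sin R)) mp).
Qed.

Lemma L2_character (m : {finite_measure set torus -> \bar R}) p : L2 m (character p).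
Proof.
apply: (@L2_bounded _ _ _ _ _ 1); first exact: cmeasurable_character.
by move=> x; rewrite sqmod_character.
Qed.

Lemma character_mul_conj (p q : 'rV[int]_nu) (x : torus) :
  character p x * Num.conj (character q x) = character (p - q) x.
Proof.
have -> : character (p - q) x = cos (phase coord (fun k => (p 0 k)%:~R) x - phase coord
  (fun k => (q 0 k)%:~R) x)
   +i* sin (phase coord (fun k => (p 0 k)%:~R) x - phase coord (fun k => (q 0 k)%:~R)
     x).
  rewrite characterE -phaseB; have ->
    : (fun k => ((p - q) 0 k)%:~R : R) = (fun k => (p 0 k)%:~R - (q 0 k)%:~R) => //.
  by apply/funext => k; rewrite !mxE rmorphB.
apply: complex_ext; rewrite !ReImE/= ?cosB ?sinB/=; ring.
Qed.

Lemma trig_comb f : trig coord int_freq f ->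
  exists N (c : 'I_N -> R[i]) (s : 'I_N -> 'rV[int]_nu),
    (fun x => (f x)%:C) = comb (@character R nu) c s.
Proof.
elim=> {f} [a t [p ap]|a b f g _ [N [c [s fE]]] _ [N' [c' [s' gE]]]].
  (* cos (u + t) is half the sum of exp (it) exp (iu) and its conjugate; the conjugate of a
     character belongs to the opposite frequency. *)
  exists 2, (fun k => if k == ord0 then (cos t / 2) +i* (sin t / 2) else (cos t / 2)
    -i* (sin t / 2)),
    (fun k => if k == ord0 then p else - p).
  apply/funext => x; rewrite /comb !big_ord_recl big_ord0/= addr0.
  have -> : character (- p) x = Num.conj (character p x).
    by rewrite -[in LHS]sub0r -character_mul_conj characterE (_ : phase _ _ _ = 0)
      ?cos0 ?sin0 ?mul1r//;
      apply: big1 => k _; rewrite mxE mul0r.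
  have -> : a = (fun k => (p 0 k)%:~R) by apply/funext.
  rewrite characterE cosD; set u := phase _ _ _.
  by apply: complex_ext; rewrite !ReImE/=; field.
have [N'' [c'' [s'' E]]] := comb_lin a%:C b%:C c s c' s'.
exists N'', c'', s''; rewrite -E -fE -gE; apply/funext => x.
by rewrite rmorphD !rmorphM.
Qed.

(** On the period that starts at r - 2 pi, the cosine exceeds cos r exactly on the arc from - r to
    r. *)
Let cos_ltP (r y : R) : 0 <= r <= pi -> r - pi *+ 2 <= y < r ->
  (cos r < cos y) = (- r < y).
Proof.
move=> /andP[r0 rpi] /andP[y1 y2]; have p0 := pi_gt0 R.
have rI : r \in `[0, pi] by rewrite in_itv/= r0.
have [ry|ry] := ltP (- r) y.
  rewrite -(cos_norm y) ltr_cos// ?ltr_norml ?ry//.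
  by rewrite in_itv/= normr_ge0/= ler_norml; apply/andP; split; lra.
apply/negbTE; rewrite -leNgt; have [ypi|ypi] := leP (- pi) y.
  rewrite -cosN leNgt ltr_cos// ?in_itv/= -?leNgt; first lra.
  by apply/andP; split; lra.
rewrite -cosD2pi leNgt ltr_cos// ?in_itv/= -?leNgt; first lra.
by apply/andP; split; lra.
Qed.

(** Frequencies are integers here, so slow sines are out of reach. Instead the ray is an arc of the
    circle, cut out by a single cosine of frequency one. *)
Lemma torus_ray_bclosed (m : {finite_measure set torus -> \bar R}) k (a : R) :
  bclosed_set m (trig coord int_freq) [set x | a < coord k x].
Proof.
have tL := @trig_lin _ _ R _ coord int_freq.
have tM f g : trig coord int_freq f -> trig coord int_freq g ->
  trig coord int_freq (fun x => f x * g x) by exact: trigM.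
have tb := trig_bmeas measurable_coord (L := int_freq).
have t1 : trig coord int_freq (fun=> 1) by exact: trig_cst.
have xpi x : - pi <= coord k x < pi by exact: (valP (tnth x k)).
have [s0 sC _] := sigma_algebra_bclosed_set m tb t1 tL tM.
have [api|api] := ltP a (- pi).
  rewrite (_ : [set x | _] = setT); first by rewrite -setC0 -setTD; exact: sC.
  apply/seteqP; split => // x _ /=; have /andP[+ _] := xpi x; exact: lt_le_trans.
have [pia|pia] := leP pi a.
  rewrite (_ : [set x | _] = set0)//.
  apply/seteqP; split => // x /= ax; have /andP[_] := xpi x.
  by move=> /(lt_trans ax); rewrite ltNge pia.
(* Half-width and centre of the arc from [a] to pi: on the torus, x > a is equivalent to cos (x - c)
   > cos r. *)
pose r := (pi - a) / 2; pose c := (pi + a) / 2.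
have delta : int_freq (fun l => (l == k)%:R * 1).
  by exists (\row_l (l == k)%:R) => l; rewrite mxE mulr1; case: (l == k).
have := bclosed_set_pos tb tL tM (bclosure_sub m tb
  (tL 1 (- cos r) _ _ (trig_cos coord (- c) delta) t1)).
congr bclosed_set; apply/seteqP; split => x /=;
  have /andP[x1 x2] := xpi x; rewrite phase_delta !mul1r mulr1 subr_gt0 cos_ltP.
- by rewrite /r /c; lra.
- by rewrite /r; apply/andP; split; lra.
- by rewrite /r /c; apply/andP; split; lra.
- by rewrite /r /c; lra.
- by rewrite /r; apply/andP; split; lra.
- by rewrite /r /c; apply/andP; split; lra.
Qed.

Lemma total_character (m : {finite_measure set torus -> \bar R}) :
  total m (@character R nu).
Proof.
have tL := @trig_lin _ _ R _ coord int_freq.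
have tM f g : trig coord int_freq f -> trig coord int_freq g ->
  trig coord int_freq (fun x => f x * g x) by exact: trigM.
have tb := trig_bmeas measurable_coord (L := int_freq).
have t1 : trig coord int_freq (fun=> 1) by exact: trig_cst.
move=> u iu; apply: (approx_trans (L2_character m) (@L2_ind _ _ _ m)) => //;
  last exact: total_ind.
move=> [B mB] eps e0; have [_ cB] : bclosed_set m (trig coord int_freq) B.
  apply: (generates_torus (sigma_algebra_bclosed_set m tb t1 tL tM)) => //.
  by move=> k a; exact: torus_ray_bclosed.
have [g tg lt] := cB _ (exprn_gt0 2 e0).
have [N [c [s gE]]] := trig_comb tg; exists N, c, s; rewrite -gE /ind/=.
rewrite [X in nrm m X](_ : _ = (fun x => (\1_B x - g x)%:C)); last first.
  by apply/funext => x; rewrite rmorphB.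
rewrite nrm_real -[ltRHS]ger0_norm ?(ltW e0)// -sqrtr_sqr ltr_sqrt ?exprn_gt0//.
Qed.

Let twopi_int (n : int) : cos (n%:~R * (pi *+ 2)) = 1 :> R /\ sin (n%:~R * (pi *+ 2)) =
  0 :> R.
Proof.
have aux (k : nat) : cos (k%:R * (pi *+ 2)) = 1 :> R /\ sin (k%:R * (pi *+ 2)) = 0 :> R.
  elim: k => [|k [c s]]; first by rewrite mul0r cos0 sin0.
  by rewrite -addn1 natrD mulrDl mul1r cosD2pi sinD2pi.
case: n => k; first exact: aux.
have [c s] := aux k.+1; rewrite NegzE mulrNz mulNr cosN sinN -pmulrn c s oppr0//.
Qed.

Lemma circle_val_opp (x : circle R) : circle_val (circle_opp x) =
  if circle_val x == - pi then - pi else - circle_val x.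
Proof.
rewrite /circle_opp /circle_val; have /andP[] := valP x; set y := val x => y1 y2.
case: ifPn => [/eqP yE|yn].
  by rewrite val_insubd -/y yE opprK ltxx andbF.
rewrite val_insubd -/y lerN2 (ltW y2)/= ltrNl lt_def y1 andbT.
by rewrite yn.
Qed.

Lemma circle_oppK : involutive (@circle_opp R).
Proof.
move=> x; apply: val_inj; rewrite -!/(circle_val _) !circle_val_opp.
have [->|xn] := eqVneq (circle_val x) (- pi); first by rewrite eqxx.
rewrite ifF ?opprK//; apply/negP => /eqP/oppr_inj h.
by have /andP[_] := valP x; rewrite -/(circle_val x) h ltxx.
Qed.

Lemma torus_oppK : involutive (@torus_opp R nu).
Proof. by move=> x; apply: eq_from_tnth => k; rewrite !tnth_mktuple circle_oppK. Qed.

Lemma measurable_torus_opp : measurable_fun setT (@torus_opp R nu).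
Proof.
apply/measurable_fun_tnthP => k.
rewrite [X in measurable_fun _ X](_ : _ = @circle_opp R \o (@tnth nu _ ^~ k));
  last first.
  by apply/funext => x; rewrite /= tnth_mktuple.
apply: measurableT_comp (measurable_tnth k); apply: measurable_fun_circle.
under eq_fun do rewrite circle_val_opp.
apply: measurable_fun_ifT.
- by apply: measurable_fun_eqr => //; exact: measurable_circle_val.
- exact: measurable_cst.
- by apply: measurableT_comp => //; exact: measurable_circle_val.
Qed.

Lemma torus_opp_image (A : set torus) : @torus_opp R nu @` A = @torus_opp R nu @^-1` A.
Proof.
apply/seteqP; split => [_ [x Ax <-]|x Ax] /=; first by rewrite torus_oppK.
by exists (torus_opp x) => //; rewrite torus_oppK.
Qed.

Lemma measurable_torus_opp_image (A : set torus) : measurable A ->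
  measurable (@torus_opp R nu @` A).
Proof.
move=> mA; rewrite torus_opp_image -[X in measurable X]setTI.
exact: measurable_torus_opp.
Qed.

Lemma character_opp (p : 'rV[int]_nu) (x : torus) :
  character p (torus_opp x) = Num.conj (character p x).
Proof.
(* The correction in full turns: at a coordinate equal to - pi the reflected value is - pi rather
   than pi, which changes the phase by - 2 pi p_k. *)
pose n : int := \sum_k (if circle_val (tnth x k) == - pi then - p 0 k else 0).
have E : phase coord (fun k => (p 0 k)%:~R) (torus_opp x) =
    - phase coord (fun k => (p 0 k)%:~R) x + n%:~R * (pi *+ 2).
  rewrite /phase -sumrN /n rmorph_sum mulr_suml -big_split; apply: eq_bigr => k _.
  rewrite /coord tnth_mktuple circle_val_opp/=; case: ifPn => [/eqP ->|_].
    by rewrite rmorphN/=; ring.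
  by rewrite mul0r addr0 mulrN.
have [c s] := twopi_int n.
rewrite !characterE E cosD sinD c s cosN sinN.
by apply: complex_ext; rewrite ?complex_Re_conj ?complex_Im_conj/=; ring.
Qed.

End torus_characters.

(** * Complex measures with a matrix density *)

Section density.
Context {disp : measure_display} {T : measurableType disp} {R : realType}.
Variable mu : {finite_measure set T -> \bar R}.
Implicit Types (f w : T -> R).

Section finite_measure_density.
Variables (rho : {finite_measure set T -> \bar R}) (w : T -> R).
Hypotheses (rm : rho `<< mu) (iw : rint mu w).
Hypothesis rhoE : forall A, measurable A -> rho A = (\int[mu]_(x in A) (w x)%:E)%E.

Let k := Radon_Nikodym_SigmaFinite.f rho mu.

Let ik : mu.-integrable setT k.
Proof. exact: Radon_Nikodym_SigmaFinite.f_integrable. Qed.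

Let mk : measurable_fun setT k. Proof. exact: measurable_int ik. Qed.

Let kw : {ae mu, forall x, k x = (w x)%:E}.
Proof.
have : ae_eq mu setT k (EFin \o w).
  apply: integral_ae_eq => //; first exact: (measurable_int mu).
  by move=> E _ mE; rewrite -Radon_Nikodym_SigmaFinite.f_integral// rhoE.
by apply: filterS => x; exact.
Qed.

(** The change of variables holds for the Radon-Nikodym derivative [k], which agrees almost
    everywhere with the given density [w] because both integrate to [rho] over every set. *)
Lemma rint_density f : measurable_fun setT f ->
  rint rho f <-> rint mu (fun x => f x * w x).
Proof.
move=> mf; have mfE : measurable_fun setT (EFin \o f) by exact/measurable_EFinP.
have mfw : measurable_fun setT (EFin \o (fun x => f x * w x)).
  by apply/measurable_EFinP; apply: measurable_funM => //; exact: (rint_measurable iw).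
have E : (\int[rho]_x `|(EFin \o f) x| = \int[mu]_x `|(EFin \o (fun x => (f x * w
  x)%R)) x|)%E.
  rewrite -(Radon_Nikodym_SigmaFinite.change_of_variables rm)//;
    last exact: measurableT_comp.
  apply: ae_eq_integral => //.
  - by apply: emeasurable_funM => //; exact: measurableT_comp.
  - exact: measurableT_comp.
  - apply: filterS kw => x kwx _; rewrite /= normrM EFinM.
    by rewrite -(gee0_abs (Radon_Nikodym_SigmaFinite.f_ge0 rm x)) -/k kwx.
by split=> /integrableP[_ l]; apply/integrableP; split => //; move: l; rewrite E.
Qed.

Lemma Rintegral_density f : rint rho f -> \int[rho]_x f x = \int[mu]_x (f x * w x).
Proof.
move=> fi; have mf := rint_measurable fi.
have mfE : measurable_fun setT (EFin \o f) by exact/measurable_EFinP.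
congr fine; rewrite -(Radon_Nikodym_change_of_variables rm)//.
apply: ae_eq_integral => //.
- by apply: emeasurable_funM => //.
- by apply/measurable_EFinP; apply: measurable_funM => //; exact: (rint_measurable iw).
- have := ae_eq_Radon_Nikodym_SigmaFinite rm measurableT.
  by apply: filterS2 kw => x kwx /(_ I) <-; rewrite -/k kwx EFinM.
Qed.

End finite_measure_density.

Variable nu : {charge set T -> \bar R}.
Hypothesis numu : nu `<< mu.

Let h x := fine (Radon_Nikodym nu mu x).

Lemma rint_RN : rint mu h.
Proof.
have := @Radon_Nikodym_integrable _ _ _ nu mu numu.
by congr (_.-integrable _ _); apply/funext => x;
  rewrite /= fineK// Radon_Nikodym_fin_num.
Qed.

Lemma RN_integral A : measurable A -> nu A = (\int[mu]_(x in A) (h x)%:E)%E.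
Proof.
move=> mA; rewrite (Radon_Nikodym_integral numu mA).
by apply: eq_integral => x _; rewrite fineK// Radon_Nikodym_fin_num.
Qed.

(** The Jordan parts have densities h 1_P and - h 1_N. The Hahn decomposition is arbitrary, so the
    result applies to the one picked by choice in [charge_integral]. *)
Lemma jordan_integralE P N (PN : hahn_decomposition nu P N) f :
  measurable_fun setT f -> rint mu (fun x => f x * h x) ->
  \int[jordan_pos PN]_x f x - \int[jordan_neg PN]_x f x = \int[mu]_x (f x * h x).
Proof.
move=> mf ifh; have [[mP _] [mN _] PNT PN0] := PN.
have mh : measurable_fun setT h by exact: (rint_measurable rint_RN).
have iI (A : set T) (g : T -> R) : measurable A -> rint mu g ->
  rint mu (fun x => g x * \1_A x).
  move=> mA ig; apply: (rint_le (g := fun x => `|g x|)) => //.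
  - by apply: measurable_funM; [exact: (rint_measurable ig)|exact: measurable_indic].
  - exact: integrable_norm ig.
  - move=> x; rewrite normrM indicE; case: (x \in A);
      rewrite ?normr1 ?mulr1// normr0 mulr0//.
have hI (A B : set T) : measurable A -> measurable B ->
    (\int[mu]_(x in A) (h x * \1_B x)%:E = nu (A `&` B))%E.
  move=> mA mB; rewrite RN_integral; last exact: measurableI.
  rewrite integral_mkcondr; apply: eq_integral => x _.
  by rewrite patchE indicE; case: (x \in B); rewrite ?mulr1 ?mulr0.
have ihP := iI _ _ mP rint_RN; have ihN := iI _ _ mN rint_RN.
have jP : jordan_pos PN `<< mu by exact: jordan_pos_dominates.
have jN : jordan_neg PN `<< mu by exact: jordan_neg_dominates.
have -> : \int[jordan_pos PN]_x f x = \int[mu]_x (f x * (h x * \1_P x)).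
  have dP A : measurable A -> jordan_pos PN A = (\int[mu]_(x in A) (h x * \1_P x)%:E)%E.
    move=> mA; rewrite hI//; transitivity (crestr0 nu mP A) => //.
    by rewrite /crestr0 mem_set.
  apply: (Rintegral_density jP ihP dP); apply/(rint_density jP ihP dP mf).
  by under eq_fun do rewrite mulrA; exact: iI.
have -> : \int[jordan_neg PN]_x f x = \int[mu]_x (f x * - (h x * \1_N x)).
  have dN A : measurable A -> jordan_neg PN A = (\int[mu]_(x in A) (- (h x * \1_N
    x))%:E)%E.
    move=> mA; transitivity ((-1)%:E * crestr0 nu mN A)%E => //.
    rewrite /crestr0 mem_set// /crestr -hI// mulN1e.
    rewrite -integralN//=; apply: integrable_add_def => //.
    exact: (integrableS measurableT mA (@subsetT _ _) ihN).
  apply: (Rintegral_density jN (rintN ihN) dN).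
  apply/(rint_density jN (rintN ihN) dN mf).
  by under eq_fun do rewrite mulrN mulrA; apply: rintN; exact: iI.
rewrite -RintegralB//.
- apply: eq_Rintegral => x _; rewrite mulrN opprK -!mulrDr.
  suff -> : \1_P x + \1_N x = 1 :> R by rewrite mulr1.
  have [Px|Px] := pselect (P x).
    rewrite !indicE mem_set// memNset ?addr0// => Nx.
    by have : (P `&` N) x by []; rewrite PN0.
  have Nx : N x by have [] : (P `|` N) x by rewrite PNT.
  by rewrite !indicE memNset// mem_set// add0r.
- by under [X in _.-integrable _ (_ \o X)]eq_fun do rewrite mulrA; exact: iI.
- by under [X in _.-integrable _ (_ \o X)]eq_fun do rewrite mulrN mulrA; apply: rintN;
    exact: iI.
Qed.

Lemma charge_integralE f : measurable_fun setT f -> rint mu (fun x => f x * h x) ->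
  charge_integral nu f = \int[mu]_x (f x * h x).
Proof. by move=> mf ifh; exact: jordan_integralE. Qed.

End density.

Section complex_density.
Context {disp : measure_display} {T : measurableType disp} {R : realType}.
Variables (mu : {finite_measure set T -> \bar R}) (G : complex_measure T R).
Hypothesis Gmu : cm_dominated G mu.

Let g := cm_density G mu.

Lemma cmeasurable_density : cmeasurable g.
Proof. by case: Gmu => a b; split;
  [exact: (rint_measurable (rint_RN a))|exact: (rint_measurable (rint_RN b))]. Qed.

Lemma cintegrable_density : cintegrable mu g.
Proof. by case: Gmu => a b; split; [exact: rint_RN a|exact: rint_RN b]. Qed.

(** One integrable majorant of |u g| controls the four products of real and imaginary parts, each of
    which is bounded by |u| |g|. *)
Lemma cm_integralE (u : T -> R[i]) (W : T -> R) : cmeasurable u -> rint mu W ->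
  {ae mu, forall x, cmod (u x * g x) <= W x} ->
  cintegrable mu (fun x => u x * g x) /\ cm_integral G u = cint mu (fun x => u x * g x).
Proof.
move=> mu' iW uW; case: Gmu => dR dI.
have [mu1 mu2] := mu'; have [mg1 mg2] := cmeasurable_density.
have ri (f : T -> R) : measurable_fun setT f -> (forall x,
  `|f x| <= cmod (u x * g x)) -> rint mu f.
  move=> mf fle; apply/integrableP; split; first exact/measurable_EFinP.
  have /integrableP[_] := iW; apply: le_lt_trans.
  apply: ae_ge0_le_integral => //; try by apply: measurableT_comp => //;
    exact/measurable_EFinP.
    by apply: measurableT_comp => //; exact: (measurable_int mu iW).
  by apply: filterS uW => x h _; rewrite /= lee_fin (le_trans (fle x))// (le_trans h)//
    ler_norm.
have cle (a b : R) (z w : R[i]) : `|a| <= cmod z -> `|b| <= cmod w ->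
  `|a * b| <= cmod (z * w).
  by move=> *; rewrite normrM cmodM ler_pM.
have cIm (z : R[i]) : `|complex.Im z| <= cmod z.
  by rewrite -sqrtr_sqr ler_sqrt ?sqmod_ge0// lerDr sqr_ge0.
have i1 : rint mu (fun x => complex.Re (u x) * complex.Re (g x)).
  by apply: ri => [|x]; [exact: measurable_funM|apply: cle; exact: cmod_Re].
have i2 : rint mu (fun x => complex.Im (u x) * complex.Im (g x)).
  by apply: ri => [|x]; [exact: measurable_funM|apply: cle; exact: cIm].
have i3 : rint mu (fun x => complex.Im (u x) * complex.Re (g x)).
  by apply: ri => [|x]; [exact: measurable_funM|apply: cle;
    [exact: cIm|exact: cmod_Re]].
have i4 : rint mu (fun x => complex.Re (u x) * complex.Im (g x)).
  by apply: ri => [|x]; [exact: measurable_funM|apply: cle;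
    [exact: cmod_Re|exact: cIm]].
split.
  split; first by under eq_fun do rewrite Re_mul; exact: rintB.
  by under eq_fun do rewrite Im_mul; exact: rintD.
rewrite /cm_integral /cint; congr (_ +i* _).
  under [RHS]eq_Rintegral do rewrite Re_mul.
  by rewrite RintegralB//; congr (_ - _); exact: charge_integralE.
under [RHS]eq_Rintegral do rewrite Im_mul.
by rewrite RintegralD// addrC; congr (_ + _); exact: charge_integralE.
Qed.

Lemma cm_integral_indic (A : set T) : measurable A -> cm_integral G (cindic A) = G A.
Proof.
move=> mA; have [dR dI] := Gmu; have [iR iI] := cintegrable_density.
have iA (f : T -> R) : rint mu f -> rint mu (fun x => \1_A x * f x).
  move=> i; apply: (rint_le (g := fun x => `|f x|)) => //.
  - by apply: measurable_funM; [exact: measurable_indic|exact: (rint_measurable i)].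
  - exact: integrable_norm i.
  - move=> x; rewrite normrM indicE; case: (x \in A);
      rewrite ?normr1 ?mul1r// normr0 mul0r//.
have ci (nu : {charge set T -> \bar R}) : nu `<< mu ->
  charge_integral nu (\1_A) = fine (nu A).
  move=> d; rewrite (charge_integralE d) ?measurable_indic//; last exact/iA/rint_RN.
  rewrite (RN_integral d mA) /Rintegral [in RHS]integral_mkcond; congr fine.
  by apply: eq_integral => x _; rewrite patchE indicE; case: (x \in A);
    rewrite ?mul1r ?mul0r.
have c0 (nu : {charge set T -> \bar R}) : nu `<< mu -> charge_integral nu (fun=> 0) = 0.
  move=> d; have i0 : rint mu (fun x => 0 * fine (Radon_Nikodym nu mu x)) by apply:
    rintZ; exact: rint_RN.
  rewrite (charge_integralE d)//; under eq_Rintegral do rewrite mul0r.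
  exact: Rintegral0.
by rewrite /cm_integral/= !ci// !c0// subr0 add0r.
Qed.

End complex_density.

(** * Positive semidefinite matrices *)

Lemma ReD (R : realType) (z w : R[i]) :
  complex.Re (z + w) = complex.Re z + complex.Re w.
Proof. exact: raddfD. Qed.

Section psd.
Variables (R : realType) (d : nat) (A : 'M[R[i]]_d).
Hypothesis psdA : psdmx A.

Lemma psdmx_herm j k : A k j = Num.conj (A j k).
Proof.
have [/eqP + _] := psdA; rewrite expr0 scale1r => h.
by rewrite [in LHS]h !mxE.
Qed.

Lemma psdmx_form (v : 'rV[R[i]]_d) :
  0 <= complex.Re (\sum_j \sum_k v 0 j * Num.conj (v 0 k) * A j k).
Proof.
have [_ /(_ v)] := psdA; rewrite lecE => /andP[_]; congr (_ <= complex.Re _).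
rewrite !mxE exchange_big/=; apply: eq_bigr => k _; rewrite !mxE mulr_suml.
by apply: eq_bigr => j _; rewrite mulrAC.
Qed.

Lemma psdmx_diag j : complex.Im (A j j) = 0 /\ 0 <= complex.Re (A j j).
Proof.
split.
  have : complex.Im (A j j) = - complex.Im (A j j) by rewrite -complex_Im_conj
    -psdmx_herm.
  lra.
have := psdmx_form (delta_mx 0 j).
rewrite (bigD1 j)//= [X in _ + X]big1 ?addr0; last first.
  by move=> i /negbTE ij; apply: big1 => k _; rewrite !mxE ij andbF !mul0r.
rewrite (bigD1 j)//= [X in _ + X]big1 ?addr0; last first.
  by move=> i /negbTE ij; rewrite !mxE ij andbF conjC0 mulr0 mul0r.
by rewrite !mxE !eqxx (conj_real 1) !mul1r.
Qed.

(** The quadratic form at the row vector a' e_j + b e_k, for a' = a and a' = - a. The sum defining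
    [v] also covers the case j = k. *)
Lemma psdmx_Re_le j k a b : `|complex.Re (a * Num.conj b * A j k)| <=
  (sqmod a * complex.Re (A j j) + sqmod b * complex.Re (A k k)) / 2.
Proof.
have key a' : 0 <= sqmod a' * complex.Re (A j j) + sqmod b * complex.Re (A k k) +
    2 * complex.Re (a' * Num.conj b * A j k).
  pose v : 'rV[R[i]]_d := \row_i (a' * (i == j)%:R + b * (i == k)%:R).
  have := psdmx_form v.
  have cb (b' : bool) : Num.conj (b'%:R : R[i]) = b'%:R.
    by case: b'; [exact: (conj_real 1)|exact: (conj_real 0)].
  have sumd (f : 'I_d -> R[i]) i : \sum_l (l == i)%:R * f l = f i.
    rewrite (bigD1 i)//= eqxx mul1r big1 ?addr0// => l /negbTE ->; exact: mul0r.
  have -> : \sum_i \sum_l v 0 i * Num.conj (v 0 l) * A i l =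
      a' * Num.conj a' * A j j + a' * Num.conj b * A j k +
      (b * Num.conj a' * A k j + b * Num.conj b * A k k).
    transitivity (\sum_i v 0 i * (Num.conj a' * A i j + Num.conj b * A i k)).
      apply: eq_bigr => i _; rewrite -(sumd (fun l => Num.conj a' * A i l)) -(sumd (fun
        l => Num.conj b * A i l)).
      rewrite -big_split mulr_sumr; apply: eq_bigr => l _ /=.
      by rewrite [v 0 l]mxE conjD !conjM !cb; ring.
    transitivity (\sum_i ((i == j)%:R * (a' * (Num.conj a' * A i j + Num.conj b * A i
      k)) +
       (i == k)%:R * (b * (Num.conj a' * A i j + Num.conj b * A i k)))).
      by apply: eq_bigr => i _; rewrite [v 0 i]mxE; ring.
    by rewrite big_split/= !sumd; ring.
  rewrite (psdmx_herm j k) !mul_conj.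
  have -> : b * Num.conj a' * Num.conj (A j k) = Num.conj (a' * Num.conj b * A j k).
    by rewrite !conjM conjCK; ring.
  rewrite !ReD complex_Re_conj.
  have rr (p : R) (z : R[i]) : complex.Re (p%:C * z) = p * complex.Re z.
    by rewrite Re_mul/= mul0r subr0.
  rewrite !rr; lra.
have := key a; have := key (- a); rewrite sqmodN !mulNr raddfN/= => k1 k2.
by rewrite ler_norml; apply/andP; split; lra.
Qed.

(** Multiplying [a] by a suitable unimodular number makes the product real and nonnegative, so that
    the bound on real parts becomes one on moduli. *)
Lemma psdmx_cmod_le j k a b : cmod (a * Num.conj b * A j k) <=
  (sqmod a * complex.Re (A j j) + sqmod b * complex.Re (A k k)) / 2.
Proof.
set z := a * Num.conj b * A j k.
have [_ dj] := psdmx_diag j; have [_ dk] := psdmx_diag k.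
have [z0|z0] := eqVneq (cmod z) 0.
  by rewrite z0 divr_ge0// addr_ge0// mulr_ge0// sqmod_ge0.
pose t : R[i] := ((cmod z)^-1)%:C * Num.conj z.
have t1 : sqmod t = 1.
  by rewrite /t sqmodM sqmod_real sqmod_conj -sqr_cmod -exprMn mulVf// expr1n.
have := psdmx_Re_le j k (t * a) b; rewrite sqmodM t1 mul1r; apply: le_trans.
have -> : t * a * Num.conj b * A j k = (cmod z)%:C.
  have -> : t * a * Num.conj b * A j k = ((cmod z)^-1)%:C * (z * Num.conj z).
    by rewrite /t /z; ring.
  by rewrite mul_conj -sqr_cmod -rmorphM expr2 mulKf.
by rewrite /= ler_norm.
Qed.

End psd.

(** Stated for bare set functions because [diag_measure] carries no measure structure. *)
Lemma eq_set_integral d (T : measurableType d) (R : realType) (m1 m2 : set T -> \bar R)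
    (f : T -> \bar R) : (forall A, measurable A -> m1 A = m2 A) ->
  (\int[m1]_x f x = \int[m2]_x f x)%E.
Proof.
move=> h; have sE (g : {nnsfun T >-> R}) : sintegral m1 g = sintegral m2 g.
  by rewrite /sintegral; apply: eq_fsbigr => x _; rewrite h.
rewrite /integral !unlock /=; congr (_ - _)%E; congr ereal_sup;
  by apply/seteqP; split => _ [g gP <-]; exists g.
Qed.

Lemma le_ae_Rintegral d (T : measurableType d) (R : realType)
    (m : {finite_measure set T -> \bar R}) (f g : T -> R) : rint m f -> rint m g ->
  {ae m, forall x, f x <= g x} -> \int[m]_x f x <= \int[m]_x g x.
Proof.
move=> i j fg; rewrite -subr_ge0 -RintegralB//.
have h := rintB j i; rewrite (eq_ae_Rintegral (g := fun x => `|g x - f x|)).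
- exact: Rintegral_ge0.
- exact: (rint_measurable h).
- exact: measurableT_comp (rint_measurable h).
- by apply: filterS fg => x fgx; rewrite ger0_norm// subr_ge0.
Qed.

Lemma dominated_ae d (T : measurableType d) (R : realType)
    (mu rho : {measure set T -> \bar R}) (Q : T -> Prop) :
  rho `<< mu -> {ae mu, forall x, Q x} -> {ae rho, forall x, Q x}.
Proof.
move=> d1 [A [mA A0 QA]]; exists A; split => //.
by move/null_content_dominatesP : d1; apply.
Qed.

(** * The covariance form of a spectral measure *)

Section spectral_measure.
Context {R : realType} {nu d : nat}.
Local Notation torus := (torus R nu).
Variables (G : 'I_d -> 'I_d -> complex_measure torus R)
  (mu : {finite_measure set torus -> \bar R}).
Hypothesis Gmu : psd_density G mu.

Let g j k := cm_density (G j k) mu.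
Let w j x := complex.Re (g j j x).

Let dom j k : cm_dominated (G j k) mu. Proof. by case: Gmu. Qed.

Let iw j : rint mu (w j). Proof. by have [] := cintegrable_density (dom j j). Qed.

Let psdg : {ae mu, forall x, psdmx (\matrix_(j, k) g j k x)}.
Proof. by case: Gmu. Qed.

Let wge0 j : {ae mu, forall x, 0 <= w j x}.
Proof. by apply: filterS psdg => x px; have [_] := psdmx_diag px j; rewrite mxE. Qed.

Let diagE j (A : set torus) : measurable A ->
  diag_measure G j A = (\int[mu]_(x in A) (w j x)%:E)%E.
Proof. by move=> mA; have [dR _] := dom j j; exact: RN_integral. Qed.

(** The positive Jordan part of the real part of G_jj is all of it: on the negative Hahn set the
    charge is also the integral of a density that is almost everywhere nonnegative. This supplies
    the genuine measures that the L2 theory works with. *)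
Lemma diag_measure_ex j : exists m : {finite_measure set torus -> \bar R},
  forall A, measurable A -> m A = diag_measure G j A.
Proof.
have [P [N PN]] := Hahn_decomposition (cmRe (G j j)).
exists (jordan_pos PN) => A mA; have [[mP _] [mN neg] PNT PN0] := PN.
transitivity (crestr0 (cmRe (G j j)) mP A) => //.
have mAN := measurableI _ _ mA mN; have mAP := measurableI _ _ mA mP.
rewrite /crestr0 mem_set// /crestr /diag_measure -[in RHS](setIT A) -PNT setIUr.
rewrite chargeU//; last by rewrite setIACA PN0 setI0.
suff -> : cmRe (G j j) (A `&` N) = 0%E by rewrite adde0.
apply/eqP; rewrite eq_le; apply/andP; split; first by apply: neg => //; exact: subIsetr.
rewrite -/(diag_measure G j (A `&` N)) diagE//.
have iwA : mu.-integrable (A `&` N) (EFin \o w j).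
  exact: (integrableS measurableT mAN (@subsetT _ _) (iw j)).
rewrite (@ae_eq_integral _ _ _ mu _ (fun x => `|(w j x)%:E|)%E)//.
- exact: integral_ge0.
- exact: (measurable_int mu).
- by apply: measurableT_comp => //; exact: (measurable_int mu iwA).
- by apply: filterS (wge0 j) => x w0 _; rewrite gee0_abs.
Qed.

Variable m : 'I_d -> {finite_measure set torus -> \bar R}.
Hypothesis mE : forall j A, measurable A -> m j A = diag_measure G j A.

Lemma L2_diag j u : L2 (diag_measure G j) u <-> L2 (m j) u.
Proof.
rewrite /L2 (@eq_set_integral _ _ _ (diag_measure G j) (m j))//.
by move=> A mA; rewrite mE.
Qed.

Lemma L2norm_diag j u : L2norm (diag_measure G j) u = L2norm (m j) u.
Proof.
rewrite /L2norm (@eq_set_integral _ _ _ (diag_measure G j) (m j))//.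
by move=> A mA; rewrite mE.
Qed.

Let mdens j A : measurable A -> m j A = (\int[mu]_(x in A) (w j x)%:E)%E.
Proof. by move=> mA; rewrite mE// diagE. Qed.

Lemma diag_dominated j : m j `<< mu.
Proof.
apply/null_content_dominatesP => A mA A0; rewrite mdens//.
apply: null_set_integral => //; apply: measurable_funTS.
exact: measurable_int (iw j).
Qed.

(** The majorant of |u conj(v) g_jk| from [psdmx_cmod_le]; its integral is the half sum of squared
    norms required by [contractive_formP]. *)
Let W j k u v x := (sqmod (u x) * w j x + sqmod (v x) * w k x) / 2.

Let iW j k u v : L2 (m j) u -> L2 (m k) v -> rint mu (W j k u v).
Proof.
move=> /L2P[mu' iu] /L2P[mv iv]; rewrite /W; under eq_fun do rewrite mulrC.
apply: rintZ; apply: rintD.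
  by apply/(rint_density (@diag_dominated j) (iw j) (mdens j)) => //;
    exact: measurable_sqmod.
by apply/(rint_density (@diag_dominated k) (iw k) (mdens k)) => //;
  exact: measurable_sqmod.
Qed.

Let intW j k u v : L2 (m j) u -> L2 (m k) v ->
  \int[mu]_x W j k u v x = (sq (m j) u + sq (m k) v) / 2.
Proof.
move=> /[dup] iu /L2P[mu' iu'] /[dup] iv /L2P[mv iv'].
have a : rint mu (fun x => sqmod (u x) * w j x).
  by apply/(rint_density (@diag_dominated j) (iw j) (mdens j)) => //;
    exact: measurable_sqmod.
have b : rint mu (fun x => sqmod (v x) * w k x).
  by apply/(rint_density (@diag_dominated k) (iw k) (mdens k)) => //;
    exact: measurable_sqmod.
rewrite /W; under eq_Rintegral do rewrite mulrC.
rewrite RintegralZl//; last exact: (rintD a b).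
rewrite RintegralD// mulrC /sq (Rintegral_density (@diag_dominated j) (iw j) (mdens
  j))//.
by rewrite (Rintegral_density (@diag_dominated k) (iw k) (mdens k)).
Qed.

Definition cov j k (u v : torus -> R[i]) : R[i] :=
  cm_integral (G j k) (fun x => u x * Num.conj (v x)).

Let covE j k u v : L2 (m j) u -> L2 (m k) v ->
  cintegrable mu (fun x => u x * Num.conj (v x) * g j k x) /\
  cov j k u v = cint mu (fun x => u x * Num.conj (v x) * g j k x).
Proof.
move=> iu iv; apply: (cm_integralE (dom j k) (W := W j k u v)) => //.
- by apply: cmeasurableM; [case: iu|apply: cmeasurable_conj; case: iv].
- exact: iW.
- apply: filterS psdg => x px; have := psdmx_cmod_le px j k (u x) (v x).
  by rewrite !mxE.
Qed.

Lemma cov_sesquilinear j k : sesquilinear (m j) (m k) (cov j k).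
Proof.
split=> [a a' u u' v iu iu' iv|a a' u v v' iu iv iv'].
  have [i ->] := covE iu iv; have [i' ->] := covE iu' iv.
  have [_ ->] := covE (L2_lin a a' iu iu') iv.
  by rewrite -cint_lin//; congr cint; apply/funext => x; ring.
have [i ->] := covE iu iv; have [i' ->] := covE iu iv'.
have [_ ->] := covE iu (L2_lin a a' iv iv').
rewrite -cint_lin//; congr cint; apply/funext => x.
by rewrite conjD !conjM; ring.
Qed.

Lemma cov_contractive j k : contractive_form (m j) (m k) (cov j k).
Proof.
apply: contractive_formP; first exact: cov_sesquilinear.
move=> u v iu iv; have [[i _] ->] := covE iu iv.
rewrite -intW// (le_trans (le_normr_Rintegral _ _))//.
apply: le_ae_Rintegral; [exact: integrable_norm i|exact: iW|].
apply: filterS psdg => x px; have := psdmx_cmod_le px j k (u x) (v x).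
by rewrite !mxE; apply: le_trans; exact: cmod_Re.
Qed.

Lemma cov_ind j k A B : cov j k (ind A) (ind B) = G j k (sval A `&` sval B).
Proof.
case: A B => [A mA] [B mB]; rewrite /cov /ind/= -(cm_integral_indic (dom j k));
  last exact: measurableI.
congr cm_integral; apply/funext => x.
by rewrite /cindic conj_real -rmorphM indicI.
Qed.

Lemma cov_character j k p q :
  cov j k (character p) (character q) = cm_integral (G j k) (character (p - q)).
Proof. by rewrite /cov; congr cm_integral; apply/funext => x;
  rewrite character_mul_conj. Qed.

Lemma cov_diag j u v : L2 (m j) u -> L2 (m j) v -> cov j j u v = ip (m j) u v.
Proof.
move=> iu iv; have [ci ->] := covE iu iv; have [i i'] := L2_mul_conj iu iv.
have [mg1 mg2] := cmeasurable_density (dom j j).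
have [mR mI] : cmeasurable (fun x => u x * Num.conj (v x)).
  by apply: cmeasurableM; [case: iu|apply: cmeasurable_conj; case: iv].
have cm : cmeasurable (fun x => u x * Num.conj (v x) * g j j x).
  by apply: cmeasurableM => //; split.
rewrite /ip /cint (Rintegral_density (@diag_dominated j) (iw j) (mdens j) i).
rewrite (Rintegral_density (@diag_dominated j) (iw j) (mdens j) i').
have im0 : {ae mu, forall x, complex.Im (g j j x) = 0}.
  by apply: filterS psdg => x px; have [+ _] := psdmx_diag px j; rewrite mxE.
case: cm => cm1 cm2; congr (_ +i* _); apply: eq_ae_Rintegral => //;
  try exact: measurable_funM.
  by apply: filterS im0 => x g0; rewrite Re_mul g0 mulr0 subr0.
by apply: filterS im0 => x g0; rewrite Im_mul g0 mulr0 add0r.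
Qed.

Lemma cov_conj j k u v : L2 (m j) u -> L2 (m k) v ->
  cov k j v u = Num.conj (cov j k u v).
Proof.
move=> iu iv; have [i ->] := covE iu iv; have [i' ->] := covE iv iu.
rewrite -cint_conj//; case: i => i1 i2; case: i' => i1' i2'.
apply: eq_ae_cint.
- by split; [exact: (rint_measurable i1')|exact: (rint_measurable i2')].
- by apply: cmeasurable_conj; split;
    [exact: (rint_measurable i1)|exact: (rint_measurable i2)].
apply: filterS psdg => x px; have := psdmx_herm px j k; rewrite !mxE => ->.
by rewrite !conjM conjCK; ring.
Qed.

(** The double sum is the integral of the quadratic form of the density matrix, evaluated at a
    vector that depends on [x]. *)
Lemma cov_psd N (c : 'I_N -> R) (j : 'I_N -> 'I_d) (p : 'I_N -> 'rV[int]_nu) :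
  0 <= \sum_(s < N) \sum_(t < N) c s * c t *
    complex.Re (cov (j s) (j t) (character (p s)) (character (p t))).
Proof.
pose F s t x := (c s * c t)%:C * (character (p s) x * Num.conj (character (p t) x) * g
  (j s) (j t) x).
have iF s t : cintegrable mu (F s t).
  apply: cintegrableZ.
  by have [] := covE (L2_character (m (j s)) (p s)) (L2_character (m (j t)) (p t)).
have Re_r (a : R) (z : R[i]) : complex.Re (a%:C * z) = a * complex.Re z.
  by rewrite Re_mul/= mul0r subr0.
have sumint (I : finType) (f : I -> torus -> R) : (forall i, rint mu (f i)) ->
    rint mu (fun x => \sum_i f i x) /\ \int[mu]_x (\sum_i f i x) = \sum_i \int[mu]_x f
      i x.
  move=> fi; elim: (index_enum I) => [|i s [IH1 IH2]].
    split; first by under eq_fun do rewrite big_nil;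
      exact: finite_measure_integrable_cst.
    by under eq_Rintegral do rewrite big_nil; rewrite big_nil Rintegral0.
  split; first by under eq_fun do rewrite big_cons; exact: rintD.
  under eq_Rintegral do rewrite big_cons; rewrite big_cons RintegralD//; last exact: fi.
  by congr (_ + _); exact: IH2.
have iRF s t : rint mu (fun x => complex.Re (F s t x)) by case: (iF s t).
have -> : \sum_(s < N) \sum_(t < N) c s * c t *
    complex.Re (cov (j s) (j t) (character (p s)) (character (p t))) =
    \int[mu]_x (\sum_s \sum_t complex.Re (F s t x)).
  have [_ ->] := sumint _ (fun s x => \sum_t complex.Re (F s t x)) (fun s => (sumint _
    _ (iRF s)).1).
  apply: eq_bigr => s _; have [_ ->] := sumint _ _ (iRF s); apply: eq_bigr => t _.
  have [[i _] ->] := covE (L2_character (m (j s)) (p s)) (L2_character (m (j t)) (p t)).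
  transitivity (c s * c t * \int[mu]_x complex.Re
    (character (p s) x * Num.conj (character (p t) x) * g (j s) (j t) x)) => //.
  by rewrite -RintegralZl//; apply: eq_Rintegral => x _; rewrite Re_r.
rewrite -[leLHS](Rintegral0 mu); apply: le_ae_Rintegral.
- exact: finite_measure_integrable_cst.
- exact: (sumint _ _ (fun s => (sumint _ _ (iRF s)).1)).1.
apply: filterS psdg => x px.
(* Terms sharing the same component of the field are collected into one coordinate. *)
pose v : 'rV[R[i]]_d := \row_i \sum_(s | j s == i) (c s)%:C * character (p s) x.
have := psdmx_form px v; congr (_ <= _).
transitivity (complex.Re (\sum_s \sum_t F s t x)); last first.
  by rewrite raddf_sum; apply: eq_bigr => s _; rewrite raddf_sum.
congr complex.Re.
transitivity (\sum_s \sum_k (c s)%:C * character (p s) x * Num.conj (v 0 k) * g (j s) k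
  x).
  rewrite (partition_big j xpredT)//=; apply: eq_bigr => i _.
  rewrite exchange_big/=; apply: eq_bigr => k _; rewrite [v 0 i]mxE !mulr_suml.
  by apply: eq_bigr => s /eqP <-; rewrite !mxE.
apply: eq_bigr => s _; rewrite [RHS](partition_big j xpredT)//=; apply: eq_bigr => k _.
rewrite [v 0 k]mxE raddf_sum/= mulr_sumr mulr_suml; apply: eq_bigr => t /eqP <-.
by rewrite conjM conj_real /F rmorphM; ring.
Qed.

Section even.
Hypothesis Geven : forall j k (A : set torus), measurable A ->
  G j k (@torus_opp R nu @` A) = Num.conj (G j k A).

(** Functions fixed by this antilinear reflection are those with real integrals; characters are
    fixed, and indicators are permuted. *)
Definition adj (u : torus -> R[i]) x := Num.conj (u (torus_opp x)).

Lemma cmeasurable_adj u : cmeasurable u -> cmeasurable (adj u).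
Proof.
move=> [u1 u2]; apply: cmeasurable_conj.
have mo := @measurable_torus_opp R nu.
by split; [exact: (measurableT_comp u1 mo)|exact: (measurableT_comp u2 mo)].
Qed.

Let m_even j A : measurable A -> m j (@torus_opp R nu @^-1` A) = m j A.
Proof.
move=> mA; rewrite -torus_opp_image; have mA' := measurable_torus_opp_image mA.
rewrite -[LHS]fineK ?fin_num_measure// -[RHS]fineK ?fin_num_measure// !mE//.
have := congr1 (fun z => complex.Re z) (Geven j j mA).
by rewrite complex_Re_conj /cmval/= => ->.
Qed.

Let int_adj j u : cmeasurable u ->
  (\int[m j]_x (sqmod (adj u x))%:E = \int[m j]_x (sqmod (u x))%:E)%E.
Proof.
move=> mu'; under eq_integral do rewrite /adj sqmod_conj.
have mo := @measurable_torus_opp R nu.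
have := @ge0_integral_pushforward _ _ _ _ R _ mo (m j) setT (fun x => (sqmod (u x))%:E)
  measurableT.
rewrite preimage_setT => <-.
- by apply: eq_set_integral => A mA; exact: m_even.
- exact/measurable_EFinP/measurable_sqmod.
- by move=> x _; rewrite lee_fin sqmod_ge0.
Qed.

Lemma L2_adj j u : L2 (m j) u -> L2 (m j) (adj u).
Proof. by move=> [mu' iu]; split; [exact: cmeasurable_adj|rewrite int_adj]. Qed.

Lemma nrm_adj j u : L2 (m j) u -> nrm (m j) (adj u) = nrm (m j) u.
Proof. by move=> [mu' _]; rewrite /nrm /sq /Rintegral int_adj. Qed.

Lemma adj_ind A : exists B, [/\ adj (ind A) = ind B, adj (ind B) = ind A &
  sval B = @torus_opp R nu @` sval A].
Proof.
case: A => A mA; exists (exist _ _ (measurable_torus_opp_image mA)).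
have e (B : set torus) x : (x \in B) = (torus_opp x \in @torus_opp R nu @` B).
  apply/idP/idP => [/set_mem Bx|/set_mem[y By /(can_inj (@torus_oppK R nu)) <-]].
    by apply/mem_set; exists x.
  exact/mem_set.
split => //; apply/funext => x; rewrite /adj /ind/= /cindic conj_real !indicE.
  by rewrite e torus_oppK.
by rewrite [in RHS]e.
Qed.

Lemma adj_character (p : 'rV[int]_nu) : adj (character p) = character p.
Proof. by apply/funext => x; rewrite /adj character_opp conjCK. Qed.

(** Reflecting both arguments and conjugating the value gives another contractive sesquilinear form.
    Evenness of G is its agreement with [cov] on indicators, and [form_ext] does the rest. *)
Lemma cov_adj j k u v : L2 (m j) u -> L2 (m k) v ->
  cov j k (adj u) (adj v) = Num.conj (cov j k u v).
Proof.
move=> iu iv; pose b u v := Num.conj (cov j k (adj u) (adj v)).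
have adj_lin a a' (u1 u2 : torus -> R[i]) :
    adj (fun x => a * u1 x + a' * u2 x) = (fun x => Num.conj a * adj u1 x + Num.conj a'
      * adj u2 x).
  by apply/funext => x; rewrite /adj conjD !conjM.
suff : b u v = cov j k u v by move=> <-; rewrite /b conjCK.
have sc := cov_sesquilinear j k.
apply: (form_ext (@L2_ind _ _ _ (m j)) (@L2_ind _ _ _ (m k)) (b := b)) => //.
- split=> [a a' u1 u2 v1 i1 i2 i3|a a' u1 v1 v2 i1 i2 i3]; rewrite /b adj_lin.
    rewrite (sesq_linl sc) ?conjD ?conjM ?conjCK//; exact: L2_adj.
  rewrite (sesq_linr sc) ?conjD ?conjM ?conjCK//; exact: L2_adj.
- move=> u1 v1 i1 i2; rewrite /b cmod_conj -(nrm_adj i1) -(nrm_adj i2).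
  by apply: cov_contractive; exact: L2_adj.
- exact: cov_contractive.
- exact: total_ind.
- exact: total_ind.
- move=> A B; rewrite /b; have [A' [-> _ A'E]] := adj_ind A;
    have [B' [-> _ B'E]] := adj_ind B.
  rewrite !cov_ind A'E B'E !torus_opp_image -preimage_setI -torus_opp_image Geven
    ?conjCK//.
  by apply: measurableI; [exact: (svalP A)|exact: (svalP B)].
Qed.

(** This is what allows G to be the spectral measure of a real valued field. *)
Lemma cov_character_real j k p q :
  complex.Im (cov j k (character p) (character q)) = 0.
Proof.
have := cov_adj (L2_character (m j) p) (L2_character (m k) q).
rewrite !adj_character => h.
have : complex.Im (cov j k (character p) (character q)) =
  - complex.Im (cov j k (character p) (character q)) by rewrite {1}h complex_Im_conj.
lra.
Qed.

End even.

End spectral_measure.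

(** * Normal laws *)

Section law.
Context {d1 : measure_display} {T1 : measurableType d1} {d2 : measure_display}
  {T2 : measurableType d2} {R : realType}.
Variables (m : {measure set T1 -> \bar R}) (X : T1 -> T2).

(** The measurability proof is an argument so that the measure structure can be attached to the
    pushforward. *)
Definition law (mX : measurable_fun setT X) : set T2 -> \bar R := pushforward m X.

Hypothesis mX : measurable_fun setT X.

Let law0 : law mX set0 = 0%E.
Proof. by rewrite /law /pushforward preimage_set0 measure0. Qed.

Let law_ge0 A : (0 <= law mX A)%E. Proof. exact: measure_ge0. Qed.

Let law_sigma_additive : semi_sigma_additive (law mX).
Proof.
move=> F mF tF mUF; rewrite /law /pushforward preimage_bigcup.
apply: measure_semi_sigma_additive.
- by move=> n; rewrite -[X in measurable X]setTI; exact: mX.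
- apply/trivIsetP => /= i j _ _ ij; rewrite -preimage_setI.
  by move/trivIsetP : tF => /(_ _ _ _ _ ij) ->//; rewrite preimage_set0.
- by rewrite -preimage_bigcup -[X in measurable X]setTI; exact: mX.
Qed.

HB.instance Definition _ := isMeasure.Build _ _ _ (law mX)
  law0 law_ge0 law_sigma_additive.

Lemma ge0_integral_law (f : T2 -> \bar R) : measurable_fun setT f ->
  (forall y, 0 <= f y)%E -> (\int[law mX]_y f y = \int[m]_x f (X x))%E.
Proof.
move=> mf f0; have := ge0_integral_pushforward mX m measurableT mf (fun y _ => f0 y).
by rewrite preimage_setT.
Qed.

End law.

Section finite_law.
Context {d1 : measure_display} {T1 : measurableType d1} {d2 : measure_display}
  {T2 : measurableType d2} {R : realType}.
Variables (m : {finite_measure set T1 -> \bar R}) (X : T1 -> T2).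
Hypothesis mX : measurable_fun setT X.

Let law_fin : fin_num_fun (law m mX).
Proof.
move=> U mU; rewrite /law /pushforward fin_num_measure// -[X in measurable X]setTI.
exact: mX.
Qed.

HB.instance Definition _ := @Measure_isFinite.Build _ _ _ (law m mX) law_fin.

Lemma rint_law (f : T2 -> R) : measurable_fun setT f ->
  rint (law m mX) f <-> rint m (fun x => f (X x)).
Proof.
move=> mf; have mf' : measurable_fun setT (EFin \o f) by exact/measurable_EFinP.
have mfX : measurable_fun setT (EFin \o (fun x => f (X x))).
  by apply/measurable_EFinP; exact: (measurableT_comp mf mX).
have E : (\int[law m mX]_y `|(f y)%:E| = \int[m]_x `|(f (X x))%:E|)%E.
  by rewrite ge0_integral_law//; exact: measurableT_comp.
by split=> /integrableP[_ l]; apply/integrableP; split => //; move: l; rewrite /= E.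
Qed.

Lemma Rintegral_law (f : T2 -> R) : rint (law m mX) f ->
  \int[law m mX]_y f y = \int[m]_x f (X x).
Proof.
move=> i; have mf := rint_measurable i; congr fine.
have := @integral_pushforward _ _ _ _ R _ mX m setT (EFin \o f).
rewrite preimage_setT => <- //; first exact/measurable_EFinP.
by apply/rint_law.
Qed.

End finite_law.

Section lipschitz.
Variable R : realType.

Lemma cos_lipschitz (x y : R) : `|cos x - cos y| <= `|x - y|.
Proof.
wlog yx : x y / y <= x => [hw|].
  have [/hw//|/ltW /hw] := leP y x.
  by rewrite distrC (distrC y).
have [] := @MVT_segment R (@cos R) (fun z => - sin z) y x yx.
- by apply: continuous_subspaceT => z; exact: continuous_cos.
- by move=> z _ ->; rewrite normrM normrN -[leRHS]mul1r ler_wpM2r// sin_max.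
Qed.

End lipschitz.

Section gaussian_measure.
Variable R : realType.
Local Notation lambda := (@lebesgue_measure R).
Local Notation gamma := (normal_prob (0 : R) 1).

Lemma measurable_affine (m s : R) : measurable_fun setT (fun y : R => m + s * y).
Proof. by apply: measurable_funD => //; exact: measurable_funM. Qed.

Let affine_ocitv (m s : R) a b : s != 0 ->
  (`|s|%:E * lambda ((fun y => m + s * y)%R @^-1` `]a, b]) = lambda `]a, b])%E.
Proof.
move=> s0; have [sp|sn] : 0 < s \/ s < 0 by case: (ltgtP s 0) s0 => // h _;
  [right|left].
  have -> : (fun y => m + s * y)%R @^-1` `]a, b] = `](a - m) / s, (b - m) / s]%classic.
    apply/seteqP; split => y /=; rewrite !in_itv/= ltr_pdivrMr// ler_pdivlMr//
      => /andP[h1 h2]; apply/andP; split; lra.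
  rewrite !lebesgue_measure_itv/= !lte_fin ltr_pM2r ?invr_gt0// ltrD2r.
  case: ifPn => _; last by rewrite mule0.
  by rewrite -!EFinB -EFinM gtr0_norm//; congr EFin; field.
have -> : (fun y => m + s * y)%R @^-1` `]a, b] = `[(b - m) / s, (a - m) / s[%classic.
  apply/seteqP; split => y /=; rewrite !in_itv/= ltr_ndivlMr// ler_ndivrMr//
    => /andP[h1 h2]; apply/andP; split; lra.
rewrite !lebesgue_measure_itv/= !lte_fin ltr_nM2r ?invr_lt0// ltrD2r.
case: ifPn => _; last by rewrite mule0.
by rewrite -!EFinB -EFinM ltr0_norm//; congr EFin; field.
Qed.

(** The rescaled pushforward agrees with Lebesgue measure on half-open intervals, and these
    determine it. *)
Lemma lebesgue_affine (m s : R) B : s != 0 -> measurable B ->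
  (lambda B = `|s|%:E * lambda ((fun y => m + s * y)%R @^-1` B))%E.
Proof.
move=> s0 mB; have mf := measurable_affine m s.
pose mf' : @measurable_fun _ _ (measurableTypeR R) (measurableTypeR R) setT (fun y => m
  + s * y) := mf.
pose mu' := mscale (NngNum (normr_ge0 s)) (law lambda mf').
suff : lambda B = mu' B by [].
apply: lebesgue_measure_unique => //.
by move=> _ [[a b] _ <-]; exact/esym/affine_ocitv.
Qed.

Lemma ge0_integral_normal (m s : R) (f : R -> \bar R) (D : set R) : measurable D ->
  measurable_fun setT f -> (forall x, 0 <= f x)%E ->
  (\int[normal_prob m s]_(x in D) f x = \int[lambda]_(x in D) (f x * (normal_pdf m s
    x)%:E))%E.
Proof.
move=> mD mf f0; have dom := normal_prob_dominates m s.
rewrite -(Radon_Nikodym_SigmaFinite.change_of_variables dom)//;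
  last exact: measurable_funTS.
set k := Radon_Nikodym_SigmaFinite.f _ _.
have ik : lambda.-integrable setT k by exact: Radon_Nikodym_SigmaFinite.f_integrable.
have mk : measurable_fun setT k by exact: measurable_int ik.
have mp : measurable_fun setT (fun x => (normal_pdf m s x)%:E).
  apply/measurable_EFinP; exact: measurable_normal_pdf.
have kw : ae_eq lambda setT k (fun x => (normal_pdf m s x)%:E).
  apply: integral_ae_eq => // E _ mE.
  by rewrite -Radon_Nikodym_SigmaFinite.f_integral.
apply: ae_eq_integral => //.
- by apply: measurable_funTS; exact: emeasurable_funM.
- by apply: measurable_funTS; exact: emeasurable_funM.
- by apply: filterS kw => x /(_ I) /= <-.
Qed.

Lemma normal_pdf_affine (m s y : R) : s != 0 ->
  `|s| * normal_pdf m s (m + s * y) = normal_pdf 0 1 y.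
Proof.
move=> s0; rewrite !normal_pdfE ?oner_eq0// /normal_peak /normal_fun mulrA.
have s2 : 0 <= s ^+ 2 by exact: sqr_ge0.
congr (_ * _); last first.
  congr expR; rewrite subr0 expr1n [m + _]addrC addrK exprMn; field.
  by rewrite s0.
rewrite -mulrnAr sqrtrM// sqrtr_sqr expr1n mul1r invfM mulrA divff ?mul1r//.
by rewrite normr_eq0.
Qed.

Lemma normal_affine (m s : R) B : s != 0 -> measurable B ->
  normal_prob m s B = gamma ((fun y => m + s * y) @^-1` B).
Proof.
move=> s0 mB; have mf := measurable_affine m s.
have mfB : measurable ((fun y : R => m + s * y) @^-1` B).
  by rewrite -[X in measurable X]setTI; exact: mf.
rewrite /normal_prob.
pose mf' : @measurable_fun _ _ (measurableTypeR R) (measurableTypeR R) setT (fun y => m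
  + s * y) := mf.
pose mu' := mscale (NngNum (normr_ge0 s)) (law lambda mf').
transitivity (\int[mu']_(x in B) (normal_pdf m s x)%:E)%E.
  by apply: eq_measure_integral => A mA _; exact: lebesgue_affine.
have mp : measurable_fun setT (fun x => (normal_pdf m s x)%:E).
  apply/measurable_EFinP; exact: measurable_normal_pdf.
rewrite ge0_integral_mscale//=; last 2 first.
- exact: measurable_funTS.
- by move=> x _; rewrite lee_fin normal_pdf_ge0.
rewrite (ge0_integral_pushforward mf')//; last 2 first.
- exact: measurable_funTS.
- by move=> x _; rewrite lee_fin normal_pdf_ge0.
rewrite -ge0_integralZl//=.
- by apply: eq_integral => y _; rewrite -EFinM normal_pdf_affine.
- by apply: measurable_funTS; apply: (measurableT_comp mp); exact: mf.
- by move=> x _; rewrite lee_fin normal_pdf_ge0.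
Qed.

Lemma rint_gamma_sqr : rint gamma (fun y : R => y ^+ 2).
Proof.
apply/integrableP; split; first by apply/measurable_EFinP; exact: measurable_funX.
under eq_integral do rewrite /= ger0_norm ?sqr_ge0//.
rewrite ge0_integral_normal//; last 2 first.
- by apply/measurable_EFinP; exact: measurable_funX.
- by move=> x; rewrite lee_fin sqr_ge0.
(* From exp (3 x^2 / 8) >= 3 x^2 / 8 follows x^2 exp (- x^2 / 2) <= 8/3 exp (- x^2 / 8), the shape
   of the normal density of standard deviation 2; the peaks correct the normalisation. *)
pose C : R := 8 / 3 * normal_peak 1 / normal_peak 2.
have p1 : 0 < normal_peak (1 : R) by apply: normal_peak_gt0; rewrite oner_eq0.
have p2 : 0 < normal_peak (2 : R) by apply: normal_peak_gt0; rewrite pnatr_eq0.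
have C0 : 0 <= C by rewrite divr_ge0 ?mulr_ge0 ?(ltW p1) ?(ltW p2)//; lra.
apply: (@le_lt_trans _ _ (\int[lambda]_x (C%:E * (normal_pdf 0 2 x)%:E))%E).
  apply: ge0_le_integral => //.
  - by move=> x _; rewrite -EFinM lee_fin mulr_ge0 ?sqr_ge0 ?normal_pdf_ge0.
  - apply: emeasurable_funM; first by apply/measurable_EFinP; exact: measurable_funX.
    by apply/measurable_EFinP; exact: measurable_normal_pdf.
  - apply: emeasurable_funM => //.
    by apply/measurable_EFinP; exact: measurable_normal_pdf.
  - move=> x _; rewrite -!EFinM lee_fin !normal_pdfE ?oner_eq0 ?pnatr_eq0// /normal_fun
      subr0.
    have -> : - x ^+ 2 / (1 ^+ 2 *+ 2) = - (3 * x ^+ 2 / 8) + - x ^+ 2 / (2 ^+ 2 *+ 2)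
      by field.
    rewrite expRD expRN; set E := expR (- x ^+ 2 / _); set F := expR (3 * x ^+ 2 / 8).
    have F0 : 0 < F by exact: expR_gt0.
    have E0 : 0 < E by exact: expR_gt0.
    have h : x ^+ 2 <= 8 / 3 * F.
      by have := expR_ge1Dx (3 * x ^+ 2 / 8); rewrite -/F; lra.
    have {}h : x ^+ 2 * F^-1 <= 8 / 3 by rewrite ler_pdivrMr.
    rewrite /C; have -> : 8 / 3 * normal_peak 1 / normal_peak 2 * (normal_peak 2 * E) =
      8 / 3 * (normal_peak 1 * E).
      by field; rewrite gt_eqF.
    have -> : x ^+ 2 * (normal_peak 1 * (F^-1 * E)) = x ^+ 2 * F^-1 * (normal_peak 1 *
      E) by ring.
    by rewrite ler_wpM2r// mulr_ge0// ltW.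
rewrite ge0_integralZl//.
- by rewrite integral_normal_pdf mule1 ltry.
- apply/measurable_EFinP; exact: measurable_normal_pdf.
- by move=> x _; rewrite lee_fin normal_pdf_ge0.
Qed.

(** The variance of the standard normal law, kept symbolic: standard deviations are normalised by
    its root and covariance kernels by the variance itself. *)
Definition kappa : R := \int[gamma]_y y ^+ 2.

Lemma rint_gamma_id : rint gamma (fun y : R => y).
Proof.
have i : rint gamma (fun y : R => y ^+ 2 + 1).
  by apply: rintD; [exact: rint_gamma_sqr|exact: finite_measure_integrable_cst].
apply: (rint_le _ i) => //; move=> x.
rewrite -(real_normK (num_real x)); have := sqr_ge0 (`|x| - 1); rewrite sqrrB; nra.
Qed.

Lemma gamma_opp (B : set R) : measurable B ->
  gamma ((fun y : R => - y) @^-1` B) = gamma B.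
Proof.
move=> mB; have -> : (fun y : R => - y) = (fun y => 0 + -1 * y).
  by apply/funext => y; rewrite add0r mulN1r.
have n1 : -1 != 0 :> R by rewrite oppr_eq0 oner_eq0.
rewrite -(normal_affine 0 n1 mB) /normal_prob; congr (integral _ _ _).
by apply/funext => x; rewrite !normal_pdfE ?oner_eq0// /normal_peak /normal_fun sqrrN.
Qed.

Lemma gamma_mean : \int[gamma]_y y = 0 :> R.
Proof.
have mo : @measurable_fun _ _ (measurableTypeR R) (measurableTypeR R) setT (fun y => -
  y).
  exact: measurable_funN.
have E : \int[law gamma mo]_y y = \int[gamma]_y y.
  by congr fine; apply: (@eq_set_integral _ _ R (law gamma mo) gamma) => A mA;
    exact: gamma_opp.
have i : rint (law gamma mo) (fun y => y).
  by apply/rint_law => //; exact/rintN/rint_gamma_id.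
have := Rintegral_law i; rewrite E RintegralN; last exact: rint_gamma_id.
by move: (\int[gamma]_y y) => z; lra.
Qed.

(** With zero variance the law would be concentrated at the origin, a Lebesgue null set and so a
    null set of the law. *)
Lemma kappa_gt0 : 0 < kappa.
Proof.
rewrite lt_def Rintegral_ge0 ?andbT; last by move=> y _; exact: sqr_ge0.
apply/negP => /eqP k0.
have i := rint_gamma_sqr.
have e0 : (\int[gamma]_y `|(y ^+ 2)%:E| = 0)%E.
  under eq_integral do rewrite /= ger0_norm ?sqr_ge0//.
  by rewrite -[LHS]fineK; [congr EFin|exact: integrable_fin_num i].
have : ae_eq gamma setT (fun y => (y ^+ 2)%:E) (cst 0%E).
  by apply/ae_eq_integral_abs => //; apply/measurable_EFinP; exact: measurable_funX.
move=> [A [mA A0 hA]].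
pose Z : set R := [set 0].
have s1 : measurable Z by exact: measurable_set1.
have g0 : gamma Z = 0%E.
  by have /null_content_dominatesP := normal_prob_dominates (0 : R) 1; apply => //;
    exact: lebesgue_measure_set1.
have gT : gamma setT = 1%E by exact: probability_setT.
have : (gamma (A `|` Z) <= 0)%E by rewrite -[0%E]adde0 -{1}A0 -g0; exact: measureU2.
have -> : A `|` Z = setT.
  apply/seteqP; split => // y _; have [->|y0] := eqVneq y 0; [by right|left].
  by apply: hA => /(_ Logic.I) [] /eqP; rewrite sqrf_eq0 (negPf y0).
by rewrite gT lee_fin ler10.
Qed.

End gaussian_measure.

(** * Centred Gaussian variables and their limits *)

Section probability_lemmas.
Context {R : realType} {disp : measure_display} {Omega : measurableType disp}.
Variable P : probability Omega R.

Lemma probability_cst (m : R) (B : set R) : P ((fun=> m) @^-1` B) = \d_m B.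
Proof.
rewrite diracE; have [mB|mB] := boolP (m \in B).
  rewrite (_ : _ @^-1` B = setT) ?probability_setT//.
  by apply/seteqP; split => // y _; exact: set_mem.
rewrite (_ : _ @^-1` B = set0) ?measure0//.
by apply/seteqP; split => // y /= /mem_set; rewrite (negPf mB).
Qed.

Lemma rint_norm (f : Omega -> R) : rint P f -> rint P (fun w => `|f w|).
Proof. exact: integrable_abse. Qed.

Lemma nrm_cst (a : R[i]) : nrm P (fun=> a) = cmod a.
Proof.
have pT : fine (P setT) = 1 by rewrite probability_setT.
by rewrite /nrm /sq Rintegral_cst// [X in _ * X]pT mulr1.
Qed.

Lemma L2_rint (u : Omega -> R[i]) : L2 P u -> cintegrable P u.
Proof.
move=> iu; have := L2_mul_conj iu (L2_cst P 1).
by congr cintegrable; apply/funext => w; rewrite conj_real mulr1.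
Qed.

Lemma cint_le_nrm (u : Omega -> R[i]) : L2 P u -> cmod (cint P u) <= nrm P u.
Proof.
move=> iu; have := cauchy_schwarz iu (L2_cst P 1).
rewrite nrm_cst cmod_real normr1 mulr1; congr (cmod _ <= _).
by congr cint; apply/funext => w; rewrite conj_real mulr1.
Qed.

Lemma mean_norm_le_nrm (f : Omega -> R) : L2 P (fun w => (f w)%:C) ->
  \int[P]_w `|f w| <= nrm P (fun w => (f w)%:C).
Proof.
move=> iF; have iA : L2 P (fun w => (`|f w|)%:C).
  case: iF => -[mf _] l; split; first by apply: cmeasurable_real;
    exact: measurableT_comp.
  by under eq_integral do rewrite sqmod_real real_normK ?num_real// -sqmod_real.
have := le_trans (cmod_Re _) (cint_le_nrm iA); rewrite /cint/= ger0_norm.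
  rewrite !nrm_real; move=> /le_trans; apply.
  by under eq_Rintegral do rewrite real_normK ?num_real//.
by apply: Rintegral_ge0.
Qed.

End probability_lemmas.

Section gaussian_law.
Context {R : realType} {disp : measure_display} {Omega : measurableType disp}.
Variable P : probability Omega R.
Implicit Types xi eta : Omega -> R.
Local Notation gamma := (normal_prob (0 : R) 1).
Local Notation cplx xi := (fun w => (xi w)%:C).

(* Centred normal laws only; unlike [gaussian], the degenerate case [s = 0] needs
   no special treatment, and the sign of [s] is irrelevant. *)
Definition glaw xi (s : R) := measurable_fun setT xi /\
  forall B : set R, measurable B -> P (xi @^-1` B) = gamma ((fun y => s * y) @^-1` B).

Let measurable_scale (s : R) :
  @measurable_fun _ _ (measurableTypeR R) R setT (fun y : R => s * y).
Proof. exact: measurable_funM. Qed.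

Lemma glaw_transfer xi s (f : R -> R) : glaw xi s -> measurable_fun setT f ->
  rint gamma (fun y : R => f (s * y)) ->
  rint P (fun w => f (xi w)) /\ \int[P]_w f (xi w) = \int[gamma]_y f (s * y).
Proof.
move=> [mxi gxi] mf.
move=> /(rint_law (gamma : {finite_measure set _ -> \bar R}) (measurable_scale s) mf) i.
have E (h : R -> \bar R) : (\int[law P mxi]_y h y =
    \int[law gamma (measurable_scale s)]_y h y)%E by apply: eq_set_integral.
have j : rint (law P mxi) f.
  by case/integrableP : i => i1 i2; apply/integrableP; split => //; rewrite E.
split; first exact: (rint_law P mxi mf).1 j.
by rewrite -(Rintegral_law j) -(Rintegral_law i) /Rintegral E.
Qed.

Lemma glaw_moments xi s : glaw xi s ->
  [/\ rint P xi, \int[P]_w xi w = 0, rint P (fun w => xi w ^+ 2) &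
      \int[P]_w (xi w ^+ 2) = s ^+ 2 * kappa R].
Proof.
move=> gxi.
have i1 : rint gamma (fun y : R => s * y) by exact/rintZ/rint_gamma_id.
have e2 : (fun y : R => (s * y) ^+ 2) = (fun y => s ^+ 2 * y ^+ 2).
  by apply/funext => y; rewrite exprMn.
have i2 : rint gamma (fun y : R => (s * y) ^+ 2).
  by rewrite e2; exact/rintZ/rint_gamma_sqr.
have [j1 ->] := glaw_transfer gxi (@measurable_id _ _ _) i1.
have [j2 ->] := @glaw_transfer xi s (fun x => x ^+ 2) gxi (measurable_funX _
  (@measurable_id _ _ _)) i2.
split=> //; first by rewrite RintegralZl ?gamma_mean ?mulr0//; exact: rint_gamma_id.
by rewrite e2 RintegralZl//; exact: rint_gamma_sqr.
Qed.

Lemma glaw_L2 xi s : glaw xi s -> L2 P (cplx xi).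
Proof.
move=> gxi; have [_ _ i _] := glaw_moments gxi; case: gxi => mxi _.
apply/L2P; split; first exact: cmeasurable_real.
by under eq_fun do rewrite sqmod_real.
Qed.

Lemma glaw_opp xi s : glaw xi s -> glaw xi (- s).
Proof.
move=> [mxi gxi]; split => // B mB; rewrite gxi//.
have mB' : measurable ((fun y : R => s * y) @^-1` B).
  by rewrite -[X in measurable X]setTI; exact: measurable_funM.
rewrite -(gamma_opp mB'); congr (gamma _).
by apply/seteqP; split => y /=; rewrite mulrN mulNr.
Qed.

(** A canonical scale, computed from the L2 norm alone: centred normal variables of equal norm have
    equal laws. *)
Definition sd xi : R := nrm P (cplx xi) / Num.sqrt (kappa R).

Let sk0 : 0 < Num.sqrt (kappa R). Proof. by rewrite sqrtr_gt0 kappa_gt0. Qed.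

Lemma sdE xi s : glaw xi s -> sd xi = `|s|.
Proof.
move=> /glaw_moments[_ _ _ e]; rewrite /sd nrm_real e sqrtrM ?sqr_ge0// sqrtr_sqr.
by rewrite mulfK// gt_eqF.
Qed.

Lemma glaw_sd xi s : glaw xi s -> glaw xi (sd xi).
Proof.
move=> gxi; rewrite (sdE gxi); have [_|_] := ger0P s => //.
exact: glaw_opp.
Qed.

(** Every Gaussian law, degenerate or not, is the law of m + s y under the standard one; the
    vanishing mean then forces m = 0. *)
Lemma gaussian_glaw xi : gaussian P xi -> \int[P]_w xi w = 0 -> glaw xi (sd xi).
Proof.
move=> [mxi [m [s h]]] x0; suff [s' gs] : exists s', glaw xi s' by exact: glaw_sd gs.
have h' (B : set R) : measurable B ->
    P (xi @^-1` B) = gamma ((fun y => m + s * y) @^-1` B).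
  move=> mB; rewrite h//; have [->|s0] := eqVneq s 0; last exact: normal_affine.
  by under [in RHS]eq_fun do rewrite mul0r addr0; rewrite probability_cst.
have ma : @measurable_fun _ _ (measurableTypeR R) R setT (fun y : R => m + s * y).
  exact: measurable_affine.
have i : rint (law gamma ma) (fun y => y).
  apply/rint_law => //; apply: rintD; first exact: finite_measure_integrable_cst.
  exact/rintZ/rint_gamma_id.
have : \int[law gamma ma]_y y = \int[P]_w xi w.
  rewrite -[RHS](@Rintegral_law _ _ _ _ _ P xi mxi (fun y => y)).
    by congr fine; apply: eq_set_integral => B mB; exact: esym (h' B mB).
  case/integrableP : i => i1 i2; apply/integrableP; split => //.
  rewrite (@eq_set_integral _ _ _ (law P mxi) (law gamma ma)) => [|B mB];
    first exact: i2.
  exact: h'.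
rewrite (Rintegral_law i) x0 RintegralD//; last 2 first.
- exact: finite_measure_integrable_cst.
- exact/rintZ/rint_gamma_id.
rewrite RintegralZl ?gamma_mean ?mulr0 ?addr0//; last exact: rint_gamma_id.
have gT : fine (gamma setT) = 1 by rewrite probability_setT.
rewrite Rintegral_cst// [X in _ * X]gT mulr1 => m0.
by exists s; split => // B mB; rewrite h'// m0; under eq_fun do rewrite add0r.
Qed.

Lemma glaw_gaussian xi s : glaw xi s -> gaussian P xi.
Proof.
move=> [mxi h]; split => //; exists 0, s => B mB; rewrite h//.
case: eqVneq => [->|s0].
  by under eq_fun do rewrite mul0r; rewrite probability_cst.
rewrite (normal_affine 0 s0 mB); congr (normal_prob 0 1 (_ @^-1` B)).
by apply/funext => y; rewrite add0r.
Qed.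

Let measurable_cos_affine (a t : R) : measurable_fun setT (fun x : R => cos (a * x +
  t)).
Proof.
apply: (measurableT_comp (continuous_measurable_fun (@continuous_cos R))).
by apply: measurable_funD => //; exact: measurable_funM.
Qed.

Let rint_cos d (T : measurableType d) (m : {finite_measure set T -> \bar R})
    (f : T -> R) : measurable_fun setT f -> rint m (fun x => cos (f x)).
Proof.
move=> mf; apply: (@rint_bounded _ _ _ _ _ 1); last by move=> x; exact: cos_max.
exact: (measurableT_comp (continuous_measurable_fun (@continuous_cos R))).
Qed.

Let measurable_affine' d (T : measurableType d) (f : T -> R) (a t : R) :
  measurable_fun setT f -> measurable_fun setT (fun x => a * f x + t).
Proof. by move=> mf; apply: measurable_funD => //; exact: measurable_funM. Qed.

Lemma glaw_cos xi s (a t : R) : glaw xi s ->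
  \int[P]_w cos (a * xi w + t) = \int[gamma]_y cos (a * (s * y) + t).
Proof.
move=> gxi; have [//|_ ->//] := glaw_transfer gxi (measurable_cos_affine a t).
apply: rint_cos; apply: measurable_funD => //; apply: measurable_funM => //.
Qed.

Let phase_unit (a : unit -> R) (x : R) : phase (fun (_ : unit) (x : R) => x) a x = a tt
  * x.
Proof. by rewrite /phase (big_pred1 tt)//; case. Qed.

Lemma cos_glaw xi s : measurable_fun setT xi ->
  (forall a t : R, \int[P]_w cos (a * xi w + t) = \int[gamma]_y cos (a * (s * y) + t))
    ->
  glaw xi s.
Proof.
move=> mxi h; split => // B mB.
have := @measure_unique_cos _ R R unit (fun _ x => x) _ (law P mxi)
  (law gamma (measurable_scale s)) (@generates_id R) _ B mB.
apply => // a t; under eq_Rintegral do rewrite phase_unit.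
under [RHS]eq_Rintegral do rewrite phase_unit.
rewrite !Rintegral_law//; apply: rint_cos; apply: measurable_funD => //;
  apply: measurable_funM => //.
Qed.

(** The cosine is 1-Lipschitz, so both sides of the identity characterising the normal law move by
    at most a multiple of the L2 distance when [xi] is replaced by a normal [eta]. *)
Lemma glaw_limit xi : L2 P (cplx xi) ->
  (forall eps, 0 < eps -> exists2 eta, (exists s, glaw eta s) &
     nrm P (fun w => (xi w)%:C - (eta w)%:C) < eps) -> glaw xi (sd xi).
Proof.
move=> ixi h; have mxi : measurable_fun setT xi by case: ixi => -[].
apply: cos_glaw => // a t; apply/eqP;
  rewrite -subr_eq0 -normr_eq0 eq_le normr_ge0 andbT.
have iy := rint_gamma_id R.
have iay : rint gamma (fun y : R => `|y|) by exact: rint_norm.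
pose C := \int[gamma]_y `|y| : R.
have C0 : 0 <= C by apply: Rintegral_ge0 => y _.
(* The first term bounds the change of the law of the variable, the second the change of scale: |sd
   eta - sd xi| <= e / sqrt kappa, and [C] is the first absolute moment. *)
apply: (@arbitrarily_small _ _ (`|a| + `|a| * C / Num.sqrt (kappa R))).
  by rewrite addr_ge0// divr_ge0 ?mulr_ge0// sqrtr_ge0.
move=> e e0 _; have [eta [s0 gs] xe] := h e e0.
have ge := glaw_sd gs; have ieta := glaw_L2 ge; have meta := ge.1.
have d1 : `|\int[P]_w cos (a * xi w + t) - \int[P]_w cos (a * eta w + t)| <= `|a| * e.
  have iB : L2 P (fun w => (xi w - eta w)%:C).
    by have := L2B ixi ieta; congr L2; apply/funext => w; rewrite raddfB.
  rewrite -RintegralB//; try by apply: rint_cos; exact: measurable_affine'.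
  apply: (le_trans (le_normr_Rintegral _ _)) => //.
    by apply: rintB; apply: rint_cos; exact: measurable_affine'.
  apply: (@le_trans _ _ (\int[P]_w (`|a| * `|xi w - eta w|))).
    apply: le_Rintegral => //.
    - by apply: rint_norm; apply: rintB; apply: rint_cos; exact: measurable_affine'.
    - by apply: rintZ; apply: rint_norm; have [] := L2_rint iB.
    - by move=> w _; rewrite (le_trans (cos_lipschitz _ _))// opprD addrACA subrr addr0
        -mulrBr normrM.
  rewrite RintegralZl//; last by apply: rint_norm; have [] := L2_rint iB.
  rewrite ler_wpM2l//; apply: (le_trans (mean_norm_le_nrm iB)).
  by apply/ltW; under eq_fun do rewrite raddfB.
have d2 : `|\int[gamma]_y cos (a * (sd eta * y) + t) - \int[gamma]_y cos (a * (sd xi *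
  y) + t)| <=
    `|a| * C / Num.sqrt (kappa R) * e.
  rewrite -RintegralB//; try by apply: rint_cos; exact: measurable_affine'.
  apply: (le_trans (le_normr_Rintegral _ _)) => //.
    by apply: rintB; apply: rint_cos; exact: measurable_affine'.
  apply: (@le_trans _ _ (\int[gamma]_y (`|a| * `|sd eta - sd xi| * `|y|))).
    apply: le_Rintegral => //.
    - by apply: rint_norm; apply: rintB; apply: rint_cos; exact: measurable_affine'.
    - exact: rintZ.
    - move=> y _; rewrite (le_trans (cos_lipschitz _ _))// opprD addrACA subrr addr0.
      by rewrite -mulrBr -mulrBl !normrM mulrA.
  rewrite RintegralZl//; set k := Num.sqrt (kappa R).
  rewrite (_ : `|a| * _ / k * e = `|a| * (k^-1 * e) * C); last by rewrite -/C; ring.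
  rewrite ler_wpM2r// ler_wpM2l// /sd -mulrBl normrM mulrC.
  rewrite [X in X * _]gtr0_norm ?invr_gt0// ler_wpM2l ?invr_ge0 ?ltW//.
  have nx := nrm_le ixi ieta; have := nrm_le ieta ixi; rewrite nrm_distC.
  by move: xe nx; rewrite ltr_norml; lra.
rewrite (_ : _ - _ = (\int[P]_w cos (a * xi w + t) - \int[P]_w cos (a * eta w + t)) +
  (\int[gamma]_y cos (a * (sd eta * y) + t) - \int[gamma]_y cos (a * (sd xi * y) + t))).
  by rewrite mulrDl (le_trans (ler_normD _ _))// lerD.
by rewrite (glaw_cos _ _ ge) addrA subrK.
Qed.

(** The Cramér-Wold principle: the laws of all linear combinations of the coordinates determine the
    characteristic function. *)
Lemma glaw_unique d (T : measurableType d) (K : finType) (c : K -> T -> R)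
    (X Y : Omega -> T) : (forall k, measurable_fun setT (c k)) -> generates c ->
  measurable_fun setT X -> measurable_fun setT Y ->
  (forall a, exists2 s, glaw (fun w => phase c a (X w)) s & glaw (fun w => phase c a (Y
    w)) s) ->
  forall B, measurable B -> P (X @^-1` B) = P (Y @^-1` B).
Proof.
move=> mc gc mX mY h B mB.
have := @measure_unique_cos _ T R K c mc (law P mX) (law P mY) gc _ B mB.
apply => // a t; have mcos := measurable_cos_phase mc a t.
have i Z (mZ : measurable_fun setT Z) : rint (law P mZ) (fun x => cos (phase c a x +
  t)).
  by apply: rint_cos; apply: measurable_funD => //; exact: measurable_phase.
rewrite !Rintegral_law//; have [s gX gY] := h a.
have := glaw_cos 1 t gX; rewrite -(glaw_cos 1 t gY).
by under eq_Rintegral do rewrite mul1r; move=> ->; under eq_Rintegral do rewrite mul1r.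
Qed.

End gaussian_law.

(** * An independent normal sequence on the unit interval *)

Section rays.
Variable R : realType.

Definition ray (a : R) : set R := [set x | a < x].

Let rayE a : ray a = `]a, +oo[%classic.
Proof. by apply/seteqP; split => x; rewrite /= in_itv/= andbT. Qed.

Lemma measurable_ray a : measurable (ray a).
Proof. by rewrite rayE. Qed.

Lemma measurable_fun_ray d (T : measurableType d) (f : T -> R) :
  (forall a, measurable [set x | a < f x]) -> measurable_fun setT f.
Proof.
move=> h; apply: (measurability _ (RGenOInfty.measurableE R)).
by move=> _ [_ [a ->] <-]; rewrite setTI preimage_itvoy.
Qed.

Lemma measure_unique_ray (m1 m2 : {measure set (measurableTypeR R) -> \bar R}) :
  (m1 setT < +oo)%E -> (forall a, m1 (ray a) = m2 (ray a)) ->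
  forall A : set R, measurable A -> m1 A = m2 A.
Proof.
move=> fin h A mA.
apply: (@measure_unique _ R (measurableTypeR R) (@RGenOInfty.G R) (fun k => ray (-
  k%:R)) (RGenOInfty.measurableE R) _ _ _ m1 m2) => //.
- move=> _ _ [a ->] [b ->]; exists (Num.max a b); apply/seteqP; split => x /=.
    by rewrite !in_itv/= !andbT gt_max => -[-> ->].
  by rewrite !in_itv/= !andbT gt_max => /andP[].
- by move=> k; exists (- k%:R); exact: rayE.
- apply/seteqP; split => // x _; exists (Num.bound `|x : R|) => //=.
  have := archi_boundP (normr_ge0 (x : R)); rewrite /ray/= ltr_norml => /andP[].
  by [].
- by move=> _ [a ->]; rewrite -rayE.
- move=> k; apply: le_lt_trans fin; apply: le_measure; rewrite ?inE//.
  exact: measurable_ray.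
Qed.

End rays.

Section binary_digits.
Variable R : realType.
Local Notation lambda := (@lebesgue_measure R).
Local Notation P := (uniform_prob (@ltr01 R)).

Lemma uniform_probE (A : set R) : measurable A -> P A = lambda (A `&` `[0, 1[).
Proof.
move=> mA; have mA1 : measurable_fun setT (fun x : R => (\1_A x : R)%:E).
  by apply/measurable_EFinP; exact: measurable_indic.
have := @integral_uniform R 0 1 ltr01 (fun x => (\1_A x : R)%:E) mA1 (fun x => ltac:(by
  rewrite lee_fin)).
rewrite integral_indic// setIT => ->.
rewrite subr0 invr1 mul1e -integral_itv_bndo_bndc ?integral_indic//.
exact: measurable_funTS.
Qed.

Definition bit (x : R) : bool := 2^-1 <= x.

Definition doubling (x : R) : R := 2 * x - (bit x)%:R.

Lemma measurable_bit b : measurable [set x | bit x = b].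
Proof.
have m1 : measurable [set x | bit x = true].
  rewrite (_ : mkset _ = `[2^-1, +oo[%classic)//.
  by apply/seteqP; split => x; rewrite /= in_itv/= andbT.
case: b => //; rewrite (_ : mkset _ = ~` [set x | bit x = true]);
  first exact: measurableC.
by apply/seteqP; split => x /=; case: (bit x).
Qed.

Lemma measurable_bitr : measurable_fun setT (fun x => (bit x)%:R : R).
Proof.
rewrite (_ : (fun _ => _) = \1_[set x | bit x = true]).
  by apply: measurable_indic; exact: measurable_bit.
apply/funext => x; rewrite indicE; congr (nat_of_bool _)%:R.
by apply/idP/idP => [h|/set_mem//]; exact/mem_set.
Qed.

Lemma measurable_doubling : measurable_fun setT doubling.
Proof. by apply: measurable_funB; [exact: measurable_funM|exact: measurable_bitr]. Qed.

Lemma measurable_preim_doubling C : measurable C -> measurable (doubling @^-1` C).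
Proof. by move=> mC; rewrite -[X in measurable X]setTI; exact: measurable_doubling. Qed.

(** The first digit is fair and independent of the remaining ones, which are again uniform:
    [doubling] stretches each half of [0, 1[ affinely onto the whole. *)
Lemma halving (b : bool) (C : set R) : measurable C ->
  P ([set x | bit x = b] `&` doubling @^-1` C) = ((2^-1)%:E * P C)%E.
Proof.
move=> mC; have m1 := measurable_bit b; have m2 := measurable_preim_doubling mC.
have mC1 : measurable (C `&` `[0, 1[) by exact: measurableI.
have n2 : 2 != 0 :> R by rewrite pnatr_eq0.
rewrite !uniform_probE//; last exact: measurableI.
rewrite (lebesgue_affine (- b%:R) n2 mC1) muleA -EFinM gtr0_norm// mulVf// mul1e.
congr (lambda _); apply/seteqP; split => x; move: (x : R) => {}x /=;
  rewrite !in_itv/= /doubling /bit.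
  move=> [[<- h] /andP[x0 x1]]; rewrite addrC; split => //.
  by case: (leP 2^-1 x) => h' /=; rewrite ?mulr1n ?mulr0n; apply/andP; split; lra.
rewrite addrC => -[h /andP[x0 x1]].
have E : (2^-1 <= x) = b.
  by case: b h x0 x1 {m1} => _ /=; rewrite ?mulr1n ?mulr0n => x0 x1; [|apply/negbTE;
    rewrite -ltNge]; lra.
rewrite E; split => //; case: b {h E m1} x0 x1 => /=; rewrite ?mulr1n ?mulr0n => x0 x1;
  by apply/andP; split; lra.
Qed.

Lemma split_bit (D : set R) : measurable D ->
  (P D = P ([set x | bit x = true] `&` D) + P ([set x | bit x = false] `&` D))%E.
Proof.
move=> mD; have m1 := measurable_bit true; have m2 := measurable_bit false.
rewrite -measureU//; try exact: measurableI.
  by congr (P _); apply/seteqP; split => x /=; [case: (bit x); [left|right]|case=> -[]].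
by apply/seteqP; split => // x /= [[-> _] []].
Qed.

(* Partial sums of the odd-indexed binary digits; composing with [doubling]
   gives the even-indexed ones. *)
Fixpoint odd_digits n (x : R) : R :=
  if n is n'.+1 then ((bit x)%:R + odd_digits n' (doubling (doubling x))) / 2 else 0.

Lemma measurable_odd_digits n : measurable_fun setT (odd_digits n).
Proof.
elim: n => [|n IH] //=; apply: measurable_funM => //; apply: measurable_funD.
  exact: measurable_bitr.
apply: (measurableT_comp IH); apply: (measurableT_comp measurable_doubling).
exact: measurable_doubling.
Qed.

Lemma odd_digits_ge0 n x : 0 <= odd_digits n x.
Proof. by elim: n x => //= n IH x; rewrite divr_ge0// addr_ge0. Qed.

Lemma odd_digits_le1 n x : odd_digits n x <= 1.
Proof.
elim: n x => //= n IH x; have := IH (doubling (doubling x)).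
by case: (bit x); rewrite /= ?mulr1n ?mulr0n; lra.
Qed.

Lemma odd_digitsS n x : odd_digits n x <= odd_digits n.+1 x.
Proof.
elim: n x => [x|n IH x]; first exact: odd_digits_ge0.
by rewrite -[odd_digits n.+2 x]/(_ / 2) -[odd_digits n.+1 x]/(_ / 2) ler_pM2r
  ?invr_gt0// lerD2l.
Qed.

(** The probability that [odd_digits] exceeds [x], computed by conditioning on the first digit: x <
    (b + t) / 2 is equivalent to 2 x - b < t. *)
Fixpoint tail_digits (n : nat) (x : R) : R :=
  if n is n'.+1 then (tail_digits n' (2 * x - 1) + tail_digits n' (2 * x)) / 2
  else (x < 0)%R%:R.

Definition tail_uniform (x : R) : R := Num.max 0 (Num.min 1 (1 - x)).

Lemma uniform_ray x : P (ray x) = (tail_uniform x)%:E.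
Proof.
rewrite uniform_probE; last exact: measurable_ray.
rewrite /tail_uniform; case: (ltP x 0) => h1.
  rewrite min_l; last lra.
  rewrite (_ : _ `&` _ = `[0, 1[%classic).
    by rewrite lebesgue_measure_itv/= lte_fin ltr01 oppr0 adde0 max_r.
  apply/seteqP; split => y /=; rewrite in_itv/= /ray/=; first by case.
  by move=> /andP[y0 y1]; split; [lra|rewrite y0].
rewrite min_r; last lra.
case: (leP 0 (1 - x)) => h2; last first.
  rewrite (_ : _ `&` _ = set0) ?measure0//.
  apply/seteqP; split => y //=; rewrite in_itv/= /ray/= => -[xy /andP[y0 y1]]; lra.
rewrite (_ : _ `&` _ = `]x, 1[%classic).
  rewrite lebesgue_measure_itv/= lte_fin; case: ltP => h3 //.
  by congr EFin; lra.
by apply/seteqP; split => y /=; rewrite !in_itv/= /ray/=;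
  [move=> [xy /andP[y0 y1]]|move=> /andP[y0 y1]; split => //]; apply/andP; split; lra.
Qed.

(** The uniform tail obeys the recursion that defines [tail_digits], which makes the two comparable
    level by level. *)
Lemma tail_uniform_rec x :
  tail_uniform x = (tail_uniform (2 * x - 1) + tail_uniform (2 * x)) / 2.
Proof.
rewrite /tail_uniform; apply/eqP; rewrite eq_sym; apply/eqP.
have [x0|x0] := ltP x 0.
  by rewrite !min_l ?max_r//; lra.
rewrite (min_r (_ : 1 - x <= 1)) ?(min_r (_ : 1 - 2 * x <= 1)); [|lra|lra].
have [x1|x1] := ltP x 2^-1.
  rewrite min_l ?max_r//; lra.
rewrite min_r; last lra.
have [x2|x2] := leP x 1.
  have h1 : 0 <= 1 - (2 * x - 1) by lra.
  have h2 : 1 - 2 * x <= 0 by lra.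
  have h3 : 0 <= 1 - x by lra.
  by rewrite (max_r h1) (max_l h2) (max_r h3); lra.
by rewrite !max_l; lra.
Qed.

Lemma tail_digits_lt0 n x : x < 0 -> tail_digits n x = tail_uniform x.
Proof.
move=> x0; have -> : tail_uniform x = 1.
  by rewrite /tail_uniform min_l ?max_r//; lra.
elim: n x x0 => [x x0|n IH x x0] /=; first by rewrite x0.
by rewrite !IH//; lra.
Qed.

Lemma tail_digits_ge1 n x : 1 <= x -> tail_digits n x = tail_uniform x.
Proof.
move=> x1; have -> : tail_uniform x = 0.
  by rewrite /tail_uniform min_r ?max_l//; lra.
elim: n x x1 => [x x1|n IH x x1] /=; first by rewrite ltNge (le_trans ler01 x1).
by rewrite !IH//; lra.
Qed.

(* No contraction in the recursion by itself: the point is that at most one of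
   [2 x - 1] and [2 x] lies in [0, 1[. *)
Lemma tail_digits_dist n x : `|tail_digits n x - tail_uniform x| <= 2^-1 ^+ n.
Proof.
elim: n x => [|n IH] x.
  rewrite expr0 /= /tail_uniform; case: (ltP x 0) => x0.
    by rewrite min_l ?max_r ?subrr ?normr0//; lra.
  rewrite min_r; last lra.
  by rewrite sub0r normrN; case: (leP 0 (1 - x)) => ?; rewrite ?normr0// ger0_norm//;
    lra.
rewrite [tail_digits _ _]/= tail_uniform_rec -mulrBl normrM exprSr [`|2^-1|]ger0_norm
  ?invr_ge0//.
rewrite ler_pM2r ?invr_gt0//.
have [h|h] := ltP (2 * x - 1) 0.
  by rewrite (tail_digits_lt0 _ h) opprD addrACA subrr add0r IH.
have x1 : 1 <= 2 * x by lra.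
by rewrite (tail_digits_ge1 n x1) opprD addrACA subrr addr0 IH.
Qed.

(** Removing the first digit of [w] exchanges the roles of the odd and even subsequences, so two
    successive halvings lead back to the same statement at level [n]. *)
Lemma joint_odd_digits n x y :
  P ([set w | x < odd_digits n w] `&` [set w | y < odd_digits n (doubling w)]) =
  (tail_digits n x * tail_digits n y)%:E.
Proof.
elim: n x y => [|n IH] x y.
  rewrite /=; case: (ltP x 0) => x0; last first.
    by rewrite (_ : _ `&` _ = set0) ?measure0 ?mul0r//; apply/seteqP; split => w //= [].
  case: (ltP y 0) => y0; last first.
    by rewrite (_ : _ `&` _ = set0) ?measure0 ?mulr0//; apply/seteqP; split => w //= [].
  by rewrite mulr1 (_ : _ `&` _ = setT) ?probability_setT//; apply/seteqP; split.
have m_ k (u v : R) : measurable ([set w | u < odd_digits k w] `&` [set w | v <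
  odd_digits k (doubling w)]).
  have h a : measurable [set w | a < odd_digits k w].
    by rewrite -[X in measurable X]setTI -preimage_itvoy; exact: measurable_odd_digits.
  by apply: measurableI => //; exact: (measurable_preim_doubling (h v)).
have m'_ (u v : R) : measurable ([set w | u < odd_digits n (doubling w)] `&` [set w | v
  < odd_digits n.+1 w]).
  have h k a : measurable [set w | a < odd_digits k w].
    by rewrite -[X in measurable X]setTI -preimage_itvoy; exact: measurable_odd_digits.
  by apply: measurableI => //; exact: (measurable_preim_doubling (h n u)).
have lt_digit (b : bool) (s t : R) : (s < (b%:R + t) / 2) = (2 * s - b%:R < t).
  by rewrite ltr_pdivlMr//; apply/idP/idP; lra.
(* The event left after the first digit [b], expressed for the shifted point: the former odd digits
   are now read after one [doubling]. *)
pose D (b : bool) := [set w | 2 * x - b%:R < odd_digits n (doubling w)] `&` [set w | y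
  < odd_digits n.+1 w].
have s1 (b : bool) : P ([set w | bit w = b] `&` ([set w | x < odd_digits n.+1 w] `&`
    [set w | y < odd_digits n.+1 (doubling w)])) = ((2^-1)%:E * P (D b))%E.
  rewrite -(halving b (m'_ _ _)); congr (P _); apply/seteqP.
  by split => w /= [<-]; rewrite !lt_digit.
(* The event left after the second digit [c]; both sums are now at level [n]. *)
pose D' (b c : bool) := [set w | 2 * x - b%:R < odd_digits n w] `&`
  [set w | 2 * y - c%:R < odd_digits n (doubling w)].
have s2 (b c : bool) : P ([set w | bit w = c] `&` D b) = ((2^-1)%:E * P (D' b c))%E.
  rewrite -(halving c (m_ _ _ _)); congr (P _); apply/seteqP.
  by rewrite /D; split => w /= [<-]; rewrite !lt_digit.
rewrite split_bit// !s1 (split_bit (m'_ _ _)) [P (D false)](split_bit (m'_ _ _)) !s2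
  !IH !subr0.
rewrite -!(EFinM, EFinD) /= mulr1n; congr EFin.
by move: (tail_digits n _) (tail_digits n _) (tail_digits n _) (tail_digits n _) => p q
  r s; field.
Qed.

(** A supremum rather than a limit, so that strict rays pull back to increasing countable unions of
    digit events. *)
Definition odd_part (x : R) : R := sup (range (odd_digits ^~ x)).

Lemma lt_odd_part a x : (a < odd_part x) <-> exists n, a < odd_digits n x.
Proof.
have ne : (range (odd_digits ^~ x)) !=set0 by exists (odd_digits 0 x), 0%N.
split=> [/(sup_gt ne)[_ [n _ <-] an]|[n an]]; first by exists n.
apply: (lt_le_trans an); apply: ub_le_sup; last by exists n.
by exists 1 => _ [k _ <-]; exact: odd_digits_le1.
Qed.

Lemma measurable_odd_part : measurable_fun setT odd_part.
Proof.
apply: measurable_fun_ray => a.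
rewrite (_ : mkset _ = \bigcup_n [set x | a < odd_digits n x]).
  apply: bigcup_measurable => n _.
  by rewrite -[X in measurable X]setTI -preimage_itvoy; exact: measurable_odd_digits.
apply/seteqP; split => x /=; first by move=> /lt_odd_part[n ?]; exists n.
by move=> [n _ ?]; apply/lt_odd_part; exists n.
Qed.

(** Continuity from below on the events, and convergence of [tail_digits] to the uniform tail on the
    probabilities. *)
Lemma joint_ray x y :
  P (odd_part @^-1` ray x `&` (odd_part \o doubling) @^-1` ray y) = (P (ray x) * P (ray
    y))%E.
Proof.
rewrite !uniform_ray.
pose F n := [set w | x < odd_digits n w] `&` [set w | y < odd_digits n (doubling w)].
have mono n m w : (n <= m)%N -> odd_digits n w <= odd_digits m w.
  by move=> nm; have := @nondecreasing_seqP _ _ (odd_digits ^~ w); case => + _;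
    apply => // k; exact: odd_digitsS.
have -> : odd_part @^-1` ray x `&` (odd_part \o doubling) @^-1` ray y = \bigcup_n F n.
  apply/seteqP; split => w /=.
    move=> [/lt_odd_part[n xn] /lt_odd_part[m ym]]; exists (maxn n m) => //;
      split => /=.
      by rewrite (lt_le_trans xn)// mono// leq_maxl.
    by rewrite (lt_le_trans ym)// mono// leq_maxr.
  by move=> [n _ [/= xn yn]]; split; apply/lt_odd_part; exists n.
have h a k : measurable [set w | a < odd_digits k w].
  by rewrite -[X in measurable X]setTI -preimage_itvoy; exact: measurable_odd_digits.
have mF n : measurable (F n).
  by apply: measurableI => //; exact: (measurable_preim_doubling (h y n)).
have /cvg_lim <- // : P \o F @ \oo --> P (\bigcup_n F n).
  have mU : measurable (\bigcup_n F n) by apply: bigcup_measurable => n _; exact: mF.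
  apply: (@nondecreasing_cvg_mu _ _ _ P F) => //.
  move=> n m nm; apply/subsetPset => w [/= xn yn].
  by split => /=; [rewrite (lt_le_trans xn)// mono|rewrite (lt_le_trans yn)// mono].
have tc z : tail_digits ^~ z @ \oo --> tail_uniform z.
  apply/cvgrPdist_le => e e0; have : (2^-1 : R) ^+ n @[n --> \oo] --> (0 : R).
    by apply: cvg_expr; rewrite ger0_norm ?invr_ge0// invf_lt1// ltr1n.
  move=> /cvgrPdist_le /(_ _ e0); apply: filterS => n.
  rewrite sub0r normrN normrX ger0_norm ?invr_ge0// distrC => /(le_trans _); apply.
  exact: tail_digits_dist.
apply/cvg_lim => //; rewrite (_ : P \o F = EFin \o (fun n => tail_digits n x *
  tail_digits n y)).
  by apply: cvg_EFin; [near=> n|exact: cvgM].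
by apply/funext => n /=; rewrite joint_odd_digits.
Unshelve. all: by end_near. Qed.

(** With the other event [D] fixed, both sides are finite measures in [A]; independence is thus
    extended from rays one variable at a time. *)
Let ray_ext (f : R -> R) (D : set R) (r : R) : measurable_fun setT f -> measurable D ->
  0 <= r -> (forall a, P (f @^-1` ray a `&` D) = r%:E * P (ray a))%E ->
  forall A, measurable A -> P (f @^-1` A `&` D) = (r%:E * P A)%E.
Proof.
move=> mf mD r0 h.
pose mf' : @measurable_fun _ _ (measurableTypeR R) (measurableTypeR R) setT f := mf.
apply: (@measure_unique_ray R (law (mrestr P mD) mf') (mscale (NngNum r0) P)) => //.
have : (P (f @^-1` setT `&` D) < +oo)%E; last by [].
by rewrite preimage_setT setTI (le_lt_trans (probability_le1 _ _))// ltry.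
Qed.

Lemma joint_uniform (A C : set R) : measurable A -> measurable C ->
  P (odd_part @^-1` A `&` (odd_part \o doubling) @^-1` C) = (P A * P C)%E.
Proof.
have mo := measurable_odd_part.
have me : measurable_fun setT (odd_part \o doubling).
  exact: (measurableT_comp mo measurable_doubling).
have preim (f : R -> R) (B : set R) : measurable_fun setT f -> measurable B ->
  measurable (f @^-1` B).
  by move=> mf mB; rewrite -[X in measurable X]setTI; exact: mf.
have fin (B : set R) : measurable B -> ((fine (P B))%:E = P B)%E.
  by move=> mB; rewrite fineK// fin_num_measure.
move=> mA mC; rewrite setIC -(fin A)//.
apply: ray_ext => // [||a]; [exact: preim|exact: fine_ge0|].
rewrite setIC muleC (fin A)// -(fin (ray a)); last exact: measurable_ray.
apply: ray_ext => // [||b]; [by apply: preim => //;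
  exact: measurable_ray|exact: fine_ge0|].
by rewrite joint_ray muleC (fin _ (measurable_ray a)).
Qed.

End binary_digits.

(** * The quantile transform *)

Section quantile.
Variables (R : realType) (m : probability (measurableTypeR R) R).
Local Notation P := (uniform_prob (@ltr01 R)).

Let idR : measurableTypeR R -> R := idfun.
HB.instance Definition _ := @isMeasurableFun.Build _ _ _ _ idR (@measurable_id _ _
  setT).
Let F (x : R) : \bar R := cdf (idR : {RV m >-> R}) x.

Let F_le x y : x <= y -> (F x <= F y)%E. Proof. exact: cdf_nondecreasing. Qed.

Let F_right (x : R) (u : \bar R) : (F x < u)%E -> exists2 y, x < y & (F y < u)%E.
Proof.
move=> xu; apply: contrapT => h.
have : (u <= F x)%E.
  apply: (cvge_to_ge (@cdf_right_continuous _ _ _ _ (idR : {RV m >-> R}) x)).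
  near=> y; rewrite leNgt; apply/negP => yu; apply: h; exists y => //.
by rewrite leNgt xu.
Unshelve. all: by end_near. Qed.

Let F_top (u : R) : u < 1 -> exists x, (u%:E <= F x)%E.
Proof.
move=> u1; apply: contrapT => h; have : (1 <= u%:E)%E.
  apply: (cvge_to_le (@cvg_cdfy1 _ _ _ _ (idR : {RV m >-> R}))).
  by near=> y; rewrite leNgt; apply/negP => /ltW yu; apply: h; exists y.
by rewrite lee_fin leNgt u1.
Unshelve. all: by end_near. Qed.

Let F_bot (u : R) : 0 < u -> exists x, (F x < u%:E)%E.
Proof.
move=> u0; apply: contrapT => h; have : (u%:E <= 0)%E.
  apply: (cvge_to_ge (@cvg_cdfNy0 _ _ _ _ (idR : {RV m >-> R}))).
  by near=> y; rewrite leNgt; apply/negP => yu; apply: h; exists y.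
by rewrite lee_fin leNgt u0.
Unshelve. all: by end_near. Qed.

(** Outside ]0, 1[ the supremum could be over an empty or unbounded set; the default 0 only affects
    a null set. *)
Definition quantile (u : R) : R :=
  if 0 < u < 1 then sup [set x | (F x < u%:E)%E] else 0.

(** The Galois relation between quantile and distribution function; right continuity supplies the
    strict inequality in one direction. *)
Let lt_quantile (u x : R) : 0 < u < 1 -> (x < quantile u) = (F x < u%:E)%E.
Proof.
rewrite /quantile => /[dup] u01 ->; case/andP : u01 => u0 u1.
have ne : [set x | (F x < u%:E)%E] !=set0 by have [y] := F_bot u0; exists y.
apply/idP/idP => [/(sup_gt ne)[y /= yu xy]|/F_right[y xy yu]].
  exact/(le_lt_trans _ yu)/F_le/ltW.
apply: (lt_le_trans xy); apply: ub_le_sup => //.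
have [M uM] := F_top u1; exists M => z /= zu; rewrite leNgt; apply/negP => /ltW/F_le.
by rewrite leNgt (lt_le_trans zu).
Qed.

Let F_fin x : ((fine (F x))%:E = F x)%E. Proof. by rewrite fineK// fin_num_measure. Qed.

Let uniform_prob_interior (A : set R) : measurable A -> P A = P (A `&` `]0, 1[).
Proof.
move=> mA; have P1 : P `]0, 1[ = 1%E.
  rewrite uniform_probE// (_ : _ `&` _ = `]0, 1[%classic).
    by rewrite lebesgue_measure_itv/= lte_fin ltr01 oppr0 adde0.
  apply/seteqP; split => x /=; rewrite !in_itv/=; first by case.
  by move=> /andP[x0 x1]; rewrite x0 x1 ltW.
rewrite (measureDI P mA (measurable_itv `]0,
  1[)) [X in (X + _)%E](_ : _ = 0%E) ?add0e//.
apply/eqP; rewrite eq_le measure_ge0 andbT.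
have <- : P (~` `]0, 1[) = 0%E.
  apply: (etrans (probability_setC P (measurable_itv `]0, 1[))).
  by rewrite [X in (1 - X)%E]P1 subee.
by apply: le_measure; rewrite ?inE; [exact: measurableD|exact: measurableC|move=> x []].
Qed.

Lemma measurable_quantile : measurable_fun setT quantile.
Proof.
apply: measurable_fun_ray => a.
have -> : [set x | a < quantile x] = `]0, 1[ `&` `]fine (F a), +oo[ `|` ~` `]0,
  1[ `&` [set _ | a < 0].
  apply/seteqP; split => u /=; rewrite !in_itv/= andbT.
    case: (boolP (0 < u < 1)) => u01; last by rewrite /quantile (negPf u01); right.
    by rewrite lt_quantile// -F_fin lte_fin; left.
  case=> [[u01]|[/negP u01 a0]]; first by rewrite lt_quantile// -F_fin lte_fin.
  by rewrite /quantile (negPf u01).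
apply: measurableU; apply: measurableI => //; first exact: measurableC.
by case: (a < 0); [rewrite (_ : mkset _ = setT)//|rewrite (_ : mkset _ = set0)//];
  apply/seteqP; split.
Qed.

Lemma law_quantile (A : set R) : measurable A -> P (quantile @^-1` A) = m A.
Proof.
have mq : @measurable_fun _ _ (measurableTypeR R) (measurableTypeR R) setT quantile.
  exact: measurable_quantile.
move: A; apply: (@measure_unique_ray _ (law P mq) m).
  have : (P setT < +oo)%E by rewrite probability_setT ltry.
  by [].
move=> a; have ma := measurable_ray a; have mqa : measurable (quantile @^-1` ray a).
  by rewrite -[X in measurable X]setTI; exact: mq.
transitivity (P (ray (fine (F a)))).
  transitivity (P (quantile @^-1` ray a)); first by [].
  rewrite uniform_prob_interior// [RHS]uniform_prob_interior//;
    last exact: measurable_ray.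
  congr (P _); apply/seteqP; split => u /=; rewrite in_itv/= => -[h u01]; split => //;
    move: h;
    by rewrite /ray/= lt_quantile// -F_fin lte_fin.
have Fa : F a = m `]-oo, a]%classic by [].
transitivity (1 - F a)%E; last first.
  rewrite Fa -probability_setC//; congr (m _); apply/seteqP; split => x /=.
    by rewrite /ray/= in_itv/= leNgt => /negP; rewrite negbK.
  by rewrite /ray/= in_itv/= leNgt => ->.
have F0 : (0 <= F a)%E by []. have F1 : (F a <= 1)%E by exact: probability_le1.
have [x Fx] : exists x, F a = x%:E by exists (fine (F a)); rewrite F_fin.
move: F0 F1; rewrite uniform_ray Fx -EFinB /tail_uniform !lee_fin => x0 x1.
by rewrite /= min_r ?max_r//; lra.
Qed.

End quantile.

(** * Sums of independent normal variables *)

Section convolution.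
Variable R : realType.
Local Notation lambda := (@lebesgue_measure R).
Local Notation gamma := (normal_prob (0 : R) 1).

(** Completing the square: the joint density of x and z = a x + b y is the marginal density of z
    times the conditional density of x given z, with mean a z / r^2 and deviation b / r. *)
Lemma normal_pdf_conv (a b r x z : R) : b != 0 -> r != 0 -> r ^+ 2 = a ^+ 2 + b ^+ 2 ->
  normal_pdf (a * x) b z * normal_pdf 0 1 x =
  normal_pdf 0 r z * normal_pdf (a * z / r ^+ 2) (b / r) x.
Proof.
move=> b0 r0 e; have r2 : r ^+ 2 != 0 by rewrite expf_eq0.
rewrite !normal_pdfE ?oner_eq0 ?mulf_neq0 ?invr_eq0// /normal_fun.
rewrite mulrACA [RHS]mulrACA -!expRD; congr (_ * expR _).
  have p0 s : 0 <= s ^+ 2 * pi *+ 2 :> R by rewrite mulrn_wge0// mulr_ge0 ?sqr_ge0//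
    pi_ge0.
  rewrite /normal_peak -!invfM -!sqrtrM//.
  by congr (Num.sqrt _)^-1; field.
have e' : b ^+ 2 = r ^+ 2 - a ^+ 2 by rewrite e addrC addKr.
rewrite subr0 exprMn exprVn.
have b2 : b ^+ 2 != 0 by rewrite expf_eq0.
move: (b ^+ 2) (r ^+ 2) e b2 r2 {e'} => B r' -> b2 r2.
by field; rewrite r2 b2.
Qed.

Let measurable_normal_pdf_mean (a b : R) : b != 0 ->
  measurable_fun setT (fun p : measurableTypeR R * measurableTypeR R => normal_pdf (a *
    p.1) b p.2).
Proof.
move=> b0; rewrite (_ : (fun _ => _) = normal_pdf 0 b \o (fun p => p.2 - a * p.1)).
  apply: (measurableT_comp (measurable_normal_pdf 0 b)).
  apply: measurable_funB; first exact: measurable_snd.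
  by apply: measurable_funM => //; exact: measurable_fst.
by apply/funext => p; rewrite /= !normal_pdfE//= /normal_fun subr0.
Qed.

(** After exchanging the integrals, the conditional density integrates to one and the marginal
    remains. *)
Lemma gamma_conv (a b r : R) (B : set R) : r ^+ 2 = a ^+ 2 + b ^+ 2 -> measurable B ->
  (\int[gamma]_x gamma ((fun y : R => (a * x + b * y)%R) @^-1` B) =
   gamma ((fun y : R => (r * y)%R) @^-1` B))%E.
Proof.
move=> e mB; have mpre c : measurable ((fun y : R => c * y) @^-1` B).
  by rewrite -[X in measurable X]setTI; exact: measurable_funM.
(* Without a second term there is no density in z; then r = a or r = - a, and the symmetry of the
   standard law concludes. *)
have [b0|b0] := eqVneq b 0.
  transitivity (gamma ((fun y : R => a * y) @^-1` B)).
    transitivity (\int[gamma]_x (\1_((fun y : R => (a * y)%R) @^-1` B) x : R)%:E)%E;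
      last first.
      have := @integral_indic _ _ R gamma _ measurableT _ (mpre a).
      by rewrite setIT.
    apply: eq_integral => x _.
    rewrite (_ : (fun y : R => a * x + b * y) = fun=> a * x); last first.
      by apply/funext => y; rewrite b0 mul0r addr0.
    rewrite (probability_cst gamma) diracE indicE.
    by congr (nat_of_bool _)%:R%:E; apply/idP/idP; rewrite !inE.
  move: e; rewrite b0 expr0n addr0 => /eqP; rewrite eqf_sqr => /orP[/eqP ->//|/eqP ->].
  rewrite -(gamma_opp (mpre a)); congr (gamma _).
  by apply/seteqP; split => y /=; rewrite mulrN mulNr.
have r0 : r != 0.
  by rewrite -sqrf_eq0 e gt_eqF// ltr_wpDl ?sqr_ge0// exprn_even_gt0.
have mpdf (c s : R) : measurable_fun setT (fun x => (normal_pdf c s x)%:E).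
  by apply/measurable_EFinP; exact: measurable_normal_pdf.
pose h (p : measurableTypeR R * measurableTypeR R) : R :=
  \1_B p.2 * normal_pdf (a * p.1) b p.2.
have h0 p : 0 <= h p by rewrite mulr_ge0// normal_pdf_ge0.
have mh : measurable_fun setT (EFin \o h).
  apply/measurable_EFinP; apply: measurable_funM;
    last exact: measurable_normal_pdf_mean.
  have mI : @measurable_fun _ _ (measurableTypeR R) R setT (\1_B : R -> R).
    exact: measurable_indic.
  exact: (measurableT_comp mI measurable_snd).
have hE x : normal_prob (a * x) b B = (\int[lambda]_z (h (x, z))%:E)%E.
  rewrite /normal_prob integral_mkcond; apply: eq_integral => z _.
  by rewrite patchE /h/= indicE; case: (z \in B); rewrite ?mul1r ?mul0r.
under eq_integral do rewrite -normal_affine// hE.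
rewrite ge0_integral_normal//; last 2 first.
- have := @measurable_fun_fubini_tonelli_F _ _ _ _ _ lambda (EFin \o h) mh.
  by apply => p; rewrite lee_fin.
- by move=> x; apply: integral_ge0 => z _; rewrite lee_fin.
have mhx x : measurable_fun setT (fun z : measurableTypeR R => (h (x, z))%:E).
  exact: (measurableT_comp mh (pair1_measurable x)).
pose H (p : measurableTypeR R * measurableTypeR R) : R := h p * normal_pdf 0 1 p.1.
transitivity (\int[lambda]_x \int[lambda]_z (H (x, z))%:E)%E.
  apply: eq_integral => x _; rewrite -ge0_integralZr//.
    by move=> z _; rewrite lee_fin.
  by rewrite lee_fin normal_pdf_ge0.
rewrite (fubini_tonelli (EFin \o H)); last 2 first.
- apply/measurable_EFinP; apply: measurable_funM; first exact/measurable_EFinP.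
  by apply: (measurableT_comp (measurable_normal_pdf 0 1)); exact: measurable_fst.
- by move=> p; rewrite lee_fin mulr_ge0// normal_pdf_ge0.
transitivity (normal_prob 0 r B); last first.
  by rewrite (normal_affine 0 r0 mB); congr (gamma (_ @^-1` B)); apply/funext => y;
    rewrite add0r.
transitivity (\int[lambda]_z (\1_B z * normal_pdf 0 r z)%:E)%E; last first.
  rewrite /normal_prob [RHS]integral_mkcond; apply: eq_integral => z _.
  by rewrite patchE indicE; case: (z \in B); rewrite ?mul1r ?mul0r.
congr (integral _ _ _); apply/funext => z.
transitivity (\int[lambda]_x ((\1_B z * normal_pdf 0 r z)%:E *
    (normal_pdf (a * z / r ^+ 2) (b / r) x)%:E))%E.
  apply: eq_integral => x _; rewrite -EFinM /H /h /=; congr EFin.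
  by rewrite -[LHS]mulrA -[RHS]mulrA (normal_pdf_conv _ _ b0 r0 e).
rewrite ge0_integralZl//; last 2 first.
- by move=> x _; rewrite lee_fin normal_pdf_ge0.
- by rewrite lee_fin mulr_ge0// normal_pdf_ge0.
  by rewrite integral_normal_pdf mule1.
exact: mpdf.
Qed.

End convolution.

Section gaussian_sequence.
Variable R : realType.
Local Notation P := (uniform_prob (@ltr01 R)).
Local Notation gamma := (normal_prob (0 : R) 1).

Let alpha (w : R) : R := quantile gamma (odd_part w).
Let beta (w : R) : R := odd_part (doubling w).

Let measurable_alpha : @measurable_fun _ _ (measurableTypeR R) (measurableTypeR R) setT
  alpha.
Proof. exact: (measurableT_comp (measurable_quantile gamma) (measurable_odd_part (R :=
  R))). Qed.

Let measurable_beta : @measurable_fun _ _ (measurableTypeR R) (measurableTypeR R) setT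
  beta.
Proof. exact: (measurableT_comp (measurable_odd_part (R :=
  R)) (measurable_doubling (R := R))). Qed.

Let phi (w : measurableTypeR R) : measurableTypeR R * measurableTypeR R :=
  (alpha w, beta w).

Let measurable_phi : measurable_fun setT phi.
Proof. exact: measurable_fun_pair. Qed.

(* Splitting a uniform variable into a standard normal one and an independent
   uniform one; iterating produces an independent normal sequence. *)
Let law_phi (B : set (measurableTypeR R * measurableTypeR R)) : measurable B ->
  P (phi @^-1` B) = (gamma \x P)%E B.
Proof.
move=> mB; symmetry.
apply: (@product_measure_unique _ _ _ _ _ gamma P (law P measurable_phi)) => // A C mA
  mC.
have mqA : measurable (quantile gamma @^-1` A).
  by rewrite -[X in measurable X]setTI; exact: measurable_quantile.
transitivity (P (quantile gamma @^-1` A) * P C)%E;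
  last by rewrite (law_quantile gamma mA).
by rewrite -joint_uniform.
Qed.

Definition normal_seq (k : nat) (w : R) : R := alpha (iter k beta w).

(** All terms but the first are functions of [beta] w, so [law_phi] makes them independent of the
    first, and [gamma_conv] adds the squared scales. *)
Lemma glaw_normal_seq n (a : nat -> R) r : r ^+ 2 = \sum_(k < n) a k ^+ 2 ->
  glaw P (fun w => \sum_(k < n) a k * normal_seq k w) r.
Proof.
elim: n a r => [|n IH] a r.
  rewrite big_ord0 => /eqP; rewrite sqrf_eq0 => /eqP ->.
  rewrite (_ : (fun _ => _) = fun=> 0); last by apply/funext => w; rewrite big_ord0.
  split => // B mB; rewrite probability_cst.
  under [in RHS]eq_fun do rewrite mul0r.
  by rewrite (probability_cst gamma).
rewrite big_ord_recl => e.
pose b := Num.sqrt (\sum_(k < n) a k.+1 ^+ 2).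
have b2 : b ^+ 2 = \sum_(k < n) a k.+1 ^+ 2.
  by rewrite sqr_sqrtr// sumr_ge0// => k _; exact: sqr_ge0.
have [mS hS] := IH (fun k => a k.+1) b b2.
pose S w := \sum_(k < n) a k.+1 * normal_seq k w.
have -> : (fun w => \sum_(k < n.+1) a k * normal_seq k w) =
    (fun p => a 0%N * p.1 + S p.2) \o phi.
  apply/funext => w; rewrite big_ord_recl /=; congr (_ + _).
  by apply: eq_bigr => k _; rewrite /normal_seq -iterSr.
have mg : measurable_fun setT (fun p : measurableTypeR R * measurableTypeR R => a 0%N *
  p.1 + S p.2).
  apply: measurable_funD; first by apply: measurable_funM => //; exact: measurable_fst.
  by apply: (measurableT_comp mS); exact: measurable_snd.
split; first exact: (measurableT_comp mg measurable_phi).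
move=> B mB; have mgB : measurable ((fun p : measurableTypeR R * measurableTypeR R => a
  0%N * p.1 + S p.2) @^-1` B).
  by rewrite -[X in measurable X]setTI; exact: mg.
transitivity ((gamma \x P)%E ((fun p : measurableTypeR R * measurableTypeR R => a 0%N *
  p.1 + S p.2) @^-1` B)).
  exact: law_phi mgB.
have e2 : r ^+ 2 = a 0%N ^+ 2 + b ^+ 2 by rewrite e b2.
rewrite -(gamma_conv e2 mB).
rewrite /product_measure1; apply: eq_integral => x _ /=.
have -> : xsection ((fun p : measurableTypeR R * measurableTypeR R => a 0%N * p.1 + S
  p.2) @^-1` B) x =
    S @^-1` ((fun y => a 0%N * x + y) @^-1` B).
  by apply/seteqP; split => w /=; rewrite /xsection/= inE.
rewrite hS//; rewrite -[X in measurable X]setTI.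
by apply: measurable_funD.
Qed.

End gaussian_sequence.

(** * Gaussian families with a given covariance *)

Section cholesky.
Variables (R : realType) (K : nat -> nat -> R).
Hypothesis Ksym : forall s t, K s t = K t s.
Hypothesis Kpsd : forall N (c : nat -> R),
  0 <= \sum_(s < N) \sum_(t < N) c s * c t * K s t.

(** The first rows of a lower triangular factor, as sequences vanishing past the diagonal, so that
    appending a row leaves the earlier ones unchanged. *)
Definition cholesky_prefix n (L : nat -> nat -> R) :=
  (forall s k, (s < n)%N -> (s < k)%N -> L s k = 0) /\
  (forall s t, (s < n)%N -> (t < n)%N -> \sum_(k < n) L s k * L t k = K s t).

Let quadS n (c : nat -> R) :
  \sum_(s < n.+1) \sum_(t < n.+1) c s * c t * K s t =
  \sum_(s < n) \sum_(t < n) c s * c t * K s t +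
  2 * c n * (\sum_(s < n) c s * K n s) + c n ^+ 2 * K n n.
Proof.
rewrite big_ord_recr /=; under eq_bigr do rewrite big_ord_recr /=.
rewrite big_split /= big_ord_recr /= -!addrA; congr (_ + _).
have -> : \sum_(s < n) c s * c n * K s n = c n * (\sum_(s < n) c s * K n s).
  by rewrite mulr_sumr; apply: eq_bigr => s _; rewrite (Ksym s n); ring.
have -> : \sum_(s < n) c n * c s * K n s = c n * (\sum_(s < n) c s * K n s).
  by rewrite mulr_sumr; apply: eq_bigr => s _; rewrite mulrA.
by move: (\sum_(s < n) _) => x; ring.
Qed.

Let linear_term_eq0 (a b : R) : (forall t, 0 <= 2 * t * b + t ^+ 2 * a) -> b = 0.
Proof.
move=> h; have a0 : 0 <= a.
  by have := h 1; have := h (-1); rewrite sqrrN expr1n; lra.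
apply/eqP; rewrite -sqrf_eq0 eq_le sqr_ge0 andbT.
have a1 : 0 < a + 1 by rewrite ltr_wpDl.
(* The shifted denominator a + 1 avoids a separate case a = 0; the value there is - b^2 (a + 2) / (a
   + 1)^2. *)
have := h (- b / (a + 1)).
have -> : 2 * (- b / (a + 1)) * b + (- b / (a + 1)) ^+ 2 * a = b ^+ 2 * - ((a + 2) / (a
  + 1) ^+ 2).
  by field; rewrite gt_eqF.
have q0 : 0 < (a + 2) / (a + 1) ^+ 2 by rewrite divr_gt0 ?exprn_gt0//; lra.
by rewrite mulrN oppr_ge0 pmulr_lle0.
Qed.

(** The block may be singular, yet the new row lies in its row space: for [v] in the kernel of the
    block, the form at (v, t) is 2 t (v . k) + t^2 K_nn, and nonnegativity for all [t] forces v . k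
    = 0. *)
Lemma kernel_solvable n : exists c : 'I_n -> R, forall t : 'I_n,
  \sum_s c s * K s t = K n t.
Proof.
pose A : 'M[R]_n := \matrix_(s, t) K s t; pose k : 'rV[R]_n := \row_t K n t.
have /submxP[c kc] : (k <= A)%MS.
  rewrite submxE; apply/eqP/matrixP => i j; rewrite (ord1 i) [RHS]mxE.
  pose v s : R := if insub s is Some s' then cokermx A s' j else 0.
  have vE (s : 'I_n) : v s = cokermx A s j by rewrite /v insubT//= => ?;
    congr (cokermx A _ j); exact: val_inj.
  have Av (s : 'I_n) : \sum_(t < n) K s t * v t = 0.
    have /matrixP/(_ s j) := mulmx_coker A; rewrite !mxE => h; rewrite -[RHS]h.
    by apply: eq_bigr => t _; rewrite [A _ _]mxE vE.
  have -> : (k *m cokermx A) 0 j = \sum_(s < n) v s * K n s.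
    by rewrite mxE; apply: eq_bigr => s _; rewrite mxE vE mulrC.
  apply: (@linear_term_eq0 (K n n)) => t.
  pose e s := if s == n then t else v s.
  have en : e n = t by rewrite /e eqxx.
  have eE (s : 'I_n) : e s = v s by rewrite /e (ltn_eqF (ltn_ord s)).
  have := Kpsd n.+1 e; rewrite quadS en.
  rewrite [X in X + _ + _](_ : _ = 0); last first.
    apply: big1 => s _; transitivity (v s * \sum_(l < n) K s l * v l);
      last by rewrite Av mulr0.
    by rewrite mulr_sumr; apply: eq_bigr => l _; rewrite !eE -mulrA [v l * _]mulrC.
  by rewrite add0r (eq_bigr (fun s : 'I_n => v s * K n s))// => s _; rewrite eE.
exists (c 0) => t; have /matrixP/(_ 0 t) := kc; rewrite !mxE => ->.
by apply: eq_bigr => s _; rewrite mxE.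
Qed.

Let extend n (L : nat -> nat -> R) (v : nat -> R) s := if s == n then v else L s.

(** The new row is the combination [u] of the old rows that reproduces the required products,
    followed by the square root of the Schur complement [r2] on the diagonal. *)
Lemma cholesky_step n L : cholesky_prefix n L ->
  exists v, cholesky_prefix n.+1 (extend n L v).
Proof.
move=> [L0 LK]; have [c hc] := kernel_solvable n.
pose u k : R := \sum_(s < n) c s * L s k.
have un : u n = 0 by apply: big1 => s _; rewrite L0 ?mulr0.
have uL (t : 'I_n) : \sum_(k < n) u k * L t k = K n t.
  rewrite -hc; under eq_bigr do rewrite mulr_suml.
  rewrite exchange_big; apply: eq_bigr => s _; rewrite -(LK s t)// mulr_sumr.
  by apply: eq_bigr => k _; rewrite mulrA.
have uu : \sum_(k < n) u k * u k = \sum_(s < n) c s * K n s.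
  transitivity (\sum_(k < n) \sum_(s < n) c s * (u k * L s k)).
    by apply: eq_bigr => k _; rewrite {2}/u mulr_sumr; apply: eq_bigr => s _;
      rewrite mulrCA.
  by rewrite exchange_big; apply: eq_bigr => s _; rewrite -mulr_sumr uL.
pose r2 := K n n - \sum_(s < n) c s * K n s.
have r0 : 0 <= r2.
  (* The Schur complement is the value of the quadratic form at (- c, 1), hence nonnegative. *)
  pose e (s : nat) : R := if insub s is Some s' then - c s' else 1.
  have en : e n = 1 by rewrite /e insubF ?ltnn.
  have eE (s : 'I_n) : e s = - c s.
    by rewrite /e insubT//= => ?; congr (- c _); exact: val_inj.
  have := Kpsd n.+1 e; rewrite quadS en expr1n mul1r mulr1.
  have -> : \sum_(s < n) e s * K n s = - \sum_(s < n) c s * K n s.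
    by rewrite -sumrN; apply: eq_bigr => s _; rewrite eE mulNr.
  have -> : \sum_(s < n) \sum_(t < n) e s * e t * K s t = \sum_(s < n) c s * K n s.
    rewrite exchange_big; apply: eq_bigr => t _; rewrite -hc mulr_sumr.
    by apply: eq_bigr => s _; rewrite !eE; ring.
  by rewrite /r2; move: (\sum_(s < n) _) => x; lra.
pose v k := if k == n then Num.sqrt r2 else u k.
have vE (k : 'I_n) : v k = u k by rewrite /v (ltn_eqF (ltn_ord k)).
have vn : v n = Num.sqrt r2 by rewrite /v eqxx.
have vL t : (t < n)%N -> \sum_(k < n.+1) v k * L t k = K n t.
  move=> tn; rewrite big_ord_recr /= (L0 t n)// mulr0 addr0 -(uL (Ordinal tn)).
  by apply: eq_bigr => k _; rewrite vE.
have vv : \sum_(k < n.+1) v k * v k = K n n.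
  rewrite big_ord_recr /= vn -expr2 sqr_sqrtr// /r2 -uu addrC.
  by rewrite [X in _ + X](eq_bigr (fun k : 'I_n => u k * u k)) ?subrK// => k _;
    rewrite vE.
exists v; split=> [s k|s t]; rewrite /extend.
  rewrite ltnS leq_eqVlt => /orP[/eqP ->|sn] sk.
    rewrite eqxx /v gtn_eqF//; apply: big1 => i _.
    by rewrite L0 ?mulr0// (ltn_trans _ sk).
  by rewrite (ltn_eqF sn) L0.
rewrite ltnS leq_eqVlt => /orP[/eqP ->|sn]; rewrite ltnS leq_eqVlt => /orP[/eqP ->|tn].
- by rewrite eqxx vv.
- by rewrite eqxx (ltn_eqF tn) vL.
- by rewrite eqxx (ltn_eqF sn) Ksym -(vL s sn); apply: eq_bigr => k _; rewrite mulrC.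
- by rewrite (ltn_eqF sn) (ltn_eqF tn) big_ord_recr/= (L0 s n)// mul0r addr0 LK.
Qed.

Lemma cholesky : exists L : nat -> nat -> R, forall s t n, (s < n)%N -> (t < n)%N ->
  (forall k, (s < k)%N -> L s k = 0) /\ \sum_(k < n) L s k * L t k = K s t.
Proof.
have /choice[F hF] : forall nL : nat * (nat -> nat -> R), exists v,
    cholesky_prefix nL.1 nL.2 -> cholesky_prefix nL.1.+1 (extend nL.1 nL.2 v).
  move=> [n L]; have [/cholesky_step[v hv]|h] := pselect (cholesky_prefix n L).
    by exists v.
  by exists (fun=> 0).
(* Stage n + 1 rewrites only row [n], so row [s] is final from stage s + 1 on. *)
pose fix S n := if n is n'.+1 then extend n' (S n') (F (n', S n')) else fun _ _ => 0.
have gS n : cholesky_prefix n (S n) by elim: n => [|n /(hF (n, _))//]; split.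
have Sext m s : (s < m)%N -> S m s = S s.+1 s.
  elim: m => // m IH; rewrite ltnS leq_eqVlt => /orP[/eqP ->//|sm].
  by rewrite -IH// [LHS]/= /extend (ltn_eqF sm).
exists (fun s => S s.+1 s) => s t n sn tn; split.
  by move=> k sk; have [h _] := gS s.+1; exact: h.
have [_ h] := gS n; rewrite -(h s t sn tn).
by apply: eq_bigr => k _; rewrite !(Sext n).
Qed.

End cholesky.

Section gaussian_family.
Variable R : realType.
Local Notation P := (uniform_prob (@ltr01 R)).

Let Y n (a : nat -> R) w := \sum_(k < n) a k * normal_seq k w.

Let glawY n a : exists s, glaw P (Y n a) s.
Proof.
exists (Num.sqrt (\sum_(k < n) a k ^+ 2)); apply: glaw_normal_seq.
by rewrite sqr_sqrtr// sumr_ge0// => k _; exact: sqr_ge0.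
Qed.

Let sqrY n a : rint P (fun w => Y n a w ^+ 2) /\
  \int[P]_w (Y n a w ^+ 2) = (\sum_(k < n) a k ^+ 2) * kappa R.
Proof.
have g : glaw P (Y n a) (Num.sqrt (\sum_(k < n) a k ^+ 2)).
  apply: glaw_normal_seq.
  by rewrite sqr_sqrtr// sumr_ge0// => k _; exact: sqr_ge0.
have [_ _ i ->] := glaw_moments g; split => //.
by rewrite sqr_sqrtr// sumr_ge0// => k _; exact: sqr_ge0.
Qed.

Let mulY n a b : \int[P]_w (Y n a w * Y n b w) = (\sum_(k < n) a k * b k) * kappa R.
Proof.
have [i1 e1] := sqrY n (fun k => a k + b k); have [i2 e2] := sqrY n a;
  have [i3 e3] := sqrY n b.
(* Polarisation: only second moments of single combinations are known so far. *)
have -> : (fun w => Y n a w * Y n b w) = fun w => 2^-1 * (Y n (fun k => a k + b k) w ^+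
  2 - Y n a w ^+ 2 - Y n b w ^+ 2).
  apply/funext => w; have -> : Y n (fun k => a k + b k) w = Y n a w + Y n b w.
    by rewrite /Y -big_split; apply: eq_bigr => k _; rewrite mulrDl.
  by rewrite sqrrD; field.
have i4 := rintB i1 i2; rewrite (RintegralZl _ measurableT (rintB i4 i3)).
rewrite (RintegralB measurableT i4 i3) (RintegralB measurableT i1 i2) e1 e2 e3 -!mulrBl
  mulrA; congr (_ * _).
rewrite -!sumrB mulr_sumr; apply: eq_bigr => k _.
by rewrite sqrrD; field.
Qed.

Theorem gaussian_family (I : countType) (K : I -> I -> R) :
  (forall i j, K i j = K j i) ->
  (forall N (c : 'I_N -> R) (i : 'I_N -> I),
     0 <= \sum_s \sum_t c s * c t * K (i s) (i t)) ->
  exists X : I -> R -> R,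
    (forall N (c : 'I_N -> R) (i : 'I_N -> I),
      exists s, glaw P (fun w => \sum_k c k * X (i k) w) s) /\
    forall i j, \int[P]_w (X i w * X j w) = K i j.
Proof.
move=> Ksym Kpsd; have k0 := kappa_gt0 R.
(* The decoding of indices below uses [i0] as a default; when [I] is empty only empty combinations
   occur. *)
have [[i0]|noI] := pselect (inhabited I); last first.
  by exists (fun _ _ => 0); split=> [N c i|i]; last (by case: noI); exists 0;
  case: N c i => [|N] c i; [have := glaw_normal_seq (n := 0) (a := fun=> 0) (r :=
    (0 : R)); rewrite big_ord0 expr0n => /(_ erefl); congr glaw; apply/funext => w;
    rewrite !big_ord0|case: noI; exact: (inhabits (i ord0))].
(* The kernel is moved to the natural numbers, set to zero off the codes of [I], and divided by the
   common variance of the normal sequence. *)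
pose K' m n : R := if unpickle m is Some i then if unpickle n is Some j then K i j /
  kappa R else 0 else 0.
have K'sym m n : K' m n = K' n m.
  by rewrite /K'; case: (unpickle m) (unpickle n) => [i|] [j|]//; rewrite Ksym.
have K'psd N (c : nat -> R) : 0 <= \sum_(s < N) \sum_(t < N) c s * c t * K' s t.
  pose i' (s : 'I_N) := odflt i0 (unpickle s).
  pose c' (s : 'I_N) := if @unpickle I s is Some _ then c s else 0.
  have := Kpsd N c' i'; rewrite -(@pmulr_rge0 _ (kappa R)^-1) ?invr_gt0//;
    congr (0 <= _).
  rewrite mulr_sumr; apply: eq_bigr => s _; rewrite mulr_sumr; apply: eq_bigr => t _.
  rewrite /c' /i' /K'; case: (unpickle s) => [a|] /=; last by rewrite !mul0r !mulr0.
  by case: (unpickle t) => [b|] /=; rewrite ?mulr0 ?mul0r ?mulr0// mulrC mulrA.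
have [L hL] := cholesky K'sym K'psd.
(* Rows vanish past the diagonal, so finitely many variables can be written with a common number of
   terms. *)
have LS s n w : (s < n)%N -> Y s.+1 (L s) w = Y n (L s) w.
  move=> sn; rewrite /Y -(subnKC sn) big_split_ord /= [X in _ + X]big1 ?addr0// => k _.
  by have [-> //] := hL s s s.+1 (ltnSn s) (ltnSn s); rewrite ?mul0r// ltnS leq_addr.
pose X (i : I) w := Y (pickle i).+1 (L (pickle i)) w.
exists X; split=> [N c i|i j].
  pose n := (\max_(k < N) pickle (i k)).+1.
  have ikn k : (pickle (i k) < n)%N by rewrite ltnS; exact: leq_bigmax.
  have [s hs] := glawY n (fun l => \sum_(k < N) c k * L (pickle (i k)) l).
  exists s; move: hs; congr glaw; apply/funext => w.
  rewrite /Y; under eq_bigr do rewrite mulr_suml.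
  rewrite exchange_big; apply: eq_bigr => k _; rewrite /X (LS _ n)// /Y mulr_sumr.
  by apply: eq_bigr => l _; rewrite mulrA.
pose n := (maxn (pickle i) (pickle j)).+1.
have i_n : (pickle i < n)%N by rewrite ltnS leq_maxl.
have j_n : (pickle j < n)%N by rewrite ltnS leq_maxr.
rewrite (_ : (fun w => _) = fun w => Y n (L (pickle i)) w * Y n (L (pickle j)) w);
  last first.
  by apply/funext => w; rewrite /X !(LS _ n).
rewrite mulY; have [_ ->] := hL _ _ n i_n j_n.
by rewrite /K' !pickleK divfK// gt_eqF.
Qed.

End gaussian_family.

(** * Spectral integrals *)

Section probability_forms.
Context {disp : measure_display} {Omega : measurableType disp} {R : realType}.

Lemma L2norm_nrm (m : {finite_measure set Omega -> \bar R}) u : L2 m u ->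
  L2norm m u = (nrm m u)%:E.
Proof.
move=> /L2P[mu iu]; rewrite /L2norm /nrm -powR12_sqrt; last exact: sq_ge0.
by rewrite -poweR_EFin; congr (_ `^ _)%E; rewrite /sq /Rintegral fineK//;
  exact: integrable_fin_num.
Qed.

Lemma cexpectationE (P : probability Omega R) xi : cexpectation P xi = cint P xi.
Proof. by rewrite /cexpectation unlock. Qed.

Lemma expectationE (P : probability Omega R) (xi : Omega -> R) :
  fine ('E_P[xi])%E = \int[P]_w xi w.
Proof. by rewrite unlock. Qed.

End probability_forms.

Section spectral_integral.
Context {R : realType} {nu d : nat}.
Local Notation torus := (torus R nu).
Variables (G : 'I_d -> 'I_d -> complex_measure torus R)
  (mu : {finite_measure set torus -> \bar R}).
Hypothesis Gmu : psd_density G mu.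
Hypothesis Geven : forall j k (A : set torus), measurable A ->
  G j k (@torus_opp R nu @` A) = Num.conj (G j k A).
Variable m : 'I_d -> {finite_measure set torus -> \bar R}.
Hypothesis mE : forall j A, measurable A -> m j A = diag_measure G j A.
Context {disp : measure_display} {Omega : measurableType disp}.
Variable P : probability Omega R.

(* Both the random integral (generated by indicators) and the operators T_j
   (generated by characters) are extensions [J] of some map [e s |-> f j s]. *)
Variables (S : Type) (e : S -> torus -> R[i]) (f : 'I_d -> S -> Omega -> R[i]).

(** The facts about a total family that pass to its whole closed span. Normality is asked of real
    parts of complex combinations, which includes imaginary parts through the factor -i. *)
Record generators : Prop := Generators {
  gen_L2e : forall j s, L2 (m j) (e s);
  gen_total : forall j, total (m j) e;
  gen_L2f : forall j s, L2 P (f j s);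
  gen_cov : forall j k s t, ip P (f j s) (f k t) = cov G j k (e s) (e t);
  gen_mean : forall j s, cint P (f j s) = 0;
  gen_adj : forall s, exists2 t, adj (e s) = e t &
    forall j, {ae P, forall w, f j t w = Num.conj (f j s w)};
  gen_gauss : forall N (c : 'I_N -> R[i]) (p : 'I_N -> 'I_d * S), exists s,
    glaw P (fun w => complex.Re (comb (fun q => f q.1 q.2) c p w)) s }.

Hypothesis gen : generators.

Let L2e j s := gen_L2e gen j s.
Let L2f j s := gen_L2f gen j s.
Let te j : total (m j) e := gen_total gen (j := j).
Let F (q : 'I_d * S) := f q.1 q.2.
Let L2F q : L2 P (F q). Proof. exact: L2f. Qed.

Lemma gen_gram j s t : ip (m j) (e s) (e t) = ip P (f j s) (f j t).
Proof. by rewrite (gen_cov gen) (cov_diag Gmu mE). Qed.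

Lemma spectral_integral_ex : exists J : 'I_d -> (torus -> R[i]) -> Omega -> R[i],
  forall j u, L2 (m j) u -> corr (m j) P e (f j) u (J j u).
Proof.
have /choice[J hJ] : forall j, exists U, forall u,
  L2 (m j) u -> corr (m j) P e (f j) u (U u).
  by move=> j; exact: (corr_fun (L2e j) (L2f j) (gen_gram j) (te (j := j))).
by exists J.
Qed.

Variable J : 'I_d -> (torus -> R[i]) -> Omega -> R[i].
Hypothesis corrJ : forall j u, L2 (m j) u -> corr (m j) P e (f j) u (J j u).

Lemma spectral_isom j : isometry P (m j) (J j).
Proof. exact: (corr_isometry (L2e j) (L2f j) (gen_gram j) (corrJ (j := j))). Qed.

Lemma spectral_gen j s : {ae P, forall w, J j (e s) w = f j s w}.
Proof.
apply: (corr_eq (L2e j) (L2f j) (gen_gram j) (corrJ (L2e j s))); last exact: aeW.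
exact: (corr_single (L2e j) (L2f j)).
Qed.

Lemma spectral_cov j k u v : L2 (m j) u -> L2 (m k) v ->
  ip P (J j u) (J k v) = cov G j k u v.
Proof.
move=> iu iv; have isoj := spectral_isom j; have isok := spectral_isom k.
apply: (form_ext (L2e j) (L2e k) (isometry_sesquilinear isoj isok)
  (isometry_contractive isoj isok) (cov_sesquilinear Gmu mE j k)
  (cov_contractive Gmu mE (j := j) (k := k)) (te (j := j)) (te (j := k))) => // s t.
rewrite -(gen_cov gen); apply: eq_ae_ip; try exact: L2f; try exact: spectral_gen.
  exact: (iso_L2 isoj).
exact: (iso_L2 isok).
Qed.

Lemma spectral_mean j u : L2 (m j) u -> cint P (J j u) = 0.
Proof.
move=> iu; have [_ iJ h] := corrJ iu; apply/cmod_eq0/eqP; rewrite eq_le sqrtr_ge0 andbT.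
apply: (@arbitrarily_small _ _ 1) => // eps e0 _; rewrite mul1r.
have [N [c [s [_ hs]]]] := h eps e0.
have iC := L2_comb (L2f j) c s.
have c0 : cint P (comb (f j) c s) = 0.
  elim: N c s {hs iC} => [|N IH] c s.
    by rewrite comb0; apply: complex_ext; rewrite /= Rintegral0.
  rewrite combS cint_lin; [|exact/L2_rint/L2_comb|exact/L2_rint].
  by rewrite IH (gen_mean gen) !mulr0 addr0.
have -> : cint P (J j u) = cint P (fun w => J j u w - comb (f j) c s w).
  have := cint_lin 1 (-1) (L2_rint iJ) (L2_rint iC); rewrite c0 mulr0 addr0 mul1r => <-.
  by congr cint; apply/funext => w; rewrite mul1r mulN1r.
apply: (le_trans (cint_le_nrm _) (ltW hs)); exact: L2B.
Qed.

Let adj_comb N (c : 'I_N -> R[i]) (s : 'I_N -> S) : exists t : 'I_N -> S,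
  adj (comb e c s) = comb e (Num.conj \o c) t /\
  forall j, {ae P, forall w, comb (f j) (Num.conj \o c) t w = Num.conj (comb (f j) c s
    w)}.
Proof.
have /choice[t ht] : forall k, exists t, adj (e (s k)) = e t /\
    forall j, {ae P, forall w, f j t w = Num.conj (f j (s k) w)}.
  by move=> k; have [t t1 t2] := gen_adj gen (s k); exists t.
exists t; split.
  apply/funext => x; rewrite /adj /comb conj_sum; apply: eq_bigr => k _.
  by rewrite conjM /=; congr (_ * _); rewrite -(ht k).1.
move=> j; have : {ae P, forall w, forall k, f j (t k) w = Num.conj (f j (s k) w)}.
  by apply: filter_forall => k; exact: (ht k).2.
apply: filterS => w hw; rewrite /comb conj_sum; apply: eq_bigr => k _.
by rewrite hw conjM.
Qed.

(** Conjugating an approximating combination conjugates its coefficients and reflects its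
    generators, so conj (J u) corresponds to [adj u]; the graph being single-valued, it is J (adj
    u). *)
Lemma spectral_adj j u : L2 (m j) u ->
  {ae P, forall w, J j (adj u) w = Num.conj (J j u w)}.
Proof.
move=> iu; have iA := L2_adj mE Geven iu; have [_ iJ h] := corrJ iu.
apply: (corr_eq (L2e j) (L2f j) (gen_gram j) (corrJ iA)); last exact: aeW.
split=> //; first exact: L2_conj.
move=> eps e0; have [N [c [s [h1 h2]]]] := h eps e0.
have [t [t1 t2]] := adj_comb c s; exists N, (Num.conj \o c), t; split.
  rewrite -t1 (_ : (fun x => _) = adj (fun x => u x - comb e c s x)); last first.
    by apply/funext => x; rewrite /adj conjB.
  by rewrite (nrm_adj mE Geven)//; exact/L2B/L2_comb.
have iD : L2 P (fun w => J j u w - comb (f j) c s w) by exact/L2B/L2_comb.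
have m1 : cmeasurable (fun w => Num.conj (J j u w) - comb (f j) (Num.conj \o c) t w).
  by apply: L2_cmeasurable; apply: (L2B (L2_conj iJ)); exact: L2_comb.
have m2 := L2_cmeasurable (L2_conj iD).
rewrite (eq_ae_nrm m1 m2); last by move: (t2 j); apply: filterS => w ->; rewrite conjB.
rewrite (_ : nrm P _ = nrm P (fun w => J j u w - comb (f j) c s w))//.
by congr Num.sqrt; apply: eq_Rintegral => w _; rewrite sqmod_conj.
Qed.

Let approx_J j u : L2 (m j) u -> approx P F (J j u).
Proof.
move=> /corrJ[_ _ h] eps /h[N [c [s [_ hs]]]].
by exists N, c, (fun k => (j, s k)).
Qed.

Let approx_gauss g : L2 P g -> approx P F g -> exists s,
  glaw P (fun w => complex.Re (g w)) s.
Proof.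
move=> ig ag; exists (sd P (fun w => complex.Re (g w))); have [[mg1 mg2] _] := ig.
have iRe h : L2 P h -> L2 P (fun w => (complex.Re (h w))%:C) /\
    nrm P (fun w => (complex.Re (h w))%:C) <= nrm P h.
  move=> /L2P[[mh1 mh2] ih].
  have i : rint P (fun w => complex.Re (h w) ^+ 2).
    apply: (rint_le _ ih) => [|w]; first exact: measurable_funX.
    by rewrite ger0_norm ?sqr_ge0// /sqmod lerDl sqr_ge0.
  split.
    apply/L2P; split; first exact: cmeasurable_real.
    by under eq_fun do rewrite sqmod_real.
  rewrite nrm_real /nrm ler_sqrt ?sq_ge0// le_Rintegral// => w _.
  by rewrite /sqmod lerDl sqr_ge0.
apply: glaw_limit => [|eps e0]; first exact: (iRe _ ig).1.
have [N [c [p hp]]] := ag eps e0; have ic := L2_comb L2F c p.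
exists (fun w => complex.Re (comb F c p w)); first exact: (gen_gauss gen).
apply: le_lt_trans hp; have := (iRe _ (L2B ig ic)).2; congr (nrm P _ <= _).
by apply/funext => w; rewrite raddfB/= raddfB.
Qed.

Lemma spectral_gauss N (c : 'I_N -> R[i]) (j : 'I_N -> 'I_d) (u : 'I_N -> torus ->
  R[i]) :
  (forall k, L2 (m (j k)) (u k)) ->
  exists s, glaw P (fun w => complex.Re (\sum_k c k * J (j k) (u k) w)) s.
Proof.
move=> iu; suff [h1 h2] : L2 P (fun w => \sum_k c k * J (j k) (u k) w) /\
    approx P F (fun w => \sum_k c k * J (j k) (u k) w) by exact: approx_gauss.
elim: N c j u iu => [|N IH] c j u iu.
  under eq_fun do rewrite big_ord0; split; first exact: L2_cst.
  move=> eps e0; have s0 : 'I_0 -> 'I_d * S by case.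
  exists 0%N, (fun=> 0), s0.
  by rewrite comb0 nrm_self.
have [i1 a1] := IH (fun k => c (lift ord0 k)) _ _ (fun k => iu (lift ord0 k)).
have iJ : L2 P (J (j ord0) (u ord0)) by exact: (iso_L2 (spectral_isom _)).
have -> : (fun w => \sum_k c k * J (j k) (u k) w) = fun w =>
    c ord0 * J (j ord0) (u ord0) w + 1 * \sum_k c (lift ord0 k) * J (j (lift ord0 k))
      (u (lift ord0 k)) w.
  by apply/funext => w; rewrite big_ord_recl mul1r.
split; first exact: L2_lin.
by apply: approx_lin => //; exact: approx_J.
Qed.

End spectral_integral.

Section finite_index.
Variable R : realType.

Lemma big_enum_ord (K : finType) (V : nmodType) (g : K -> V) :
  \sum_k g k = \sum_(i < #|K|) g (enum_val i).
Proof. by rewrite (reindex _ (onW_bij _ (enum_val_bij K))). Qed.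

Lemma Re_realM (a : R) (z : R[i]) : complex.Re (a%:C * z) = a * complex.Re z.
Proof. by rewrite Re_mul/= mul0r subr0. Qed.

Lemma Re_sum (K : finType) (g : K -> R[i]) :
  complex.Re (\sum_k g k) = \sum_k complex.Re (g k).
Proof. exact: raddf_sum. Qed.

Lemma cindic_bigcup disp (T : measurableType disp) n (A : 'I_n ->
  set T) x : trivIset setT A ->
  cindic (\bigcup_(s in setT) A s) x = \sum_(s < n) cindic (A s) x :> R[i].
Proof.
move=> tA; have [[s _ As]|nA] := pselect ((\bigcup_(s in setT) A s) x).
  rewrite (bigD1 s)//= big1 ?addr0 => [|t ts]; rewrite !cindicE.
    by rewrite !mem_set//; exists s.
  rewrite memNset// => At; move/trivIsetP : tA => /(_ t s Logic.I Logic.I ts)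
    /seteqP[/(_ x) h _].
  exact: h.
rewrite cindicE memNset// big1// => s _; rewrite cindicE memNset// => As.
by apply: nA; exists s.
Qed.

End finite_index.

(** * Fields, random measures and their integrals *)

Section spectral_correspondence.
Context {R : realType} {nu d : nat}.
Local Notation torus := (torus R nu).
Variables (G : 'I_d -> 'I_d -> complex_measure torus R)
  (mu : {finite_measure set torus -> \bar R}).
Hypothesis Gmu : psd_density G mu.
Hypothesis Geven : forall j k (A : set torus), measurable A ->
  G j k (@torus_opp R nu @` A) = Num.conj (G j k A).
Variable m : 'I_d -> {finite_measure set torus -> \bar R}.
Hypothesis mE : forall j A, measurable A -> m j A = diag_measure G j A.
Context {disp : measure_display} {Omega : measurableType disp}.
Variable P : probability Omega R.

Section from_integral.
Variables (S : Type) (e : S -> torus -> R[i]) (f : 'I_d -> S -> Omega -> R[i]).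
Hypothesis gen : generators G m P e f.
Variable J : 'I_d -> (torus -> R[i]) -> Omega -> R[i].
Hypothesis corrJ : forall j u, L2 (m j) u -> corr (m j) P e (f j) u (J j u).

Let isoJ j := spectral_isom Gmu mE gen corrJ j.

Let spectral_gauss_fin (K : finType) (c : K -> R[i]) (j : K -> 'I_d) (u : K -> torus ->
  R[i]) :
  (forall k, L2 (m (j k)) (u k)) ->
  exists s, glaw P (fun w => complex.Re (\sum_k c k * J (j k) (u k) w)) s.
Proof.
pose ev (i : 'I_#|K|) : K := enum_val i.
move=> iu; have [s hs] := spectral_gauss Gmu mE gen corrJ (fun k => c (ev k)) (j :=
  fun k => j (ev k))
  (u := fun k => u (ev k)) (fun k => iu (ev k)).
by exists s; move: hs; congr glaw; apply/funext => w; rewrite [in RHS]big_enum_ord.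
Qed.

Let iso_sum j n (u : 'I_n -> torus -> R[i]) : (forall s, L2 (m j) (u s)) ->
  {ae P, forall w, J j (fun x => \sum_s u s x) w = \sum_s J j (u s) w}.
Proof.
elim: n u => [|n IH] u iu.
  have := iso_lin (isoJ j) 0 0 (L2_cst (m j) 0) (L2_cst (m j) 0).
  apply: filterS => w h; rewrite big_ord0; move: h; rewrite !mul0r addr0 => h.
  rewrite -[RHS]h; congr (J j _ w).
  by apply/funext => x; rewrite big_ord0.
have iS : L2 (m j) (fun x => \sum_s u (lift ord0 s) x).
  have := L2_comb (fun s => iu (lift ord0 s)) (fun=> 1) id; congr L2.
  by apply/funext => x; apply: eq_bigr => s _; rewrite mul1r.
apply: filterS2 (IH _ (fun s => iu (lift ord0 s))) (iso_lin (isoJ j) 1 1 (iu ord0) iS)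
  => w h.
rewrite !mul1r h => h'; rewrite [RHS]big_ord_recl -h'; congr (J j _ w).
by apply/funext => x; rewrite big_ord_recl !mul1r.
Qed.

Lemma integral_spectral_measure : random_spectral_measure P G (fun j A => J j (cindic
  A)).
Proof.
split.
- move=> N A mA c.
  (* The Boolean selects real or imaginary part; the coefficient -i converts the latter into a real
     part. *)
  have [s hs] := spectral_gauss_fin (fun k : bool * ('I_N * 'I_d) =>
    (c k)%:C * (if k.1 then 1 else - 'i)) (j := fun k => k.2.2) (u :=
      fun k => cindic (A k.2.1))
    (fun k => L2_cindic _ (mA _)).
  apply: (@glaw_gaussian _ _ _ _ _ s); move: hs; congr glaw; apply/funext => w.
  rewrite Re_sum; apply: eq_bigr => -[[] [k j]] _; rewrite -mulrA Re_realM /= ?mul1r//.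
  by rewrite -Im_Re.
- move=> j A mA; rewrite cexpectationE; apply: (spectral_mean gen corrJ).
  exact: L2_cindic.
- move=> j k A B mA mB; rewrite cexpectationE -/(ip P _ _).
  rewrite (spectral_cov Gmu mE gen corrJ) ?L2_cindic//; try exact: L2_cindic.
  exact: (cov_ind Gmu j k (exist _ A mA) (exist _ B mB)).
- move=> j n A mA tA; have := iso_sum (fun s => L2_cindic (m j) (mA s)).
  apply: filterS => w <-; congr (J j _ w); apply/funext => x.
  by rewrite cindic_bigcup.
- move=> j A mA; have [B [_ BA Bopp]] := adj_ind (exist _ A mA : @mset _ torus).
  have := spectral_adj Gmu Geven mE gen corrJ (L2_ind (m j) B).
  by rewrite BA /ind Bopp.
Qed.

End from_integral.

Section field.
Variable X : 'I_d -> 'rV[int]_nu -> Omega -> R.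
Hypothesis XG : gaussian_stationary_field_with P X G.

Let gaussian_comb N (a : 'I_N -> R) (j : 'I_N -> 'I_d) (p : 'I_N -> 'rV[int]_nu) :
  gaussian P (fun w => \sum_k a k * X (j k) (p k) w).
Proof.
have [gX _ _ _] := XG.
(* Joint normality concerns all pairs of a time and a component; the coefficients select one
   component at each time. *)
have := gX N p (fun k => if k.2 == j k.1 then a k.1 else 0); congr gaussian;
  apply/funext => w.
rewrite -(pair_bigA _ (fun s i => (if i == j s then a s else 0) * X i (p s) w))/=.
apply: eq_bigr => s _; rewrite (bigD1 (j s))//= eqxx big1 ?addr0// => i /negPf ->.
by rewrite mul0r.
Qed.

Let glaw_single j p : exists s, glaw P (X j p) s.
Proof.
have [_ _ zX _] := XG; exists (sd P (X j p)); apply: gaussian_glaw.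
  have := @gaussian_comb 1 (fun=> 1) (fun=> j) (fun=> p); congr gaussian.
  by apply/funext => w; rewrite big_ord1 mul1r.
by rewrite -expectationE zX.
Qed.

Lemma field_glaw N (a : 'I_N -> R) (j : 'I_N -> 'I_d) (p : 'I_N -> 'rV[int]_nu) :
  exists s, glaw P (fun w => \sum_k a k * X (j k) (p k) w) s.
Proof.
exists (sd P (fun w => \sum_k a k * X (j k) (p k) w)); apply: gaussian_glaw => //.
have rX i q : rint P (X i q) /\ \int[P]_w X i q w = 0.
  by have [s /glaw_moments[]] := glaw_single i q.
suff [] : rint P (fun w => \sum_k a k * X (j k) (p k) w) /\
  \int[P]_w (\sum_k a k * X (j k) (p k) w) = 0 by [].
elim: N a j p => [|N IH] a j p.
  under eq_fun do rewrite big_ord0; split; first exact: finite_measure_integrable_cst.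
  exact: Rintegral0.
have [i1 e1] := IH (fun k => a (lift ord0 k)) (fun k => j (lift ord0 k)) (fun k => p
  (lift ord0 k)).
have [i2 e2] := rX (j ord0) (p ord0); have i3 := rintZ (a ord0) i2.
under eq_fun do rewrite big_ord_recl; split; first exact: rintD.
by rewrite (RintegralD measurableT i3 i1) e1 addr0 (RintegralZl _ measurableT i2) e2
  mulr0.
Qed.

Lemma field_generators : generators G m P (@character R nu) (fun j p w => (X j p w)%:C).
Proof.
have [_ _ zX sX] := XG.
split.
- by move=> j p; exact: L2_character.
- by move=> j; exact: total_character.
- by move=> j p; have [s gs] := glaw_single j p; exact: glaw_L2 gs.
- move=> j k p q; rewrite cov_character -sX expectationE.
  rewrite /ip (_ : (fun w => _) = fun w => (X j p w * X k q w)%:C); last first.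
    by apply/funext => w; rewrite conj_real -rmorphM.
  by apply: complex_ext; rewrite //= Rintegral0.
- move=> j p; apply: complex_ext; rewrite /= ?Rintegral0//.
  by rewrite -expectationE zX.
- move=> p; exists p; first exact: adj_character.
  by move=> j; apply: aeW => w; rewrite conj_real.
- move=> N c p; have [s gs] := field_glaw (fun k => complex.Re (c k)) (fun k => (p
    k).1) (fun k => (p k).2).
  exists s; move: gs; congr glaw; apply/funext => w; rewrite /comb Re_sum.
  by apply: eq_bigr => k _; rewrite mulrC -Re_realM mulrC.
Qed.

Variable T : 'I_d -> (torus -> R[i]) -> Omega -> R[i].

Lemma corr_spectral_isometry :
  (forall j u, L2 (m j) u -> corr (m j) P (@character R nu) (fun p w => (X j p w)%:C) u
    (T j u)) ->
  spectral_isometry P G X T.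
Proof.
move=> corrT; have gen := field_generators;
  have isoT j := spectral_isom Gmu mE gen corrT j.
have L2f j := gen_L2f gen j; have gram j := gen_gram Gmu mE gen j.
split.
- move=> j u /(L2_diag mE) iu; have [_ iT h] := corrT j u iu; split=> // eps e0.
  have [N [c [p [_ hp]]]] := h eps e0; exists N, c, p.
  rewrite -/(comb (fun p w => (X j p w)%:C) c p) L2norm_nrm ?lte_fin//.
  by apply: (L2B iT); exact: (L2_comb (L2f j)).
- move=> j xi [ixi h].
  have axi : approx P (fun p w => (X j p w)%:C) xi.
    move=> eps e0; have [N [c [p]]] := h eps e0; rewrite L2norm_nrm ?lte_fin;
      first by exists N, c, p.
    by apply: (L2B ixi); exact: (L2_comb (L2f j)).
  (* The preimage is built by running the extension backwards, from the field to the characters. *)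
  have [u /corr_sym cu] := corr_exists (L2f j) (gen_L2e gen j) (fun s t => esym (gram j
    s t)) ixi axi.
  have [iu _ _] := cu; exists u; first exact/(L2_diag mE).
  by apply: (corr_eq (gen_L2e gen j) (L2f j) (gram j) (corrT j u iu) cu); exact: aeW.
- by move=> j u v a b /(L2_diag mE) iu /(L2_diag mE) iv; exact: (iso_lin (isoT j)).
- move=> j u /(L2_diag mE) iu; rewrite (L2norm_diag mE) !L2norm_nrm//;
    last exact: (iso_L2 (isoT j)).
  by rewrite (iso_nrm (isoT j)).
- move=> j N c p.
  have cc := corr_comb (gen_L2e gen j) (L2f j) c p; have [ic _ _] := cc.
  by apply: (corr_eq (gen_L2e gen j) (L2f j) (gram j) (corrT j _ ic) cc); exact: aeW.
Qed.

Lemma spectral_isometry_corr : spectral_isometry P G X T -> forall j u, L2 (m j) u ->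
  corr (m j) P (@character R nu) (fun p w => (X j p w)%:C) u (T j u).
Proof.
move=> iT j; have gen := field_generators.
have isoT : isometry P (m j) (T j).
  split=> [v iv|a b v v' iv iv'|v iv]; have jv := (L2_diag mE j v).2 iv.
  - by have [] := si_range iT jv.
  - exact: (si_linear iT a b jv ((L2_diag mE j v').2 iv')).
  - have [iTv _] := si_range iT jv; have := si_norm iT jv.
    by rewrite (L2norm_diag mE) !L2norm_nrm//; exact: EFin_inj.
have genT p : {ae P, forall w, T j (character p) w = (X j p w)%:C}.
  have := si_character iT j (fun _ : 'I_1 => 1) (fun=> p).
  apply: filterS => w; rewrite big_ord1 mul1r => <-; congr (T j _ w).
  by apply/funext => x; rewrite big_ord1 mul1r.
move=> u iu.
exact: (isometry_corrP (gen_L2e gen j) (gen_L2f gen j) isoT (gen_total gen (j :=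
  j)) genT iu).
Qed.

End field.

Section measure.
Variable Z : 'I_d -> set torus -> Omega -> R[i].
Hypothesis ZG : random_spectral_measure P G Z.

Let gaussian_comb N (c : 'I_N -> R[i]) (j : 'I_N -> 'I_d) (A : 'I_N -> @mset _ torus) :
  gaussian P (fun w => complex.Re (\sum_k c k * Z (j k) (sval (A k)) w)).
Proof.
(* The coefficients come from Re (c z) = Re c Re z - Im c Im z, supported on the selected
   components. *)
have := rsm_gaussian ZG (fun s => svalP (A s)) (fun k : bool * ('I_N * 'I_d) =>
  if k.2.2 == j k.2.1 then (if k.1 then complex.Re (c k.2.1) else - complex.Im (c
    k.2.1)) else 0).
congr gaussian; apply/funext => w; rewrite Re_sum.
pose F (b : bool) s i : R := (if i == j s then (if b then complex.Re (c s) else -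
  complex.Im (c s)) else 0) *
  (if b then complex.Re (Z i (sval (A s)) w) else complex.Im (Z i (sval (A s)) w)).
rewrite (eq_bigr (fun k => F k.1 k.2.1 k.2.2)); last by move=> [[] [s i]].
rewrite -(pair_bigA _ (fun b q => F b q.1 q.2))/= exchange_big.
rewrite -(pair_bigA _ (fun s i => \sum_b F b s i))/= /F.
apply: eq_bigr => s _; rewrite (bigD1 (j s))//= eqxx [X in _ + X]big1 ?addr0;
  last first.
  by move=> i /negPf ->; rewrite big1// => b _; rewrite mul0r.
by rewrite big_bool/= Re_mul mulNr.
Qed.

Let glaw_single j (A : @mset _ torus) :
  (exists s, glaw P (fun w => complex.Re (Z j (sval A) w)) s) /\
  (exists s, glaw P (fun w => complex.Im (Z j (sval A) w)) s).
Proof.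
have := rsm_mean ZG j (svalP A); rewrite cexpectationE => z0.
split; eexists; apply: gaussian_glaw.
- have := @gaussian_comb 1 (fun=> 1) (fun=> j) (fun=> A); congr gaussian.
  by apply/funext => w; rewrite big_ord1 mul1r.
- exact: (congr1 (fun z => complex.Re z) z0).
- have := @gaussian_comb 1 (fun=> - 'i) (fun=> j) (fun=> A); congr gaussian.
  by apply/funext => w; rewrite big_ord1 -Im_Re.
- exact: (congr1 (fun z => complex.Im z) z0).
Qed.

Let L2Z j (A : @mset _ torus) : L2 P (Z j (sval A)).
Proof.
have [[s gs] [t gt]] := glaw_single j A.
have := L2_lin 1 'i (glaw_L2 gs) (glaw_L2 gt); congr L2; apply/funext => w.
apply: complex_ext; rewrite !ReImE /=; ring.
Qed.

Lemma measure_generators : generators G m P (@ind _ torus R) (fun j A => Z j (sval A)).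
Proof.
have mean0 j (A : @mset _ torus) : cint P (Z j (sval A)) = 0.
  by rewrite -cexpectationE; exact: (rsm_mean ZG j (svalP A)).
split => //.
- by move=> j A; exact: L2_ind.
- by move=> j; exact: total_ind.
- move=> j k A B; rewrite (cov_ind Gmu) -(rsm_cov ZG j k (svalP A) (svalP B)).
  by rewrite cexpectationE.
- move=> A; have [B [AB _ Bopp]] := adj_ind A; exists B => // j.
  by have := rsm_even ZG j (svalP A); apply: filterS => w ->; rewrite -Bopp conjCK.
- move=> N c p; eexists; apply: gaussian_glaw.
    by have := gaussian_comb c (fun k => (p k).1) (fun k => (p k).2).
  suff [_ h] : cintegrable P (comb (fun q => Z q.1 (sval q.2)) c p) /\
      cint P (comb (fun q => Z q.1 (sval q.2)) c p) = 0.
    exact: (congr1 (fun z => complex.Re z) h).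
  elim: N c p => [|N IH] c p.
    rewrite comb0; split; first exact/L2_rint/L2_cst.
    by apply: complex_ext; rewrite /= Rintegral0.
  rewrite combS; have [i1 e1] := IH (c \o lift ord0) (p \o lift ord0).
  have i2 := L2_rint (L2Z (p ord0).1 (p ord0).2).
  rewrite cint_lin// e1 mean0 !mulr0 addr0; split => //.
  by apply: cintegrableD; exact: cintegrableZ.
Qed.

Variable I : 'I_d -> (torus -> R[i]) -> Omega -> R[i].

Lemma corr_random_integral :
  (forall j u, L2 (m j) u -> corr (m j) P (@ind _ torus R) (fun A => Z j (sval A)) u (I
    j u)) ->
  random_integral P G Z I.
Proof.
move=> corrI; have gen := measure_generators;
  have isoI j := spectral_isom Gmu mE gen corrI j.
have L2f j := gen_L2f gen j; have gram j := gen_gram Gmu mE gen j.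
split.
- by move=> j u /(L2_diag mE); exact: (iso_L2 (isoI j)).
- move=> j N A c mA tA.
  have cc := corr_comb (gen_L2e gen j) (L2f j) c (fun s => exist _ (A s) (mA s));
    have [ic _ _] := cc.
  by apply: (corr_eq (gen_L2e gen j) (L2f j) (gram j) (corrI j _ ic) cc); exact: aeW.
- move=> j u /(L2_diag mE) iu eps e0; exists eps => // v /(L2_diag mE) iv.
  have iIu := iso_L2 (isoI j) iu; have iIv := iso_L2 (isoI j) iv.
  rewrite (L2norm_diag mE) !L2norm_nrm; try exact: L2B.
  have := corr_nrm (gen_L2e gen j) (L2f j) (gram j) (corr_lin (gen_L2e gen j) (L2f j) 1
    (-1) (corrI j u iu) (corrI j v iv)).
  rewrite (_ : (fun x => _) = fun x => u x - v x); last by apply/funext => x;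
    rewrite mul1r mulN1r.
  rewrite [X in _ = nrm P X](_ : _ = fun w => I j u w - I j v w);
    last by apply/funext => w; rewrite mul1r mulN1r.
  by move=> ->.
Qed.

(** Values on elementary functions and continuity already pin down the graph: an approximation of
    [u] by simple functions is transported by both properties. *)
Lemma random_integral_corr : random_integral P G Z I -> forall j u, L2 (m j) u ->
  corr (m j) P (@ind _ torus R) (fun A => Z j (sval A)) u (I j u).
Proof.
move=> rI j u iu; have iu' := (L2_diag mE j u).2 iu; have iI := ri_L2 rI iu'.
split=> // eps e0; have [delta d0 hd] := ri_continuous rI iu' e0.
(* The same combination must be eps-close to [u] and delta-close for the continuity of the
   integral. *)
have md0 : 0 < Num.min delta eps by rewrite lt_min d0 e0.
have [N [c [A hA]]] := total_ind iu md0.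
(* Elementary functions are given by disjoint sets, so the combination is rewritten over atoms. *)
have [N' [c' [B [mB tB E]]]] := comb_ind_disjoint c A.
exists N', c', (fun s => exist _ (B s) (mB s)).
have E' : comb (@ind _ torus R) c' (fun s => exist _ (B s) (mB s)) = comb (@ind _ torus
  R) c A.
  by rewrite E.
rewrite E'; move: hA; rewrite lt_min => /andP[h1 h2]; split => //.
have iC := L2_comb (L2_ind (m j)) c A; have iC' := (L2_diag mE j _).2 iC.
have := hd _ iC'; rewrite (L2norm_diag mE) L2norm_nrm; last exact: L2B.
have iIC := ri_L2 rI iC'.
rewrite lte_fin => /(_ h1); rewrite L2norm_nrm; last exact: L2B.
rewrite lte_fin; apply: le_lt_trans; rewrite le_eqVlt; apply/orP; left; apply/eqP.
have iZ := L2_comb (gen_L2f measure_generators j) c' (fun s => exist _ (B s) (mB s)).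
apply: eq_ae_nrm; [exact: L2_cmeasurable (L2B iI iZ)|exact: L2_cmeasurable (L2B iI
  iIC)|].
have := ri_elementary rI j c' mB tB; apply: filterS => w h.
by rewrite E h.
Qed.

End measure.

End spectral_correspondence.

(** * Stationarity and existence of the field *)

Section fields.
Context {R : realType} {nu d : nat}.
Local Notation torus := (torus R nu).
Variables (G : 'I_d -> 'I_d -> complex_measure torus R)
  (mu : {finite_measure set torus -> \bar R}).
Hypothesis Gmu : psd_density G mu.
Hypothesis Geven : forall j k (A : set torus), measurable A ->
  G j k (@torus_opp R nu @` A) = Num.conj (G j k A).
Variable m : 'I_d -> {finite_measure set torus -> \bar R}.
Hypothesis mE : forall j A, measurable A -> m j A = diag_measure G j A.
Context {disp : measure_display} {Omega : measurableType disp}.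
Variables (P : probability Omega R) (X : 'I_d -> 'rV[int]_nu -> Omega -> R).
Hypothesis glawX : forall N (a : 'I_N -> R) (j : 'I_N -> 'I_d) (p : 'I_N ->
  'rV[int]_nu),
  exists s, glaw P (fun w => \sum_k a k * X (j k) (p k) w) s.
Hypothesis covX : forall j k p q, \int[P]_w (X j p w * X k q w) =
  complex.Re (cov G j k (character p) (character q)).

Let glaw_single j p : exists s, glaw P (X j p) s.
Proof.
have [s hs] := glawX (fun _ : 'I_1 => 1) (fun=> j) (fun=> p); exists s; move: hs.
by congr glaw; apply/funext => w; rewrite big_ord1 mul1r.
Qed.

Let glaw_fin (K : finType) (a : K -> R) (j : K -> 'I_d) (p : K -> 'rV[int]_nu) :
  exists s, glaw P (fun w => \sum_k a k * X (j k) (p k) w) s.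
Proof.
pose ev (i : 'I_#|K|) : K := enum_val i.
have [s hs] := glawX (a \o ev) (j \o ev) (p \o ev); exists s; move: hs.
by congr glaw; apply/funext => w; rewrite [in RHS]big_enum_ord.
Qed.

Let spectralX : has_spectral_measure P X G.
Proof.
move=> j k p q; rewrite expectationE covX -cov_character.
by apply: complex_ext => //; rewrite (cov_character_real Gmu mE Geven).
Qed.

Let F (q : 'I_d * 'rV[int]_nu) w : R[i] := (X q.1 q.2 w)%:C.

Let L2F q : L2 P (F q).
Proof. by have [s gs] := glaw_single q.1 q.2; exact: glaw_L2 gs. Qed.

Let ipF q r : ip P (F q) (F r) = cm_integral (G q.1 r.1) (character (q.2 - r.2)).
Proof.
rewrite -spectralX expectationE /ip.
rewrite (_ : (fun w => _) = fun w => (X q.1 q.2 w * X r.1 r.2 w)%:C); last first.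
  by apply/funext => w; rewrite conj_real -rmorphM.
by apply: complex_ext; rewrite //= Rintegral0.
Qed.

(** Inner products depend only on differences of times, so a shift preserves the norm of every
    combination, and with it the scale of its normal law. *)
Let sd_shift (K : finType) (a : K -> R) (j : K -> 'I_d) (p : K -> 'rV[int]_nu) t :
  sd P (fun w => \sum_k a k * X (j k) (p k + t) w) = sd P (fun w => \sum_k a k * X (j
    k) (p k) w).
Proof.
pose ev (i : 'I_#|K|) : K := enum_val i; congr (_ / _).
pose F' (q : 'I_d * 'rV[int]_nu) := F (q.1, q.2 + t).
have gram q r : ip P (F' q) (F' r) = ip P (F q) (F r).
  by rewrite !ipF /= opprD addrACA subrr addr0.
have := nrm_comb (fun q => L2F (q.1, q.2 + t)) L2F gram (fun i => (a (ev i))%:C)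
  (fun i => (j (ev i), p (ev i))).
by congr (nrm P _ = nrm P _); apply/funext => w; rewrite big_enum_ord rmorph_sum;
  apply: eq_bigr => i _; rewrite rmorphM.
Qed.

Let stationaryX : stationary_field P X.
Proof.
move=> N p t B mB.
(* The index type is what two applications of [generates_tuple] to [generates_id] produce. *)
pose c (k : 'I_N * ('I_d * unit)) (x : N.-tuple (d.-tuple R)) : R :=
  tnth (tnth x k.1) k.2.1.
have mc k : measurable_fun setT (c k).
  exact: (measurableT_comp (measurable_tnth k.2.1) (measurable_tnth k.1)).
have gc : generates c := generates_tuple (generates_tuple (@generates_id R)).
have mX j q : measurable_fun setT (X j q) by have [s []] := glaw_single j q.
have ms q : measurable_fun setT (field_sample X (N := N) q).
  apply/measurable_fun_tnthP => s;
    rewrite [X in measurable_fun _ X](_ : _ = fun w => [tuple X j (q s) w | j < d]).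
    apply/measurable_fun_tnthP => j;
      rewrite [X in measurable_fun _ X](_ : _ = X j (q s))//.
    by apply/funext => w; rewrite /= tnth_mktuple.
  by apply/funext => w; rewrite /= tnth_mktuple.
have phaseE a q w : phase c a (field_sample X (N :=
  N) q w) = \sum_k a k * X k.2.1 (q k.1) w.
  by apply: eq_bigr => k _; rewrite /c !tnth_mktuple.
apply: (glaw_unique mc gc (ms _) (ms _)) => // a.
have [s gs] := glaw_fin a (fun k => k.2.1) (fun k => p k.1 + t).
have [s' gs'] := glaw_fin a (fun k => k.2.1) (fun k => p k.1).
have := glaw_sd gs; have := glaw_sd gs'; rewrite sd_shift => g1 g2.
exists (sd P (fun w => \sum_k a k * X k.2.1 (p k.1) w)).
  by under eq_fun do rewrite phaseE.
by under eq_fun do rewrite phaseE.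
Qed.

Lemma gaussian_stationary_field : gaussian_stationary_field_with P X G.
Proof.
split => //.
- move=> N p c; have [s gs] := glaw_fin c (fun k => k.2) (fun k => p k.1).
  exact: glaw_gaussian gs.
- move=> j p; have [s /glaw_moments[i e _ _]] := glaw_single j p.
  by rewrite unlock -[LHS]fineK; [congr EFin|exact: integrable_fin_num i].
Qed.

End fields.

Section existence.
Context {R : realType} {nu d : nat}.
Local Notation torus := (torus R nu).
Variables (G : 'I_d -> 'I_d -> complex_measure torus R)
  (mu : {finite_measure set torus -> \bar R}).
Hypothesis Gmu : psd_density G mu.
Hypothesis Geven : forall j k (A : set torus), measurable A ->
  G j k (@torus_opp R nu @` A) = Num.conj (G j k A).
Variable m : 'I_d -> {finite_measure set torus -> \bar R}.
Hypothesis mE : forall j A, measurable A -> m j A = diag_measure G j A.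

(** The index set of component and time is countable, and the real parts of the covariances of
    characters form a symmetric positive semidefinite kernel on it. *)
Lemma gaussian_field_exists : exists X : 'I_d -> 'rV[int]_nu -> R -> R,
  gaussian_stationary_field_with (uniform_prob (@ltr01 R)) X G.
Proof.
pose K (i j : 'I_d * 'rV[int]_nu) :=
  complex.Re (cov G i.1 j.1 (character i.2) (character j.2)).
have Ksym i j : K i j = K j i.
  rewrite /K (cov_conj Gmu mE (L2_character (m j.1) j.2) (L2_character (m i.1) i.2)).
  exact: complex_Re_conj.
have Kpsd N (c : 'I_N -> R) (i : 'I_N -> 'I_d * 'rV[int]_nu) :
    0 <= \sum_s \sum_t c s * c t * K (i s) (i t).
  exact: (cov_psd Gmu mE c (fun s => (i s).1) (fun s => (i s).2)).
have [X [X1 X2]] := gaussian_family Ksym Kpsd.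
exists (fun j p => X (j, p)).
apply: (gaussian_stationary_field Gmu Geven mE) => [N a j p|j k p q].
  by have [s hs] := X1 N a (fun k => (j k, p k)); exists s.
by rewrite X2.
Qed.

End existence.

Theorem theorem3p1 (R : realType) (nu d : nat)
    (G : 'I_d -> 'I_d -> complex_measure (torus R nu) R)
    (G_psd_even : psd_even_measure G) :
  (* (1) *)
  (exists (disp : measure_display) (Omega : measurableType disp)
      (P : probability Omega R)
      (Z : 'I_d -> set (torus R nu) -> Omega -> R[i]),
    random_spectral_measure P G Z) /\
  (* (2) *)
  (forall (disp : measure_display) (Omega : measurableType disp)
      (P : probability Omega R)
      (Z : 'I_d -> set (torus R nu) -> Omega -> R[i]),
    random_spectral_measure P G Z ->
    (exists I : 'I_d -> (torus R nu -> R[i]) -> Omega -> R[i],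
      random_integral P G Z I) /\
    (forall I : 'I_d -> (torus R nu -> R[i]) -> Omega -> R[i],
      random_integral P G Z I ->
      [/\ (forall j u v (a b : R[i]), Kspace G j u -> Kspace G j v ->
            {ae P, forall w, I j (fun x => a * u x + b * v x) w =
                             a * I j u w + b * I j v w}),
          (forall j j' u v, Kspace G j u -> Kspace G j' v ->
            cexpectation P (fun w => I j u w * Num.conj (I j' v w)) =
            cm_integral (G j j') (fun x => u x * Num.conj (v x))),
          (forall j u, Kspace G j u -> cexpectation P (I j u) = 0)
        & (forall mu : {finite_measure set (torus R nu) -> \bar R},
            psd_density G mu -> even_measure mu ->
            forall j u, Kspace G j u ->
            {ae mu, forall x, u (torus_opp x) = Num.conj (u x)} ->
            {ae P, forall w, complex.Im (I j u w) = 0})])) /\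
  (* (3) *)
  (forall (disp : measure_display) (Omega : measurableType disp)
      (P : probability Omega R)
      (Z : 'I_d -> set (torus R nu) -> Omega -> R[i])
      (I : 'I_d -> (torus R nu -> R[i]) -> Omega -> R[i]),
    random_spectral_measure P G Z -> random_integral P G Z I ->
    let X j p w := complex.Re (I j (character p) w) in
    (forall j p, {ae P, forall w, (X j p w)%:C = I j (character p) w}) /\
    gaussian_stationary_field_with P X G) /\
  (* (4) *)
  (forall (disp : measure_display) (Omega : measurableType disp)
      (P : probability Omega R) (X : 'I_d -> 'rV[int]_nu -> Omega -> R),
    gaussian_stationary_field_with P X G ->
    (exists T : 'I_d -> (torus R nu -> R[i]) -> Omega -> R[i],
      spectral_isometry P G X T) /\
    (forall T : 'I_d -> (torus R nu -> R[i]) -> Omega -> R[i],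
      spectral_isometry P G X T ->
      let Z j A := T j (cindic A) in
      random_spectral_measure P G Z /\
      (forall I : 'I_d -> (torus R nu -> R[i]) -> Omega -> R[i],
        random_integral P G Z I ->
        forall j p,
          {ae P, forall w, I j (character p) w = (X j p w)%:C}))).
Proof.
have [[mu Gmu] Geven] := G_psd_even.
have /choice[m mE] := diag_measure_ex Gmu.
have part4 (disp : measure_display) (Omega : measurableType disp)
    (P : probability Omega R) (X : 'I_d -> 'rV[int]_nu -> Omega -> R) :
  gaussian_stationary_field_with P X G ->
  (exists T : 'I_d -> (torus R nu -> R[i]) -> Omega -> R[i],
    spectral_isometry P G X T) /\
  (forall T : 'I_d -> (torus R nu -> R[i]) -> Omega -> R[i],
    spectral_isometry P G X T ->
    let Z j A := T j (cindic A) in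
    random_spectral_measure P G Z /\
    (forall I : 'I_d -> (torus R nu -> R[i]) -> Omega -> R[i],
      random_integral P G Z I ->
      forall j p,
        {ae P, forall w, I j (character p) w = (X j p w)%:C})).
  move=> XG; have gen := field_generators m XG; split.
    have [T hT] := spectral_integral_ex Gmu mE gen.
    by exists T; exact: (corr_spectral_isometry Gmu mE XG).
  move=> T iT Z; have cT := spectral_isometry_corr mE XG iT.
  have ZG : random_spectral_measure P G Z by exact: (integral_spectral_measure Gmu
    Geven mE gen cT).
  split=> // I rI j p.
  have genZ := measure_generators Gmu m ZG.
  have cI := random_integral_corr Gmu mE ZG rI (L2_character (m j) p).
  have isoT := spectral_isom Gmu mE gen cT j.
  (* By definition T takes the values of Z on indicators, so T and the random integral have the same
     graph over Z and agree at the character. *)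
  have TZ (A : @mset _ (torus R nu)) : {ae P, forall w,
    T j (ind A) w = Z j (sval A) w} by exact: aeW.
  have cT' := isometry_corrP (gen_L2e genZ j) (gen_L2f genZ j) isoT (gen_total genZ (j
    := j)) TZ
    (L2_character (m j) p).
  have := corr_eq (gen_L2e genZ j) (gen_L2f genZ j) (gen_gram Gmu mE genZ j) cI cT'
    (aeW _ (fun=> erefl)).
  by apply: filterS2 (spectral_gen Gmu mE gen cT j p) => w -> ->.
split; [|split; [|split]] => //.
(* The random measure is read off from a constructed field through its operators T_j. *)
- have [X XG] := gaussian_field_exists Gmu Geven mE.
  have [[T iT] /(_ T iT) [ZG _]] := part4 _ _ _ _ XG.
  by do 4 eexists; exact: ZG.
- move=> disp Omega P Z ZG; have gen := measure_generators Gmu m ZG; split.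
    have [I hI] := spectral_integral_ex Gmu mE gen.
    by exists I; exact: (corr_random_integral Gmu mE ZG).
  move=> I rI; have cI := random_integral_corr Gmu mE ZG rI.
  have isoI j := spectral_isom Gmu mE gen cI j.
  split.
  + by move=> j u v a b /(L2_diag mE) iu /(L2_diag mE) iv; exact: (iso_lin (isoI j)).
  + move=> j k u v /(L2_diag mE) iu /(L2_diag mE) iv.
    by rewrite cexpectationE; exact: (spectral_cov Gmu mE gen cI iu iv).
  + by move=> j u /(L2_diag mE) iu; rewrite cexpectationE;
    exact: (spectral_mean gen cI iu).
  + move=> mu' Gmu' _ j u /(L2_diag mE) iu hu.
    (* The diagonal measure is dominated by any [mu'] admitting densities, so symmetry of [u] off a
       null set of [mu'] suffices. *)
    have uA : {ae m j, forall x, adj u x = u x}.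
      have := dominated_ae (diag_dominated Gmu' mE j) hu; apply: filterS => x hx.
      by rewrite /adj hx conjCK.
    (* [u] and [adj u] have the same integral, and that of [adj u] is the conjugate: the imaginary
       part equals its own opposite. *)
    have := corr_eq (gen_L2e gen j) (gen_L2f gen j) (gen_gram Gmu mE gen j)
      (cI j _ (L2_adj mE Geven iu)) (cI j u iu) uA.
    apply: filterS2 (spectral_adj Gmu Geven mE gen cI iu) => w -> h.
    by have := congr1 (fun z => complex.Im z) h; rewrite complex_Im_conj => ?; lra.
- move=> disp Omega P Z I ZG rI X; have gen := measure_generators Gmu m ZG.
  have cI := random_integral_corr Gmu mE ZG rI.
  have isoI j := spectral_isom Gmu mE gen cI j.
  (* Characters are fixed by [adj], so their integrals are real. *)
  have XI j p : {ae P, forall w, (X j p w)%:C = I j (character p) w}.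
    have := spectral_adj Gmu Geven mE gen cI (L2_character (m j) p);
      rewrite adj_character.
    apply: filterS => w h; apply: complex_ext => //=.
    by have := congr1 (fun z => complex.Im z) h; rewrite complex_Im_conj => ?; lra.
  split=> //; apply: (gaussian_stationary_field Gmu Geven mE) => [N a j p|j k p q].
    have [s hs] := spectral_gauss Gmu mE gen cI (fun k => (a k)%:C) (fun k =>
      L2_character (m (j k)) (p k)).
    exists s; move: hs; congr glaw; apply/funext => w; rewrite Re_sum.
    by apply: eq_bigr => k _; rewrite Re_realM.
  have iI i r : L2 P (I i (character r)) by exact: (iso_L2 (isoI i) (L2_character (m i)
    r)).
  have iX i r : L2 P (fun w => (X i r w)%:C).
    apply: eq_ae_L2 (iI i r); last by move: (XI i r); apply: filterS.
    by case: (iI i r) => -[mI _] _; exact: cmeasurable_real.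
  rewrite -(spectral_cov Gmu mE gen cI (L2_character (m j) p) (L2_character (m k) q)).
  rewrite -(eq_ae_ip (iX j p) (iX k q) (iI j p) (iI k q) (XI j p) (XI k q)).
  rewrite /ip /cint/=; apply: eq_Rintegral => w _.
  by rewrite oppr0 mulr0 subr0.
Qed.
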